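(* Let $\alpha\in\mathbb{Z}_{>1}$ and let $p>q\ge 1$ be integers with $\alpha=p+q-1$. Put $$g_0=\gcd(p,q),\quad g_1=\gcd(p-1,q),\quad g_2=\gcd(p,q-1).$$ Then the number of connected components of the moduli space $\mathcal{M}hcmu_{0,1}(\alpha)$ consisting of HCMU spheres with $p$ maximum points and $q$ minimum points of the curvature, equivalently the number of WBP-trees (up to being the same) with $\#V^+=p$, $\#V^-=q$, $\mathrm{wt}(x)=q$ for all $x\in V^+$ and $\mathrm{wt}(y)=p$ for all $y\in V^-$, is $$G(1)+\sum_{1<d\mid g_1}\varphi(d)\,G(d)+\sum_{1<d\mid g_2}\varphi(d)\,G(d),$$ where $\varphi$ is Euler's totient function and $G$ is defined as follows. With $S_1=\{(n_1,\dots,n_{g_0})\in\mathbb{Z}_{\ge0}^{g_0} : \sum_{j=1}^{g_0}jn_j=g_0\}$, $$G(1)=\sum_{(n_1,\dots,n_{g_0})\in S_1}\mathcal{C}_1(n_1,\dots,n_{g_0}),$$ $$\mathcal{C}_1(n_1,\dots,n_{g_0})=(-1)^{n-1}(p+q-1)^{n-2}\prod_{j=1}^{g_0}\frac{1}{n_j!}\left[\frac{\left(\frac{j(p+q)}{g_0}-1\right)!}{\left(\frac{jp}{g_0}\right)!\left(\frac{jq}{g_0}\right)!}\right]^{n_j},\qquad n=\sum_{j=1}^{g_0}n_j.$$ For $d>1$ with $d\mid g_1$ or $d\mid g_2$, with $S_d=\{(s,n_1,\dots,n_{g_0})\in\mathbb{Z}_{\ge0}^{g_0+1} : s+\sum_{j=1}^{g_0}jn_j=\lfloor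 g_0/d\rfloor\}$, $$G(d)=\sum_{(s,n_1,\dots,n_{g_0})\in S_d}\mathcal{C}_d(s,n_1,\dots,n_{g_0}),$$ $$\mathcal{C}_d(s,n_1,\dots,n_{g_0})=(-1)^{n-1}\frac{(p+q-1)^{n-2}}{d^{\,n-1}}\binom{\left(s+\{\frac{g_0}{d}\}\right)\frac{p+q}{g_0}-\frac1d}{\left(s+\{\frac{g_0}{d}\}\right)\frac{r}{g_0}}\prod_{j=1}^{g_0}\frac{1}{n_j!}\left[\frac{\left(\frac{j(p+q)}{g_0}-1\right)!}{\left(\frac{jp}{g_0}\right)!\left(\frac{jq}{g_0}\right)!}\right]^{n_j},$$ where $n=1+\sum_{j=1}^{g_0}n_j$, and $r=q$ if $1<d\mid g_1$, $r=p$ if $1<d\mid g_2$.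
   Context: $\lfloor x\rfloor$ and $\{x\}=x-\lfloor x\rfloor$ denote integer and fractional part of a real number $x$. **WBP-trees.** A weighted bi-colored plane tree (WBP-tree) is a triple $T=(V,E,\mathcal{W})$ where $(V,E)$ is a finite tree embedded in the Euclidean plane $\mathbb{R}^2$, $V=V^+\sqcup V^-$ is a partition (black points $V^+$, white points $V^-$) such that every edge joins a vertex of $V^+$ to a vertex of $V^-$, and $\mathcal{W}:E\to\mathbb{Z}_+$ is a weight function ($\mathbb{Z}_+$ = positive integers). The weight $\mathrm{wt}(v)$ of a vertex $v$ is the sum of the weights of the edges adjacent to $v$. Two WBP-trees are regarded as the same if there is an orientation-preserving homeomorphism of $\mathbb{R}^2$ carrying one embedded graph to the other and preserving vertex colors and edge weights. **HCMU surfaces.** An HCMU metric on a compact Riemann surface is an extremal Kähler metric with finitely many singularities: a conformal metric, smooth away from finitely many points, of finite area and finite Calabi energy, whose curvature $K$ satisfies the Euler–Lagrange equation $K_{,zz}=0$ (second covariant derivative of type $(2,0)$), and whose singularities are conical points (angle $2\pi\alpha_i$) or cusps (regarded as cone points of angle zero). $\mathcal{M}hcmu_{0,1}(\alpha)$ is the set of isometry classes (orientation-preserving) of HCMU surfaces of genus $0$ with exactly one singularity, a conical point of angle $2\pi\alpha$. Maximum/minimum points mean maximum/minimum points of $K$. **Data description and topology.** A football is a sphere with an HCMU metric whose curvature has one maximum point, one minimum point and no saddle point. By a known theorem of Lu–Xu, HCMU surfaces of genus $0$ with exactly one singularity, a conical point of angle $2\pi\alpha$, whose singularity is a saddle point of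 $K$ (which is the case when $p>q\ge1$, $\alpha=p+q-1$) correspond bijectively to data $(E,V^+\sqcup V^-;K_0,R;\mathcal{W},\mathcal{L})$ on the sphere: $E$ is a finite collection of arcs (one per football of the decomposition), forming a bi-colored graph on the sphere with vertex set $V^+\sqcup V^-$, where $V^+$ is the set of maximum points and $V^-$ the set of minimum points, each edge joining $V^+$ to $V^-$; the complementary faces are topological polygons and represent the saddle points (here there is exactly one face); $K_0$ is the curvature at the maximum points; $R$ is the ratio of the cone angle at the minimum point to that at the maximum point in each football, a parameter equivalent to the minimum curvature; $\mathcal{W}:E\to\mathbb{R}_+$ records the cone angle (divided by $2\pi$) at the maximum point of each football and satisfies the balance equations $\sum_{e\ni x}\mathcal{W}(e)=\beta$ at each $x\in V^+$ of cone angle $2\pi\beta$ and $R\sum_{e\ni y}\mathcal{W}(e)=\beta$ at each $y\in V^-$ of cone angle $2\pi\beta$ (smooth points have $\beta=1$); $\mathcal{L}$ assigns to each face a number in $(0,l)$, the position of the saddle point as seen from a football, with $l$ determined by $K_0$ and $R$. Connected components are taken with respect to continuous variation of this data: the real parameters $K_0,R,\mathcal{L},\mathcal{W}$ vary continuously and the bi-colored graph (up to orientation-preserving homeomorphism) is discrete. *)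

(* Defs.v *)
From HB Require Import structures.
From mathcomp Require Import all_boot all_order all_algebra all_fingroup.
From mathcomp Require Import all_classical all_reals all_analysis.

Set Implicit Arguments.
Unset Strict Implicit.
Unset Printing Implicit Defensive.

Import Order.TTheory GRing.Theory Num.Theory.
Import numFieldNormedType.Exports.

Local Open Scope classical_set_scope.
Local Open Scope ring_scope.

(* A bi-colored graph on an oriented surface, as a rotation system: black
   vertices B, white vertices W, edges E, each edge having one end of each
   color.  brot (resp. wrot) sends an edge to the next one counterclockwise
   around its black (resp. white) end, so that its cycles are the sets of edges
   at a common black (resp. white) vertex.  On a connected graph this records
   the cellular embedding up to orientation-preserving homeomorphism. *)
Record bigraph (B W E : finType) := Bigraph {
  bend : {ffun E -> B};
  wend : {ffun E -> W};
  brot : {perm E};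
  wrot : {perm E};
  brotP : [forall e, porbit brot e == [set f | bend f == bend e]%SET];
  wrotP : [forall e, porbit wrot e == [set f | wend f == wend e]%SET]
}.

HB.instance Definition _ (B W E : finType) := gen_eqMixin (bigraph B W E).
HB.instance Definition _ (B W E : finType) := gen_choiceMixin (bigraph B W E).

Section Bigraph.
Variables (B W E : finType) (G : bigraph B W E).

Definition adjacent : rel (B + W) := fun u v =>
  match u, v with
  | inl b, inr w | inr w, inl b =>
      [exists e, (bend G e == b) && (wend G e == w)]
  | _, _ => false
  end.

Definition graph_connected : Prop := forall u v, connect adjacent u v.

(* Parallel edges are excluded separately, since adjacent does not see them. *)
Definition is_tree : Prop :=
  [/\ graph_connected,
      injective (fun e => (bend G e, wend G e)) &
      forall c : seq (B + W), ucycle adjacent c -> (size c <= 2)%N].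

(* The boundary walk of a face with 2k sides meets k edges from black to white;
   these form one cycle of brot * wrot. *)
Definition faces : {set {set E}} := porbits (brot G * wrot G)%g.

Definition spherical : Prop :=
  graph_connected /\ (#|B| + #|W| + #|faces| = #|E| + 2)%N.

End Bigraph.

(* Orientation-preserving homeomorphism preserving the colors. *)
Definition bigraph_iso (B W E B' W' E' : finType)
    (G : bigraph B W E) (G' : bigraph B' W' E')
    (fb : B -> B') (fw : W -> W') (fe : E -> E') : Prop :=
  [/\ bijective fb, bijective fw, bijective fe &
      forall e, [/\ bend G' (fe e) = fb (bend G e),
                    wend G' (fe e) = fw (wend G e),
                    brot G' (fe e) = fe (brot G e) &
                    wrot G' (fe e) = fe (wrot G e)]].

Lemma bigraph_iso_refl (B W E : finType) (G : bigraph B W E) :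
  bigraph_iso G G id id id.
Proof. by split=> //; exists id. Qed.

Lemma bigraph_iso_sym (B W E B' W' E' : finType)
    (G : bigraph B W E) (G' : bigraph B' W' E') fb fw fe ge :
  bigraph_iso G G' fb fw fe -> cancel fe ge -> cancel ge fe ->
  exists gb gw, bigraph_iso G' G gb gw ge.
Proof.
move=> [[gb fbK gbK] [gw fwK gwK] _ H] feK geK; exists gb, gw.
split; [by exists fb|by exists fw|by exists fe|] => e.
have [h1 h2 h3 h4] := H (ge e); rewrite geK in h1 h2 h3 h4.
by rewrite h1 h2 h3 h4 fbK fwK !feK.
Qed.

Lemma bigraph_iso_trans (B1 W1 E1 B2 W2 E2 B3 W3 E3 : finType)
    (G1 : bigraph B1 W1 E1) (G2 : bigraph B2 W2 E2) (G3 : bigraph B3 W3 E3)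
    fb fw fe gb gw ge :
  bigraph_iso G1 G2 fb fw fe -> bigraph_iso G2 G3 gb gw ge ->
  bigraph_iso G1 G3 (gb \o fb) (gw \o fw) (ge \o fe).
Proof.
move=> [b1 b2 b3 H] [c1 c2 c3 K]; split; try exact: bij_comp.
move=> e /=; have [h1 h2 h3 h4] := H e; have [k1 k2 k3 k4] := K (fe e).
by rewrite k1 k2 k3 k4 h1 h2 h3 h4.
Qed.

(* Vertices and edges are numbered; wbp_same forgets the numbering. *)
Record weighted_bigraph : Type := WeightedBigraph {
  nblack : nat;
  nwhite : nat;
  nedge : nat;
  wgraph :> bigraph 'I_nblack 'I_nwhite 'I_nedge;
  eweight : 'I_nedge -> nat
}.

Arguments eweight : clear implicits.

Definition is_wbp_tree (T : weighted_bigraph) : Prop :=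
  is_tree T /\ forall e, (0 < eweight T e)%N.

Definition black_weight (T : weighted_bigraph) (x : 'I_(nblack T)) : nat :=
  (\sum_(e | bend T e == x) eweight T e)%N.

Definition white_weight (T : weighted_bigraph) (y : 'I_(nwhite T)) : nat :=
  (\sum_(e | wend T e == y) eweight T e)%N.

Arguments black_weight : clear implicits.
Arguments white_weight : clear implicits.

Definition wbp_same (T T' : weighted_bigraph) : Prop :=
  exists fb fw fe, bigraph_iso T T' fb fw fe /\
    forall e, eweight T' (fe e) = eweight T e.

Definition balanced_wbp_tree (p q : nat) : set weighted_bigraph :=
  [set T | [/\ is_wbp_tree T, nblack T = p, nwhite T = q,
               forall x, black_weight T x = q &
               forall y, white_weight T y = p]].

Definition wbp_classes (p q : nat) : set (set weighted_bigraph) :=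
  [set [set T' | wbp_same T T'] | T in balanced_wbp_tree p q].

Section Moduli.
Variable R : realType.

(* On a football with curvature between K1 and K0 the cone angles at the minimum
   and maximum points are in the ratio rho = (K0 + 2 K1) / (2 K0 + K1). *)
Definition min_curvature (K0 rho : R) : R := K0 * (2 * rho - 1) / (2 - rho).

(* Length of a meridian of a football: along it the curvature decreases from K0
   to K1 with (dK/ds)^2 = (K0 - K)(K - K1)(K + K0 + K1) / 3. *)
Definition meridian_length (K0 rho : R) : \bar R :=
  let K1 := min_curvature K0 rho in
  (\int[lebesgue_measure]_(K in `]K1, K0[)
    ((Num.sqrt ((K0 - K) * (K - K1) * (K + K0 + K1) / 3))^-1)%:E)%E.

Variables alpha p q : nat.

(* (G, K0, rho, L, w): bi-colored graph, maximum curvature, angle ratio, position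
   of the saddle point, edge weights.  As there is just one face, the function L
   on faces is a single number; as the face contains a saddle point of cone
   angle 2 pi alpha, it has 2 alpha sides, that is, G has alpha edges. *)
Definition hcmu_params : Type :=
  discrete_topology (bigraph 'I_p 'I_q 'I_alpha) * R * R * R * 'rV[R]_alpha.

HB.instance Definition _ := Topological.on hcmu_params.

(* All extremal points are smooth, hence the 1 in the balance equations. *)
Definition hcmu_data : set hcmu_params :=
  [set x : hcmu_params | let: (G, K0, rho, L, w) := x in
    [/\ spherical G /\ #|faces G| = 1%N,
        0 < K0,
        0 < rho < 1,
        0 < L /\ (L%:E < meridian_length K0 rho)%E &
        [/\ forall e, 0 < w 0 e,
            forall x, \sum_(e | bend G e == x) w 0 e = 1 &
            forall y, rho * \sum_(e | wend G e == y) w 0 e = 1]]].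

Definition hcmu_same (x x' : hcmu_params) : Prop :=
  let: (G, K0, rho, L, w) := x in
  let: (G', K0', rho', L', w') := x' in
  [/\ K0 = K0', rho = rho', L = L' &
      exists fb fw fe, bigraph_iso G G' fb fw fe /\
        forall e, w' 0 (fe e) = w 0 e].

Definition hcmu_rel : rel hcmu_data :=
  fun x x' => `[< hcmu_same (set_val x) (set_val x') >].

Lemma hcmu_rel_refl : reflexive hcmu_rel.
Proof.
move=> x; apply/asboolP; case: (set_val x) => [[[[G K0] rho] L] w] /=.
by split=> //; exists id, id, id; split=> //; exact: bigraph_iso_refl.
Qed.

Lemma hcmu_rel_sym : symmetric hcmu_rel.
Proof.
suff H x y : hcmu_rel x y -> hcmu_rel y x by move=> x y; apply/idP/idP; exact: H.
move=> /asboolP; rewrite /hcmu_rel.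
case: (set_val x) => [[[[G K0] rho] L] w] /=.
case: (set_val y) => [[[[G' K0'] rho'] L'] w'] /=.
move=> [-> -> -> [fb [fw [fe [iso ew]]]]]; apply/asboolP; split=> //.
have [_ _ [ge feK geK] _] := iso.
have [gb [gw iso']] := bigraph_iso_sym iso feK geK.
by exists gb, gw, ge; split=> // e; rewrite -ew geK.
Qed.

Lemma hcmu_rel_trans : transitive hcmu_rel.
Proof.
move=> y x z /asboolP + /asboolP +; rewrite /hcmu_rel.
case: (set_val x) => [[[[G1 K1] rho1] L1] w1] /=.
case: (set_val y) => [[[[G2 K2] rho2] L2] w2] /=.
case: (set_val z) => [[[[G3 K3] rho3] L3] w3] /=.
move=> [-> -> -> [fb [fw [fe [iso ew]]]]].
move=> [-> -> -> [gb [gw [ge [iso' ew']]]]]; apply/asboolP; split=> //.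
exists (gb \o fb), (gw \o fw), (ge \o fe).
by split=> [|e /=]; [exact: bigraph_iso_trans iso iso'|rewrite ew' ew].
Qed.

Canonical hcmu_equiv :=
  EquivRel hcmu_rel hcmu_rel_refl hcmu_rel_sym hcmu_rel_trans.

Definition hcmu_moduli : Type :=
  quotient_topology {eq_quot hcmu_equiv}%qT.

HB.instance Definition _ := Topological.on hcmu_moduli.

Definition hcmu_components : set (set hcmu_moduli) :=
  [set connected_component [set: hcmu_moduli] x | x in [set: hcmu_moduli]].

End Moduli.

Arguments hcmu_components : clear implicits.

Section Formula.
Variables p q : nat.
Let g0 := gcdn p q.

Definition fracpart (x : rat) : rat := x - (Num.floor x)%:~R.

(* Only used where x and y are nonnegative integers. *)
Definition qbinomial (x y : rat) : rat := 'C(Num.truncn x, Num.truncn y)%:R.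

(* Below, the index j : 'I_g0 stands for j.+1, and n j is n_(j+1); the bound g0
   on s and on the n j is implied by the linear constraints. *)
Definition prod_factor (n : {ffun 'I_g0 -> 'I_g0.+1}) : rat :=
  \prod_(j < g0)
    (((n j)`!)%:R^-1 *
     (((j.+1 * (p + q) %/ g0) - 1)`!%:R /
      ((j.+1 * p %/ g0)`!%:R * (j.+1 * q %/ g0)`!%:R)) ^+ n j).

Definition C1 (n : {ffun 'I_g0 -> 'I_g0.+1}) : rat :=
  let N : int := (\sum_j n j)%N in
  (-1) ^ (N - 1) * (p + q - 1)%:R ^ (N - 2) * prod_factor n.

Definition G1 : rat :=
  \sum_(n : {ffun 'I_g0 -> 'I_g0.+1} | (\sum_(j < g0) j.+1 * n j == g0)%N) C1 n.

Definition Cd (r d s : nat) (n : {ffun 'I_g0 -> 'I_g0.+1}) : rat :=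
  let N : int := (1 + \sum_j n j)%N in
  let t : rat := s%:R + fracpart (g0%:R / d%:R) in
  (-1) ^ (N - 1) * ((p + q - 1)%:R ^ (N - 2) / d%:R ^ (N - 1)) *
  qbinomial (t * ((p + q)%:R / g0%:R) - d%:R^-1) (t * (r%:R / g0%:R)) *
  prod_factor n.

Definition Gd (r d : nat) : rat :=
  \sum_(sn : 'I_g0.+1 * {ffun 'I_g0 -> 'I_g0.+1}
        | (sn.1 + \sum_(j < g0) j.+1 * sn.2 j == g0 %/ d)%N) Cd r d sn.1 sn.2.

Definition component_count : rat :=
  let g1 := gcdn (p - 1) q in
  let g2 := gcdn p (q - 1) in
  G1 + \sum_(d <- divisors g1 | (1 < d)%N) (totient d)%:R * Gd q d
     + \sum_(d <- divisors g2 | (1 < d)%N) (totient d)%:R * Gd p d.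

End Formula.

(* Main.v *)
Require Import Defs.
From HB Require Import structures.
From mathcomp Require Import all_boot all_order all_algebra all_fingroup cyclic.
From mathcomp Require Import zify ring lra.
From mathcomp Require boolp.
Set Implicit Arguments.
Unset Strict Implicit.
Unset Printing Implicit Defensive.
Import GRing.Theory.

(** Why the theorem holds.

    Number the edges of a tree with [p] black and [q] white vertices in the
    order in which they are met on a walk around its only face.  The rotation
    about the black vertices becomes a permutation [s] of the [p + q - 1] edges,
    the rotation about the white vertices is [s^-1 * c] for the long cycle [c],
    and Euler's formula says that [s] lies on a geodesic from [1] to [c] in the
    Cayley graph of the transpositions ([geodesic]).  Changing the edge at which
    the walk starts conjugates [s] by a power of [c].  On a tree the weights of
    the edges are determined by their sums at the vertices ([tree_vsum_inj]),
    so the classes of weighted trees are the orbits of [<[c]>] on the geodesic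
    permutations that carry a balanced weighting ([readings_orbit],
    [readings_surj], [iso_of_readings]).

    The components of the moduli space are the same orbits.  Adding the balance
    equations gives [R = q / p]; then [q] times the weights are the integral
    weights of a tree ([data_weights]).  So for a given graph only the maximal
    curvature and the position of the saddle point vary, and they range over a
    connected set, as the length of a meridian is at least [1 / sqrt K0]
    ([meridian_length_ge], [fiber_component]).  The graph is locally constant
    ([component_reading]).

    By the Cauchy-Frobenius lemma, [p + q - 1] times the number of orbits is the
    sum over the divisors [d] of [p + q - 1] of [totient d] times the number of
    those [s] that commute with a rotation of order [d].  For [d > 1] such a
    tree is a cyclic cover of a quotient tree with [(p + q - 1) / d] edges.
    Counting vertices upstairs and downstairs shows that the cover is branched
    at exactly one vertex ([geodesic_skew]); its weight downstairs is [q / d] or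
    [p / d], while all other vertices keep the weights [q] and [p].  Conversely
    each such quotient tree has exactly one cover ([card_symmetric]).  So only
    the [d] dividing [q] or [p] contribute, and these are the divisors of [g1]
    and of [g2].

    It remains to count trees with a root edge.  Cutting off the last edge at
    the root gives a recursion for planted plane trees with a prescribed missing
    weight at the root ([plantedS]).  Let [u] mark edges and [t] the missing
    weight, with a positive exponent for black roots and a negative one for
    white roots.  For the generating series [B] and [W] the recursion says that
    [(1 - B) * (1 - W)] is a series in [u] alone minus [u] times a Laurent
    polynomial with two terms.  This is a Wiener-Hopf factorization
    ([wiener_hopf]), and Lagrange inversion ([lagrange_coef]) expresses its
    coefficients by the numbers of balanced words in two letters.  Such words
    exist only in lengths divisible by [(p + q) / g0]; exponentiating their
    series produces the sums over [(n_1, ..., n_g0)] ([words_exp]).  The special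
    vertex of a quotient tree is a first order perturbation of the same
    recursion ([planted_marked]). *)

(** * Geodesics below a permutation *)

Definition size_of (T : finType) := #|T|.

Section PermOrbits.
Local Open Scope group_scope.
Variable T : finType.
Implicit Types (s t c : {perm T}) (A B : {set T}).

Definition ncyc s := #|porbits s|.

Lemma ncyc_tperm s x y :
  ncyc (tperm x y * s) + (x \notin porbit s y).*2 = ncyc s + (x != y).
Proof. exact: porbits_mul_tperm. Qed.

Lemma ncyc_le s : ncyc s <= size_of T.
Proof. exact: leq_imset_card. Qed.

Lemma porbit_agree s t A x :
  {in A, forall i, s i \in A} -> {in A, s =1 t} -> x \in A ->
  porbit s x = porbit t x.
Proof.
move=> sA st xA; have H n : (s ^+ n) x \in A /\ (s ^+ n) x = (t ^+ n) x.
  elim: n => [|n [IA IE]]; first by rewrite !expg0 !perm1.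
  by rewrite !expgSr !permM -IE -st // sA.
apply/setP=> y; apply/porbitP/porbitP=> -[n ->]; exists n; by case: (H n).
Qed.

Lemma porbitJ s t x : porbit (s ^ t) (t x) = t @: porbit s x.
Proof.
have H n : ((s ^ t) ^+ n) (t x) = t ((s ^+ n) x).
  by rewrite -conjXg permJ.
apply/setP=> y; apply/porbitP/imsetP=> [[n ->]|[z /porbitP[n ->] ->]].
  by exists ((s ^+ n) x); rewrite ?H // mem_porbit.
by exists n; rewrite H.
Qed.

Lemma porbitsJ s t : porbits (s ^ t) = [set t @: O | O : {set T} in porbits s].
Proof.
apply/setP=> O; apply/imsetP/imsetP=> [[x _ ->]|[O' /imsetP[x _ ->] ->]].
  exists (porbit s (t^-1 x)); first exact: imset_f.
  by rewrite -porbitJ permKV.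
by exists (t x); rewrite ?inE // porbitJ.
Qed.

Lemma ncycJ s t : ncyc (s ^ t) = ncyc s.
Proof. by rewrite /ncyc porbitsJ card_imset //; apply: imset_inj; apply: perm_inj. Qed.

Lemma ncycV s : ncyc s^-1 = ncyc s.
Proof. by congr #|pred_of_set _|; apply: eq_imset => x; rewrite porbitV. Qed.

Lemma ncyc1 : ncyc (1 : {perm T}) = size_of T.
Proof.
rewrite /ncyc /porbits card_imset // => x y /setP/(_ x).
rewrite porbit_id => /esym/porbitP[n]; by rewrite expg1n perm1.
Qed.

Lemma porbit_fix s x : s x = x -> porbit s x = [set x].
Proof.
move=> sx; apply/setP=> y; rewrite inE; apply/porbitP/eqP=> [[n ->]|->].
  by elim: n => [|n IH]; rewrite ?expg0 ?perm1 // expgSr permM IH.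
by exists 0; rewrite expg0 perm1.
Qed.

(** Multiplying by a transposition merges or splits one orbit, so that
    [size_of T - ncyc s] is the length of [s] in transpositions, which is
    subadditive.  In the case of equality the transpositions taken off [s] all
    split orbits of [c]. *)
Lemma porbits_triangle s c :
  ncyc s + ncyc (s^-1 * c) <= size_of T + ncyc c /\
  (ncyc s + ncyc (s^-1 * c) = size_of T + ncyc c ->
   forall x, s x \in porbit c x).
Proof.
have [n] := ubnP (size_of T - ncyc s); elim: n s c => // n IH s c lt_n.
have [/eqP s1|/forallPn[x nx]] := boolP [forall x, s x == x].
  have -> : s = 1 by apply/permP=> x; rewrite perm1; apply/eqP; move/eqP/forallP: s1.
  by rewrite ncyc1 invg1 mul1g; split=> // _ x; rewrite perm1 porbit_id.
set y := s x; have ny : y != x by [].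
pose s' : {perm T} := tperm x y * s; pose c' : {perm T} := tperm x y * c.
have yx : porbit s x = porbit s y by apply/esym/eqP; rewrite eq_porbit_mem (mem_porbit s 1).
have cs' : ncyc s' = (ncyc s).+1.
  have := ncyc_tperm s x y; rewrite /= -yx porbit_id -/s' eq_sym ny /=; lia.
have ltT := ncyc_le s'.
have [] := IH s' c'; first by lia.
(* The same transposition is taken off [s] and [c]; the quotient stays the same. *)
have -> : s'^-1 * c' = s^-1 * c by rewrite /s' /c' invMg tpermV mulgA -(mulgA s^-1) tperm2 mulg1.
rewrite cs' => le' eq'.
have := ncyc_tperm c x y; rewrite /= eq_sym ny -/c'.
have [xy|xy] /= := boolP (x \in porbit c y) => cc'; last by split=> [|E]; [lia|exfalso; lia].
split=> [|E]; first by lia.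
have sub z : porbit c' z \subset porbit c z.
  apply/subsetP=> _ /porbitP[k ->]; elim: k => [|k]; first by rewrite expg0 perm1 porbit_id.
  rewrite expgSr permM; move: ((c' ^+ k) z) => u uz; rewrite permM.
  have cC v : v \in porbit c z -> c v \in porbit c z.
    by rewrite -!eq_porbit_mem => /eqP <-; rewrite (porbit_perm c 1).
  apply: cC; case: tpermP => // Eu; rewrite -eq_porbit_mem in uz; move/eqP: uz => <-; rewrite Eu.
    by rewrite porbit_sym.
  by [].
have {}E : (ncyc s).+1 + ncyc (s^-1 * c) = size_of T + ncyc c' by lia.
move=> z; have H u : s' u \in porbit c u := subsetP (sub u) _ (eq' E u).
have sE v : s v = s' (tperm x y v) by rewrite permM tpermK.
rewrite sE -eq_porbit_mem; have /eqP -> : porbit c (s' (tperm x y z)) == porbit c (tperm x y z).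
  by rewrite eq_porbit_mem.
rewrite eq_porbit_mem; case: tpermP => [->|->|]; rewrite ?porbit_id //.
by rewrite porbit_sym.
Qed.

Definition geodesic s c := ncyc s + ncyc (s^-1 * c) == size_of T + ncyc c.

(** Orbits of the first factor of a geodesic are contained in those of the
    product: each step of the geodesic splits an orbit. *)
Lemma geodesic_sub s c x : geodesic s c -> s x \in porbit c x.
Proof. by move/eqP=> E; apply: (proj2 (porbits_triangle s c)). Qed.

Lemma geodesic1 s : geodesic s 1 = (s == 1).
Proof.
apply/idP/eqP=> [g|->]; last by rewrite /geodesic invg1 mulg1 ncyc1.
apply/permP=> x; have := geodesic_sub x g.
by rewrite porbit_fix ?perm1 // inE => /eqP.
Qed.

Lemma geodesicJ s c t : geodesic (s ^ t) (c ^ t) = geodesic s c.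
Proof. by rewrite /geodesic -conjVg -conjMg !ncycJ. Qed.

Lemma porbit_out s A x : perm_on A s -> x \notin A -> porbit s x = [set x].
Proof. by move=> sA xA; apply: porbit_fix; apply: out_perm sA xA. Qed.

Definition orbits_in A s := porbit s @: A.

(** The points outside of the support form orbits of their own. *)
Lemma ncyc_orbits_in A s : perm_on A s ->
  ncyc s = #|orbits_in A s| + #|~: A|.
Proof.
move=> sA; have -> : ncyc s = #|porbit s @: (A :|: ~: A)|.
  congr #|pred_of_set _|; rewrite setUCr; apply/setP=> O.
  by apply/imsetP/imsetP=> -[x _ ->]; exists x.
rewrite imsetU cardsU.
have -> : porbit s @: (~: A) = set1 @: (~: A).
  by apply: eq_in_imset => x; rewrite inE => xA; rewrite (porbit_out sA).
rewrite (card_imset _ set1_inj).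
suff -> : orbits_in A s :&: set1 @: (~: A) = set0 by rewrite cards0 subn0.
apply/setP=> O; rewrite !inE; apply/andP=> -[/imsetP[x xA ->] /imsetP[y]].
rewrite inE => yA /setP/(_ x); rewrite porbit_id inE => /esym/eqP xy.
by rewrite -xy xA in yA.
Qed.

Section Disjoint.
Variables (A B : {set T}) (s t : {perm T}).
Hypotheses (sA : perm_on A s) (tB : perm_on B t) (AB : [disjoint A & B]).

Lemma disj_permL x : x \in A -> (s * t) x = s x.
Proof.
move=> xA; rewrite permM (out_perm tB) //.
by rewrite (disjointFr AB) // perm_closed.
Qed.

Lemma disj_permR x : x \notin A -> (s * t) x = t x.
Proof. by move=> xA; rewrite permM (out_perm sA). Qed.

Lemma disj_commute : s * t = t * s.
Proof.
apply/permP=> x; have [xA|xA] := boolP (x \in A).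
  by rewrite disj_permL // permM (out_perm tB) ?(disjointFr AB).
rewrite disj_permR // permM; have [xB|xB] := boolP (x \in B).
  by rewrite (out_perm sA) // (disjointFl AB) // perm_closed.
by rewrite (out_perm tB) // (out_perm sA).
Qed.

Lemma disj_porbitL x : x \in A -> porbit (s * t) x = porbit s x.
Proof.
by move=> xA; apply: (porbit_agree (A := A)) => // y yA; rewrite disj_permL // perm_closed.
Qed.

Lemma disj_porbitR x : x \in B -> porbit (s * t) x = porbit t x.
Proof.
move=> xB; apply: (porbit_agree (A := B)) => // y yB;
 by rewrite disj_permR ?(disjointFl AB) // perm_closed.
Qed.

Lemma disj_perm_on : perm_on (A :|: B) (s * t).
Proof.
exact: perm_onM (subset_trans sA (subsetUl _ _)) (subset_trans tB (subsetUr _ _)).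
Qed.

Lemma disj_orbits_in : orbits_in (A :|: B) (s * t) = orbits_in A s :|: orbits_in B t.
Proof.
rewrite /orbits_in imsetU; congr (_ :|: _); apply: eq_in_imset => x.
  exact: disj_porbitL.
exact: disj_porbitR.
Qed.

Lemma disj_orbits_disjoint : [disjoint orbits_in A s & orbits_in B t].
Proof.
rewrite -setI_eq0; apply/eqP/setP=> O; rewrite !inE; apply/andP=> -[/imsetP[x xA ->] /imsetP[y yB]].
move/setP/(_ x); rewrite porbit_id -disj_porbitR // -eq_porbit_mem.
rewrite disj_porbitL // disj_porbitR // => /esym/eqP/setP/(_ y).
rewrite porbit_id => /porbitP[n E]; have := perm_onV sA.
have : y \in A by rewrite E; elim: n {E} => [|n IH]; rewrite ?expg0 ?perm1 // expgSr permM perm_closed.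
by rewrite (disjointFl AB).
Qed.

Lemma ncyc_disj : ncyc (s * t) + size_of T = ncyc s + ncyc t.
Proof.
rewrite (ncyc_orbits_in disj_perm_on) (ncyc_orbits_in sA) (ncyc_orbits_in tB) disj_orbits_in.
rewrite cardsU (eqP (_ : _ :&: _ == set0)) ?setI_eq0 ?disj_orbits_disjoint // cards0.
have cC (X : {set T}) : #|X| + #|~: X| = size_of T by exact: cardsC.
have := cardsUI A B; rewrite (eqP (_ : A :&: B == set0)) ?setI_eq0 // cards0.
move: (cC A) (cC B) (cC (A :|: B)); rewrite addn0.
move: #|A| #|B| #|A :|: B| #|~: A| #|~: B| #|~: _| #|orbits_in A s| #|_|; lia.
Qed.

End Disjoint.

(** Geodesics below a product of disjoint permutations are products of
    geodesics. *)
Lemma geodesicM A B s t c d : [disjoint A & B] ->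
  perm_on A s -> perm_on B t -> perm_on A c -> perm_on B d ->
  geodesic (s * t) (c * d) = geodesic s c && geodesic t d.
Proof.
move=> AB sA tB cA dB; rewrite /geodesic.
have scA : perm_on A (s^-1 * c) := perm_onM (perm_onV sA) cA.
have tdB : perm_on B (t^-1 * d) := perm_onM (perm_onV tB) dB.
have -> : (s * t)^-1 * (c * d) = (s^-1 * c) * (t^-1 * d).
  by rewrite invMg mulgA -(mulgA t^-1) -(disj_commute scA (perm_onV tB)) // !mulgA.
have e1 := ncyc_disj sA tB AB; have e2 := ncyc_disj cA dB AB.
have e3 := ncyc_disj scA tdB AB.
have [l1 _] := porbits_triangle s c; have [l2 _] := porbits_triangle t d.
move: e1 e2 e3 l1 l2; set x1 := ncyc (s^-1 * c * _); set x2 := ncyc (s^-1 * c).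
set x3 := ncyc (t^-1 * d); set x4 := ncyc (s * t); set x5 := ncyc (c * d) => e1 e2 e3 l1 l2.
apply/eqP/andP=> [E|[/eqP E1 /eqP E2]]; last by lia.
by split; apply/eqP; lia.
Qed.

(** Attaching a fixed point [e] of [s] to the orbit of [x]. *)
Section Merge.
Variables (A : {set T}) (s : {perm T}) (x e : T).
Hypotheses (sA : perm_on A s) (xA : x \in A) (eA : e \notin A).
Let s' := tperm x e * s.

Lemma merge_porbit_out z : z \in A -> z \notin porbit s x -> porbit s' z = porbit s z.
Proof.
move=> zA zx; have Kz u : u \in A :\: porbit s x -> s u \in A :\: porbit s x.
  rewrite !inE (perm_closed _ sA) => /andP[h ->]; rewrite andbT; apply: contra h.
  by rewrite -!eq_porbit_mem (porbit_perm s 1).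
apply/esym/(porbit_agree Kz); last by rewrite inE zx.
move=> u; rewrite !inE => /andP[ux uA]; rewrite permM tpermD //.
  by apply: contraNneq ux => <-; rewrite porbit_id.
by apply: contraNneq eA => ->.
Qed.

Lemma merge_porbit : porbit s' x = e |: porbit s x.
Proof.
have nxe : x != e by apply: contraNneq eA => <-.
have s'x : s' x = e by rewrite permM tpermL (out_perm sA).
have s'e : s' e = s x by rewrite permM tpermR.
have s'u u : u \in A -> u != x -> s' u = s u.
  move=> uA ux; rewrite permM tpermD 1?eq_sym //; by apply: contraNneq eA => <-.
have inA n : (s ^+ n) x \in A.
  by elim: n => [|n IH]; rewrite ?expg0 ?perm1 // expgSr permM perm_closed.
have ex : e \in porbit s' x by apply/porbitP; exists 1%N; rewrite expg1.
have cl u : u \in porbit s' x -> s' u \in porbit s' x.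
  by rewrite -!eq_porbit_mem (porbit_perm s' 1).
apply/setP=> y; rewrite !inE; apply/idP/orP=> [/porbitP[n ->]|[/eqP->//|/porbitP[n ->]]].
  elim: n => [|n]; first by rewrite expg0 perm1 porbit_id; right.
  rewrite expgSr permM; move: ((s' ^+ n) x) => u [/eqP ->|/porbitP[k ->]].
    by right; rewrite s'e (mem_porbit s 1).
  have [->|ne] := eqVneq ((s ^+ k) x) x; first by rewrite s'x; left.
  by right; rewrite s'u // -permM -expgSr mem_porbit.
elim: n => [|n IH]; first by rewrite expg0 perm1 porbit_id.
rewrite expgSr permM; have [->|ne] := eqVneq ((s ^+ n) x) x.
  by rewrite -s'e cl.
by rewrite -s'u ?cl.
Qed.

Lemma merge_orbits_in :
  orbits_in (e |: A) s' = (e |: porbit s x) |: (orbits_in A s :\ porbit s x).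
Proof.
apply/setP=> O; rewrite !inE; apply/imsetP/orP=> [[z]|[/eqP ->|/andP[ne /imsetP[z zA E]]]].
- have ee : porbit s' e = porbit s' x.
    apply/eqP; rewrite eq_porbit_mem; apply/porbitP; exists 1%N.
    by rewrite expg1 permM tpermL (out_perm sA).
  rewrite !inE => /predU1P[->|zA] ->; first by left; rewrite ee merge_porbit.
  have [zx|zx] := boolP (z \in porbit s x).
    left; rewrite -merge_porbit eq_porbit_mem merge_porbit !inE zx; exact: orbT.
  right; rewrite merge_porbit_out // eq_porbit_mem zx; exact: imset_f.
- by exists x; rewrite ?merge_porbit // !inE xA orbT.
- exists z; first by rewrite !inE zA orbT.
  by rewrite merge_porbit_out // -eq_porbit_mem -E.
Qed.

Lemma merge_fresh : e |: porbit s x \notin orbits_in A s :\ porbit s x.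
Proof.
rewrite !inE negb_and; apply/orP; right; apply/imsetP=> -[z zA /setP/(_ e)].
rewrite !inE eqxx /= => /esym/porbitP[n E]; move: eA; rewrite E.
by elim: n {E} => [|n IH]; rewrite ?expg0 ?perm1 ?zA // expgSr permM perm_closed.
Qed.

Lemma ncyc_merge : (ncyc s').+1 = ncyc s.
Proof.
have := ncyc_tperm s x e; rewrite /= -/s'.
have -> : x != e by apply: contraNneq eA => <-.
rewrite (porbit_out sA eA) inE; have -> : x == e = false by apply: contraNF eA => /eqP <-.
by rewrite /=; lia.
Qed.

End Merge.

End PermOrbits.

(** * Geodesics below a cycle of consecutive edges *)

Section IntervalCycle.
Local Open Scope group_scope.
Variable M : nat.
Local Notation T := 'I_M.+1.
Implicit Types (s t : {perm T}) (a l j : nat).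

(** The edges of a subtree are consecutive along the face. *)
Definition itv a l : {set T} := [set i : T | a <= i < a + l].

Fixpoint cyc a l : {perm T} :=
  if l is l'.+1 then cyc a l' * tperm (inord a) (inord (a + l')) else 1.

Arguments cyc : simpl never.

Lemma cycS a l : cyc a l.+1 = cyc a l * tperm (inord a) (inord (a + l)).
Proof. by []. Qed.

Lemma val_tperm (x y i : T) :
  val (tperm x y i) = if val i == val x then val y else if val i == val y then val x else val i.
Proof.
rewrite !val_eqE; case: tpermP => [->|->|/eqP/negbTE -> /eqP/negbTE -> //].
  by rewrite eqxx.
by rewrite eqxx; case: eqP => [->|].
Qed.

Lemma val_cyc a l (i : T) : a + l <= M.+1 ->
  val (cyc a l i) = if a <= i < a + l then (if i.+1 == a + l then a else i.+1) else i.
Proof.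
elim: l => [|l IH] le_l; first by rewrite perm1; case: ifP => //; lia.
rewrite cycS permM val_tperm IH; last by lia.
rewrite /= !inordK; [|lia..]; move: (val i) => n; repeat case: ifP; lia.
Qed.

Lemma cyc_on a l : a + l <= M.+1 -> perm_on (itv a l) (cyc a l).
Proof.
move=> le_l; apply/subsetP=> i; rewrite !inE -val_eqE /= val_cyc //.
by case: ifP => //; rewrite eqxx.
Qed.

Lemma porbit_cyc a l i : a + l <= M.+1 -> i \in itv a l -> porbit (cyc a l) i = itv a l.
Proof.
move=> le_l; rewrite inE => il.
have H k : k < l -> (cyc a l ^+ k) (inord a) = inord (a + k).
  elim: k => [|k IH] lt_k; first by rewrite expg0 perm1 addn0.
  rewrite expgSr permM IH; last by lia.
  by apply: val_inj; rewrite /= val_cyc // !inordK; [repeat case: ifP; lia|lia..].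
have -> : porbit (cyc a l) i = porbit (cyc a l) (inord a).
  apply/eqP; rewrite eq_porbit_mem; apply/porbitP; exists (i - a).
  by rewrite H; [apply: val_inj; rewrite /= inordK; lia|lia].
apply/setP=> x; rewrite inE; apply/porbitP/idP=> [[n ->]|xl].
  elim: n => [|n IH]; first by rewrite expg0 perm1 inordK; lia.
  rewrite expgSr permM; have := val_cyc ((cyc a l ^+ n) (inord a)) le_l.
  by rewrite /= IH => ->; move: IH; case: ifP; lia.
exists (x - a); rewrite H; last by lia.
by apply: val_inj; rewrite /= inordK; lia.
Qed.

Lemma itv_disjoint a j b l : a + j <= b -> [disjoint itv a j & itv b l].
Proof.
move=> le_b; rewrite -setI_eq0; apply/eqP/setP=> i; rewrite !inE; lia.
Qed.

(** Where the last edge [a + l] of an interval is attached: the last edge of the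
    left part, or itself when that part is empty. *)
Definition anchor a l j : T := if j == 0 then inord (a + l) else inord (a + j).-1.

(** Taking off the edge [a + l] cuts the face into two: the edges before [j]
    stay with the root, the others become a tree planted at the far end. *)
Lemma cyc_split a l j : a + l.+1 <= M.+1 -> j <= l ->
  tperm (anchor a l j) (inord (a + l)) * cyc a l.+1 = cyc a j * cyc (a + j) (l.+1 - j).
Proof.
move=> le_l le_j; apply/permP=> i; apply: val_inj.
rewrite [in LHS]permM [in RHS]permM !val_cyc; [|lia..]; rewrite /= val_tperm /anchor.
case: (eqVneq j 0) => [->|j0]; rewrite /= !inordK; try lia; move: (val i) => n.
  repeat case: ifP; lia.
repeat case: ifP; lia.
Qed.

Lemma ncyc_tpermR (s : {perm T}) y e : s e = e -> y != e -> (ncyc (s * tperm y e)).+1 = ncyc s.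
Proof.
move=> se ye; have -> : s * tperm y e = tperm (s^-1 y) e * s.
  by rewrite -{2}[e](permK s) se -tpermJ conjgE invgK -!mulgA mulVg mulg1.
have := ncyc_tperm s (s^-1 y) e; rewrite (porbit_fix se) inE.
have -> : s^-1 y == e = false by rewrite -{1}(permK s e) se (inj_eq perm_inj) (negbTE ye).
by rewrite /=; lia.
Qed.

(** Joining a fixed point of [s] to the cycle lowers both sides of the triangle
    inequality by one. *)
Lemma geodesic_shorten b k s : b + k.+1 <= M.+1 -> s (inord (b + k)) = inord (b + k) ->
  geodesic s (cyc b k.+1) = geodesic s (cyc b k).
Proof.
move=> le_k se; case: k => [|k] in le_k se *; first by rewrite cycS addn0 tperm1 mulg1.
set e : T := inord _ in se; rewrite /geodesic cycS mulgA.
have ne : inord b != e :> T by rewrite -val_eqE /= !inordK; lia.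
have ce : cyc b k.+1 e = e.
  apply: val_inj; rewrite val_cyc; last by lia.
  by rewrite /e /= inordK; [case: ifP => //; lia|lia].
have := ncyc_tpermR ce ne.
have := @ncyc_tpermR (s^-1 * cyc b k.+1) _ e _ ne; rewrite permM -{1}se permK => /(_ ce).
move: (ncyc (_ * tperm _ _)) (ncyc (_ * tperm _ _)) (ncyc (_ * _)) => x y z; lia.
Qed.

Lemma geodesic_attach a l j s : a + l.+1 <= M.+1 -> j <= l -> s (inord (a + l)) = inord (a + l) ->
  geodesic (tperm (anchor a l j) (inord (a + l)) * s) (cyc a l.+1) =
  geodesic s (cyc a j * cyc (a + j) (l.+1 - j)).
Proof.
move=> le_l le_j se; rewrite -cyc_split //; set e : T := inord _ in se *.
have [j0|j0] := eqVneq j 0; first by rewrite /anchor j0 /= tperm1 !mul1g.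
have xe : anchor a l j != e by rewrite /anchor (negbTE j0) -val_eqE /= !inordK; lia.
rewrite /geodesic; set x := anchor _ _ _ in xe *.
have -> : (tperm x e * s)^-1 * cyc a l.+1 = s^-1 * (tperm x e * cyc a l.+1).
  by rewrite invMg tpermV -[LHS](mulgA s^-1).
have := ncyc_tperm s x e; rewrite (porbit_fix se) inE xe.
have := ncyc_tperm (cyc a l.+1) x e; rewrite xe.
have -> : x \in porbit (cyc a l.+1) e.
  rewrite porbit_cyc //; first by rewrite inE /x /anchor (negbTE j0) inordK; lia.
  by rewrite inE /e inordK; lia.
rewrite /=; set u := ncyc (_^-1 * _).
move: u (ncyc (_ * cyc _ _)) (ncyc (_ * s)) (ncyc s) (ncyc (cyc _ _)) (size_of _) => u p r t v z; lia.
Qed.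

Lemma geodesic_on a l s : a + l <= M.+1 -> geodesic s (cyc a l) -> perm_on (itv a l) s.
Proof.
move=> le_l g; apply/subsetP=> i; rewrite inE; apply: contraR => il.
have := geodesic_sub i g; rewrite porbit_fix ?inE //; apply: out_perm il; exact: cyc_on.
Qed.

Lemma geodesic_join a l j s1 s2 : a + l.+1 <= M.+1 -> j <= l ->
  geodesic s1 (cyc a j) -> geodesic s2 (cyc (a + j) (l - j)) ->
  geodesic (tperm (anchor a l j) (inord (a + l)) * (s1 * s2)) (cyc a l.+1).
Proof.
move=> le_l le_j g1 g2.
have on1 : perm_on (itv a j) s1 by apply: geodesic_on g1; lia.
have on2 : perm_on (itv (a + j) (l - j)) s2 by apply: geodesic_on g2; lia.
have e1 : inord (a + l) \notin itv a j by rewrite inE inordK; lia.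
have e2 : inord (a + l) \notin itv (a + j) (l - j) by rewrite inE inordK; lia.
rewrite geodesic_attach //; last by rewrite permM (out_perm on1) ?(out_perm on2).
rewrite (@geodesicM _ (itv a j) (itv (a + j) (l.+1 - j))) ?itv_disjoint ?cyc_on //; try lia.
  rewrite g1 subSn // geodesic_shorten //; first by lia.
  by rewrite (_ : a + j + (l - j) = a + l) ?(out_perm on2) //; lia.
apply: subset_trans on2 _; apply/subsetP=> i; rewrite !inE; lia.
Qed.

(** In its orbit the edge [a + l] comes right after the last edge of the left
    part; this is where the face is cut. *)
Lemma geodesic_unjoin a l s : a + l.+1 <= M.+1 -> geodesic s (cyc a l.+1) ->
  exists j s1 s2, [/\ j <= l, geodesic s1 (cyc a j), geodesic s2 (cyc (a + j) (l - j)) &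
    s = tperm (anchor a l j) (inord (a + l)) * (s1 * s2)].
Proof.
move=> le_l g; set e : T := inord (a + l); pose x := s^-1 e.
have sx : s x = e by rewrite permKV.
have xI : x \in itv a l.+1.
  by rewrite -(perm_closed x (geodesic_on le_l g)) sx inE inordK; lia.
have [j [le_j jx]] : exists j, j <= l /\ anchor a l j = x.
  have [xe|xe] := eqVneq x e; first by exists 0.
  move: xI xe; rewrite inE -val_eqE /= inordK; last by lia.
  move=> xI xe; exists (x - a).+1; split; first by lia.
  by apply: val_inj; rewrite /anchor /= inordK; lia.
pose s' := tperm x e * s; have s'e : s' e = e by rewrite permM tpermR.
have sE : s = tperm (anchor a l j) e * s' by rewrite jx /s' mulgA tperm2 mul1g.
move: g; rewrite {1}sE geodesic_attach //.
set A := itv a j; set B := itv (a + j) (l.+1 - j) => g.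
have AB : [disjoint A & B] by rewrite itv_disjoint.
have cA : perm_on A (cyc a j) by apply: cyc_on; lia.
have cB : perm_on B (cyc (a + j) (l.+1 - j)) by apply: cyc_on; lia.
have nA : s' \in 'N(A | 'P).
  apply/astabsP=> y; rewrite /= apermE; have H z : z \in A -> s' z \in A.
    move=> zA; have := geodesic_sub z g; rewrite (disj_porbitL cA cB) //.
    by rewrite porbit_cyc //; lia.
  apply/idP/idP => [|/H //]; apply: contraLR => yA.
  have := geodesic_sub y g; have [yB|yB] := boolP (y \in B).
    rewrite (disj_porbitR cA cB) // porbit_cyc //; last by lia.
    by apply: contraL; rewrite -/B => /(disjointFr AB) ->.
  rewrite porbit_fix => [/set1P->//|]; by rewrite permM (out_perm cA) ?(out_perm cB).
have nB : s' \in 'N(B | 'P).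
  apply/astabsP=> y; rewrite /= apermE; have H z : z \in B -> s' z \in B.
    move=> zB; have := geodesic_sub z g; rewrite (disj_porbitR cA cB) //.
    by rewrite porbit_cyc //; lia.
  apply/idP/idP => [|/H //]; apply: contraLR => yB.
  have := geodesic_sub y g; have [yA|yA] := boolP (y \in A).
    rewrite (disj_porbitL cA cB) // porbit_cyc //; last by lia.
    by apply: contraL; rewrite -/A => /(disjointFl AB) ->.
  rewrite porbit_fix => [/set1P->//|]; by rewrite permM (out_perm cA) ?(out_perm cB).
have s'M : s' = restr_perm A s' * restr_perm B s'.
  apply/permP=> y; rewrite [in RHS]permM; have [yA|yA] := boolP (y \in A).
    rewrite (restr_permE nA) // (out_perm (restr_perm_on _ _)) //.
    by rewrite (disjointFr AB) //; move/astabsP: nA => /(_ y) /=; rewrite apermE => ->.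
  rewrite (out_perm (restr_perm_on A _)) //; have [yB|yB] := boolP (y \in B).
    by rewrite (restr_permE nB).
  rewrite (out_perm (restr_perm_on B _)) //; have := geodesic_sub y g.
  rewrite porbit_fix => [/set1P->//|]; by rewrite permM (out_perm cA) ?(out_perm cB).
exists j, (restr_perm A s'), (restr_perm B s'); rewrite -s'M -sE.
move: g; rewrite {1}s'M (geodesicM AB) ?restr_perm_on // => /andP[g1 g2].
split=> //; move: g2; rewrite subSn // geodesic_shorten //; first by lia.
have -> : a + j + (l - j) = a + l by lia.
rewrite -/e restr_permE // /B inE inordK; lia.
Qed.

End IntervalCycle.
Arguments cyc : simpl never.

(** * Planted plane trees and their recursion *)

Definition add_at (T : eqType) (w : T -> nat) (x : T) (k : nat) : T -> nat :=
  fun i => w i + (i == x) * k.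

Section OrbitProd.
Variables (T : finType) (K : comNzRingType).
Implicit Types (s t : {perm T}) (A B O : {set T}) (w : T -> nat) (f : nat -> K).

Lemma sum_add_at O w x k :
  \sum_(i in O) add_at w x k i = \sum_(i in O) w i + (x \in O) * k.
Proof.
rewrite big_split /=; congr (_ + _); have [xO|xO] := boolP (x \in O).
  rewrite (bigD1 x) //= eqxx big1 ?addn0 // => i /andP[_ /negbTE ->]; exact: mul0n.
rewrite big1 // => i iO; case: eqP => // ix; by rewrite -ix iO in xO.
Qed.

Definition orbit_prod A s w f : K := \prod_(O in orbits_in A s) f (\sum_(i in O) w i).

Lemma orbits_in_sub A s O : perm_on A s -> O \in orbits_in A s -> O \subset A.
Proof.
move=> sA /imsetP[x xA ->]; apply/subsetP=> _ /porbitP[n ->].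
by elim: n => [|n IH]; rewrite ?expg0 ?perm1 // expgSr permM perm_closed.
Qed.

Lemma orbit_prod_eq A s w w' f : perm_on A s -> {in A, w =1 w'} ->
  orbit_prod A s w f = orbit_prod A s w' f.
Proof.
move=> sA ww'; apply: eq_bigr => O OA; congr f; apply: eq_bigr => i iO.
by apply: ww'; apply: (subsetP (orbits_in_sub sA OA)).
Qed.

Lemma orbit_prod_ext A s w w' f : w =1 w' -> orbit_prod A s w f = orbit_prod A s w' f.
Proof. by move=> ww'; apply: eq_bigr => O _; congr f; apply: eq_bigr => i _. Qed.

Lemma orbit_prod0 s w f : orbit_prod set0 s w f = 1%R.
Proof. by rewrite /orbit_prod /orbits_in imset0 big_set0. Qed.

Lemma orbit_prodV A s w f : orbit_prod A s^-1%g w f = orbit_prod A s w f.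
Proof.
rewrite /orbit_prod; apply: eq_bigl => O; congr (O \in pred_of_set _).
by apply: eq_imset => x; rewrite porbitV.
Qed.

Lemma orbit_prod_fix e w f : orbit_prod [set e] 1%g w f = f (w e).
Proof.
by rewrite /orbit_prod /orbits_in imset_set1 big_set1 porbit_fix ?perm1 // big_set1.
Qed.

Lemma orbit_prod_disj A B s t w f :
  perm_on A s -> perm_on B t -> [disjoint A & B] ->
  orbit_prod (A :|: B) (s * t)%g w f = (orbit_prod A s w f * orbit_prod B t w f)%R.
Proof.
move=> sA tB AB; rewrite /orbit_prod disj_orbits_in //.
rewrite -bigU /= ?disj_orbits_disjoint //.
by apply: eq_bigl => O; rewrite !inE.
Qed.

Lemma orbit_prod_merge A s x e w f : perm_on A s -> x \in A -> e \notin A ->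
  orbit_prod (e |: A) (tperm x e * s)%g w f = orbit_prod A s (add_at w x (w e)) f.
Proof.
move=> sA xA eA; rewrite /orbit_prod merge_orbits_in // big_setU1 ?merge_fresh //=.
rewrite [RHS](big_setD1 (porbit s x)) ?imset_f //=; congr (_ * _)%R.
  rewrite sum_add_at porbit_id mul1n big_setU1 1?addnC //=.
  by apply: contra eA; apply/subsetP/(orbits_in_sub sA)/imset_f.
apply: eq_bigr => O; rewrite 2!inE => /andP[ne /imsetP[y _ E]]; rewrite sum_add_at.
case: (boolP (x \in O)) => [|_]; last by rewrite addn0.
by rewrite E -eq_porbit_mem -E eq_sym (negbTE ne).
Qed.

Lemma orbit_prod_add_at A s x y w k f : y \in porbit s x ->
  orbit_prod A s (add_at w x k) f = orbit_prod A s (add_at w y k) f.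
Proof.
move=> xy; apply: eq_bigr => O /imsetP[z _ ->]; rewrite !sum_add_at.
by rewrite -!eq_porbit_mem (eqP (_ : porbit s x == porbit s y)) // eq_porbit_mem porbit_sym.
Qed.

Lemma orbit_prodJ (r : {perm T}) A s w f :
  orbit_prod (r @: A) (s ^ r)%g w f = orbit_prod A s (fun i => w (r i)) f.
Proof.
rewrite /orbit_prod; have -> : orbits_in (r @: A) (s ^ r)%g = (fun O : {set T} => r @: O) @: orbits_in A s.
  apply/setP=> O; apply/imsetP/imsetP=> [[_ /imsetP[x xA ->] ->]|[_ /imsetP[x xA ->] ->]].
    by exists (porbit s x); rewrite ?imset_f // porbitJ.
  by exists (r x); rewrite ?imset_f // porbitJ.
rewrite big_imset /=; last by move=> O O' _ _; apply: imset_inj; apply: perm_inj.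
by apply: eq_bigr => O _; rewrite big_imset //= => i j _ _; apply: perm_inj.
Qed.
End OrbitProd.

Section Planted.
Variables (M H : nat) (K : comNzRingType).
Local Notation T := 'I_M.+1.
Local Notation itv := (@itv M).
Local Notation cyc := (@cyc M).
Implicit Types (a l j h k : nat) (be om : nat -> K).

(** A rotation with a bounded weighting: a finite type to sum over. *)
Definition decorated := ({perm T} * {ffun T -> 'I_H.+1})%type.
Implicit Types z : decorated.

Definition rot z : {perm T} := z.1.
Definition wt z : T -> nat := fun i => z.2 i.

(** The weights vanish outside of the interval, so that a tree there has just
    one representative. *)
Definition plane_trees a l : {set decorated} :=
  [set z | geodesic (rot z) (cyc a l) && [forall i, (0 < wt z i) == (i \in itv a l)]].

(** The root of a planted tree misses the weight [h], which is added at the last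
    edge of the interval for a black root and at the first one for a white root.
    A planted tree without edges consists of the root alone. *)
Definition black_prod be a l h z : K :=
  if l == 0 then be h else orbit_prod (itv a l) (rot z) (add_at (wt z) (inord (a + l).-1) h) be.
Definition white_prod om a l h z : K :=
  if l == 0 then om h else
  orbit_prod (itv a l) ((rot z)^-1 * cyc a l)%g (add_at (wt z) (inord a) h) om.

Definition black_planted be om a l h : K :=
  (\sum_(z in plane_trees a l)
     black_prod be a l h z * orbit_prod (itv a l) ((rot z)^-1 * cyc a l)%g (wt z) om)%R.
Definition white_planted be om a l h : K :=
  (\sum_(z in plane_trees a l)
     orbit_prod (itv a l) (rot z) (wt z) be * white_prod om a l h z)%R.

Lemma itv0 a : itv a 0 = set0.
Proof. by apply/setP=> i; rewrite !inE; lia. Qed.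

Lemma itvS a l : a + l.+1 <= M.+1 -> itv a l.+1 = inord (a + l) |: itv a l.
Proof.
move=> le_l; apply/setP=> i; rewrite !inE -val_eqE /= inordK; lia.
Qed.

Lemma itvU a l j : j <= l -> itv a l = itv a j :|: itv (a + j) (l - j).
Proof. by move=> le_j; apply/setP=> i; rewrite !inE; lia. Qed.

Definition join_weight a l j k z1 z2 : {ffun T -> 'I_H.+1} :=
  [ffun i : T => if i == inord (a + l) then inord k
                 else if i \in itv a j then (z1 : _ * {ffun T -> _}).2 i else (z2 : _ * {ffun T -> _}).2 i].

(** Hanging a white-planted tree at the black root of another tree, by a new
    edge of weight [k]. *)
Definition join a l j k z1 z2 : decorated :=
  ((tperm (anchor M a l j) (inord (a + l)) * (rot z1 * rot z2))%g, join_weight a l j k z1 z2).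

Section Join.
Variables (a l j k : nat) (z1 z2 : decorated).
Hypotheses (le_l : a + l.+1 <= M.+1) (le_j : j <= l) (k0 : 0 < k <= H).
Hypotheses (z1P : z1 \in plane_trees a j) (z2P : z2 \in plane_trees (a + j) (l - j)).
Let A := itv a j.
Let B := itv (a + j) (l - j).
Let e : T := inord (a + l).

Let val_e : e = a + l :> nat. Proof. by rewrite inordK //; move: le_l; clear; lia. Qed.
Let g1 : geodesic (rot z1) (cyc a j). Proof. by move: z1P; rewrite inE => /andP[]. Qed.
Let g2 : geodesic (rot z2) (cyc (a + j) (l - j)). Proof. by move: z2P; rewrite inE => /andP[]. Qed.
Let on1 : perm_on A (rot z1). Proof. by apply: geodesic_on g1; lia. Qed.
Let on2 : perm_on B (rot z2). Proof. by apply: geodesic_on g2; lia. Qed.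
Let eA : e \notin A. Proof. by rewrite inE val_e; lia. Qed.
Let eB : e \notin B. Proof. by rewrite inE val_e; lia. Qed.
Let AB : [disjoint A & B]. Proof. exact: itv_disjoint. Qed.

Lemma join_wt_e : wt (join a l j k z1 z2) e = k.
Proof. by rewrite /wt /= ffunE eqxx inordK //; case/andP: k0. Qed.

Lemma join_wtL : {in A, wt (join a l j k z1 z2) =1 wt z1}.
Proof.
move=> i iA; rewrite /wt /= ffunE iA; case: eqP => // ie.
by move: eA; rewrite /e -ie iA.
Qed.

Lemma join_wtR : {in B, wt (join a l j k z1 z2) =1 wt z2}.
Proof.
move=> i iB; rewrite /wt /= ffunE (disjointFl AB iB); case: eqP => // ie.
by move: eB; rewrite /e -ie iB.
Qed.

Lemma join_trees : join a l j k z1 z2 \in plane_trees a l.+1.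
Proof.
rewrite inE geodesic_join //; apply/forallP=> i; rewrite /wt /= ffunE.
move: z1P z2P; rewrite !inE => /andP[_ /forallP/(_ i)/eqP w1] /andP[_ /forallP/(_ i)/eqP w2].
rewrite -/e; have [->|] := eqVneq i e.
  rewrite inordK ?val_e; first by move: k0 le_l; clear; lia.
  by case/andP: k0.
rewrite -val_eqE /= val_e => ie; case: ifP => iA; rewrite -/(wt z1 i) -/(wt z2 i) ?w1 ?w2.
  by move: iA le_j; rewrite !inE; clear; lia.
by move: iA ie le_j; rewrite !inE; clear; lia.
Qed.

(** Seen from the black tree alone, the weight of the new edge is missing at the
    root. *)
Lemma join_black be h :
  black_prod be a l.+1 h (join a l j k z1 z2) =
  (black_prod be a j (h + k) z1 * orbit_prod B (rot z2) (wt z2) be)%R.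
Proof.
rewrite /black_prod addnS /= -/e (itvS le_l) -/e (itvU a le_j) -/A -/B.
set w := add_at _ _ _; have we : w e = h + k by rewrite /w /add_at join_wt_e eqxx mul1n addnC.
have wB : {in B, w =1 wt z2}.
  move=> i iB; rewrite /w /add_at join_wtR //; case: eqP => [ie|_]; last by rewrite addn0.
  by move: eB; rewrite -ie iB.
have [j0|j0] := eqVneq j 0.
  have A0 : A = set0 by rewrite /A j0 itv0.
  rewrite A0 set0U /anchor j0 /= -/e tperm1 mul1g.
  have -> : rot z1 = 1%g by move: g1; rewrite j0 geodesic1 => /eqP.
  rewrite mul1g -[rot z2]mul1g orbit_prod_disj ?disjoints1 //; last exact: perm_on1.
  by rewrite orbit_prod_fix we mul1g (orbit_prod_eq _ on2 wB).
have xA : anchor M a l j \in A.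
  by rewrite /anchor (negbTE j0) inE inordK; move: j0 le_l le_j; clear; lia.
rewrite orbit_prod_merge ?we; first last.
- by rewrite inE negb_or eA.
- by rewrite inE xA.
- exact: disj_perm_on.
rewrite orbit_prod_disj //; congr (_ * _)%R.
  rewrite /anchor (negbTE j0).
  apply: orbit_prod_eq => // i iA; rewrite /add_at /w /add_at join_wtL //.
  by case: (eqVneq i e) => [ie|_]; [move: eA; rewrite -ie iA|rewrite addn0].
apply: orbit_prod_eq => // i iB; rewrite /add_at wB //; case: eqP => [ix|_]; last by rewrite addn0.
by rewrite ix (disjointFr AB) in iB.
Qed.

Lemma join_white om :
  orbit_prod (itv a l.+1) ((rot (join a l j k z1 z2))^-1 * cyc a l.+1)%g (wt (join a l j k z1 z2)) om =
  (orbit_prod A ((rot z1)^-1 * cyc a j)%g (wt z1) om * white_prod om (a + j) (l - j) k z2)%R.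
Proof.
pose z := join a l j k z1 z2; pose t1 := ((rot z1)^-1 * cyc a j)%g.
pose t2 := ((rot z2)^-1 * cyc (a + j) (l - j).+1)%g.
have leA : a + j <= M.+1 by move: le_l le_j; clear; lia.
have leB : a + j + (l - j).+1 <= M.+1 by move: le_l le_j; clear; lia.
have cA : perm_on A (cyc a j) by exact: cyc_on.
have BS : B \subset itv (a + j) (l - j).+1.
  by apply/subsetP=> i; rewrite !inE; clear; lia.
have on2' : perm_on (itv (a + j) (l - j).+1) (rot z2) by exact: subset_trans on2 BS.
have t1A : perm_on A t1 by exact: perm_onM (perm_onV on1) cA.
have t2B : perm_on (itv (a + j) (l - j).+1) t2.
  exact: perm_onM (perm_onV on2') (cyc_on leB).
have AB' : [disjoint A & itv (a + j) (l - j).+1] by exact: itv_disjoint.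
have -> : ((rot z)^-1 * cyc a l.+1)%g = (t1 * t2)%g.
  rewrite /rot /z /join /= invMg tpermV -[LHS](mulgA (_^-1)%g) cyc_split // subSn // invMg.
  rewrite /t1 /t2 -/(rot z1) -/(rot z2) -[LHS]mulgA (mulgA (rot z1)^-1%g).
  by rewrite -/t1 mulgA -(disj_commute t1A (perm_onV on2') AB') -mulgA.
rewrite (itvU a (leqW le_j)) subSn // orbit_prod_disj //; congr (_ * _)%R.
  exact: (orbit_prod_eq _ t1A join_wtL).
rewrite /white_prod (itvS leB).
have aj : a + j + (l - j) = a + l by move: le_j; clear; lia.
rewrite aj -/e -/B; have [lj|lj] := eqVneq (l - j) 0.
  have B0 : B = set0 by rewrite /B lj itv0.
  rewrite B0 setU0 /t2 lj cycS addn0 tperm1 mulg1.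
  have -> : rot z2 = 1%g by move: g2; rewrite lj geodesic1 => /eqP.
  by rewrite invg1 mul1g orbit_prod_fix join_wt_e.
pose u := ((rot z2)^-1 * cyc (a + j) (l - j))%g; pose y : T := inord (a + j).
have uB : perm_on B u by apply: perm_onM (perm_onV on2) (cyc_on _); move: leB; clear; lia.
have yB : y \in B by rewrite inE inordK; move: leB lj; clear; lia.
have -> : t2 = (tperm (u^-1 y) e * u)%g.
  have ue : u e = e by rewrite (out_perm uB).
  rewrite -[e](permK u) ue -tpermJ conjgE invgK -!mulgA mulVg mulg1.
  by rewrite /t2 cycS aj mulgA.
have uy : u^-1%g y \in B by rewrite -(perm_closed _ uB) permKV.
rewrite orbit_prod_merge // join_wt_e (@orbit_prod_add_at _ _ _ _ _ y).
  apply: orbit_prod_eq uB _ => i iB; rewrite /add_at join_wtR //.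
by apply/porbitP; exists 1; rewrite expg1 permKV.
Qed.
End Join.

Lemma plane_trees0 a : plane_trees a 0 = [set (1%g, [ffun => ord0])].
Proof.
apply/setP=> -[s w]; rewrite !inE geodesic1 /=; apply/andP/eqP=> [[/eqP s1 /forallP w0]|[-> ->]].
  rewrite -s1; congr (_, _); apply/ffunP=> i; rewrite ffunE; apply: val_inj => /=.
  by have := w0 i; rewrite itv0 inE /wt /=; case: (nat_of_ord (w i)).
by split=> //; apply/forallP=> i; rewrite /wt /= ffunE itv0 inE.
Qed.

Lemma black_planted0 be om a h : black_planted be om a 0 h = be h.
Proof.
rewrite /black_planted plane_trees0 big_set1 /black_prod /= itv0 orbit_prod0.
exact: mulr1.
Qed.

Section Split.
Variables (a l : nat).
Hypothesis le_l : a + l.+1 <= M.+1.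
Let e : T := inord (a + l).

(** The sizes at which a plane tree splits when its last root edge is cut. *)
Definition split_at z : 'I_l.+1 * 'I_H.+1 :=
  let x := ((rot z)^-1)%g e in
  (inord (if x == e then 0 else (x - a).+1), (z : _ * {ffun T -> _}).2 e).

Arguments split_at : simpl never.

Lemma split_join (j : 'I_l.+1) (k : 'I_H.+1) z1 z2 : 0 < k ->
  z1 \in plane_trees a j -> z2 \in plane_trees (a + j) (l - j) ->
  split_at (join a l j k z1 z2) = (j, k).
Proof.
move=> k0 z1P z2P; have le_j : j <= l by rewrite -ltnS.
have [g1 g2] : geodesic (rot z1) (cyc a j) /\ geodesic (rot z2) (cyc (a + j) (l - j)).
  by move: z1P z2P; rewrite !inE => /andP[-> _] /andP[-> _].
have on1 : perm_on (itv a j) (rot z1) by apply: geodesic_on g1; move: le_l le_j; clear; lia.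
have on2 : perm_on (itv (a + j) (l - j)) (rot z2).
  by apply: geodesic_on g2; move: le_l le_j; clear; lia.
have se : (rot z1 * rot z2)%g e = e.
  rewrite permM (out_perm on1) ?(out_perm on2) // inE inordK; move: le_l le_j; clear; lia.
have xE : ((rot (join a l j k z1 z2))^-1)%g e = anchor M a l j.
  by apply: (canLR (permK _)); rewrite /rot [in RHS]permM tpermL se.
congr pair; last by apply: val_inj; rewrite /= ffunE eqxx inordK // ltn_ord.
rewrite xE /anchor; case: (eqVneq (j : nat) 0) => [j0|j0].
  by rewrite eqxx; apply: val_inj; rewrite /= inordK.
rewrite -val_eqE /= !inordK; try by move: j0 le_l le_j; clear; lia.
case: eqP => [|_]; first by move: j0 le_j; clear; lia.
by apply: val_inj; rewrite /= inordK; move: j0 le_j; clear; lia.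
Qed.

Lemma join_inj (j : 'I_l.+1) (k : 'I_H.+1) z1 z2 z1' z2' : 0 < k ->
  z1 \in plane_trees a j -> z2 \in plane_trees (a + j) (l - j) ->
  z1' \in plane_trees a j -> z2' \in plane_trees (a + j) (l - j) ->
  join a l j k z1 z2 = join a l j k z1' z2' -> z1 = z1' /\ z2 = z2'.
Proof.
move=> k0 z1P z2P z1P' z2P'; have le_j : j <= l by rewrite -ltnS.
have kH : 0 < k <= H by rewrite k0 -ltnS ltn_ord.
have AB : [disjoint itv a j & itv (a + j) (l - j)] by exact: itv_disjoint.
case=> /mulgI s12 w12.
have w12' : join_weight a l j k z1 z2 = join_weight a l j k z1' z2' by [].
have [g1 w1] : geodesic (rot z1) (cyc a j) /\ forall i, (0 < wt z1 i) = (i \in itv a j).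
  by move: z1P; rewrite inE => /andP[-> /forallP H']; split=> // i; exact: (eqP (H' i)).
have [g2 w2] : geodesic (rot z2) (cyc (a + j) (l - j)) /\ forall i, (0 < wt z2 i) = (i \in itv (a + j) (l - j)).
  by move: z2P; rewrite inE => /andP[-> /forallP H']; split=> // i; exact: (eqP (H' i)).
have [g1' w1'] : geodesic (rot z1') (cyc a j) /\ forall i, (0 < wt z1' i) = (i \in itv a j).
  by move: z1P'; rewrite inE => /andP[-> /forallP H']; split=> // i; exact: (eqP (H' i)).
have [g2' w2'] : geodesic (rot z2') (cyc (a + j) (l - j)) /\ forall i, (0 < wt z2' i) = (i \in itv (a + j) (l - j)).
  by move: z2P'; rewrite inE => /andP[-> /forallP H']; split=> // i; exact: (eqP (H' i)).
have leA : a + j <= M.+1 by move: le_l le_j; clear; lia.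
have leB : a + j + (l - j) <= M.+1 by move: le_l le_j; clear; lia.
have on1 := geodesic_on leA g1; have on1' := geodesic_on leA g1'.
have on2 := geodesic_on leB g2; have on2' := geodesic_on leB g2'.
have es1 : rot z1 = rot z1'.
  apply/permP=> i; have [iA|iA] := boolP (i \in itv a j).
    by rewrite -(disj_permL on1 on2 AB) // -(disj_permL on1' on2' AB) // s12.
  by rewrite (out_perm on1) // (out_perm on1').
have es2 : rot z2 = rot z2' by move: s12; rewrite -/(rot z1) es1 => /mulgI.
have wE i : wt (join a l j k z1 z2) i = wt (join a l j k z1' z2') i.
  by rewrite /wt /= w12'.
have ew1 i : wt z1 i = wt z1' i.
  have [iA|iA] := boolP (i \in itv a j).
    by rewrite -(join_wtL le_l le_j kH z1P z2P iA) wE (join_wtL le_l le_j kH z1P' z2P' iA).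
  by move: (w1 i) (w1' i); rewrite (negbTE iA); do 2 case: (wt _ i).
have ew2 i : wt z2 i = wt z2' i.
  have [iB|iB] := boolP (i \in itv (a + j) (l - j)).
    by rewrite -(join_wtR le_l le_j kH z1P z2P iB) wE (join_wtR le_l le_j kH z1P' z2P' iB).
  by move: (w2 i) (w2' i); rewrite (negbTE iB); do 2 case: (wt _ i).
move: es1 es2 ew1 ew2; case: (z1) (z2) (z1') (z2') => [s1 u1] [s2 u2] [s1' u1'] [s2' u2'].
rewrite /rot /wt /= => -> -> ew1 ew2; split; congr (_, _); apply/ffunP=> i.
  exact: val_inj (ew1 i).
exact: val_inj (ew2 i).
Qed.

Lemma join_surj z : z \in plane_trees a l.+1 ->
  exists j : 'I_l.+1, exists k : 'I_H.+1, exists z1 z2, [/\ 0 < k,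
    z1 \in plane_trees a j, z2 \in plane_trees (a + j) (l - j) & z = join a l j k z1 z2].
Proof.
case: z => s w; rewrite inE => /andP[/= g /forallP /= w0].
have [j [s1 [s2 [le_j g1 g2 sE]]]] := geodesic_unjoin le_l g.
have lt_j : j < l.+1 by [].
pose cut (A : {set T}) : {ffun T -> 'I_H.+1} := [ffun i => if i \in A then w i else ord0].
exists (Ordinal lt_j), (w e), (s1, cut (itv a j)), (s2, cut (itv (a + j) (l - j))).
have ie : e \in itv a l.+1 by rewrite (itvS le_l) inE set11.
split; first by rewrite -/(wt (s, w) e) (eqP (w0 e)).
- rewrite inE /= g1; apply/forallP=> i; rewrite /wt /= ffunE; case: ifP => // iA.
  by rewrite -/(wt (s, w) i) (eqP (w0 i)) (itvS le_l) in_setU1 (itvU a le_j) in_setU iA orbT.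
- rewrite inE /= g2; apply/forallP=> i; rewrite /wt /= ffunE; case: ifP => // iA.
  by rewrite -/(wt (s, w) i) (eqP (w0 i)) (itvS le_l) in_setU1 (itvU a le_j) in_setU iA !orbT.
rewrite /join -sE; congr (_, _); apply/ffunP=> i; rewrite !ffunE /= inord_val.
case: eqP => [->//|/eqP ie']; case iA: (i \in itv a j) => //.
case iB: (i \in itv (a + j) (l - j)) => //.
have := w0 i; rewrite (itvS le_l) in_setU1 (itvU a le_j) in_setU (negbTE ie') iA iB.
by rewrite /wt /= => /eqP wi; apply: val_inj => /=; move: wi; case: (nat_of_ord (w i)).
Qed.

(** Cutting the last edge of the root leaves a planted tree with the same root,
    whose deficit grew by the weight of the edge, and a planted tree of the
    other color whose deficit is that weight. *)
Lemma black_plantedS be om h :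
  black_planted be om a l.+1 h =
  (\sum_(j < l.+1) \sum_(k < H.+1 | (0 < k)%N)
     black_planted be om a j (h + k) * white_planted be om (a + j) (l - j) k)%R.
Proof.
rewrite /black_planted (partition_big split_at (fun jk => 0 < jk.2)); last first.
  by move=> z /join_surj[j [k [z1 [z2 [k0 z1P z2P ->]]]]]; rewrite split_join.
rewrite pair_big /=; apply: eq_big => // -[j k] /= k0.
have le_j : j <= l by rewrite -ltnS.
have kH : 0 < k <= H by rewrite k0 -ltnS ltn_ord.
set D := setX (plane_trees a j) (plane_trees (a + j) (l - j)).
rewrite (eq_bigl (mem ((fun p => join a l j k p.1 p.2) @: D))); last first.
  move=> z; apply/andP/imsetP=> [[zP /eqP zs]|[[z1 z2]]].
    have [j' [k' [z1 [z2 [k0' z1P z2P zE]]]]] := join_surj zP.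
    have := split_join k0' z1P z2P; rewrite -zE zs => -[ej ek].
    move: z1P z2P zE; rewrite -ej -ek => z1P z2P zE.
    by exists (z1, z2); rewrite // in_setX z1P.
  rewrite in_setX => /andP[z1P z2P] -> /=; rewrite split_join //; split=> //.
  exact: join_trees.
rewrite big_imset /=; last first.
  move=> [z1 z2] [z1' z2']; rewrite !in_setX => /andP[z1P z2P] /andP[z1P' z2P'] /=.
  by case/(join_inj k0 z1P z2P z1P' z2P') => -> ->.
rewrite big_distrlr /= pair_big /=; apply: eq_big => -[z1 z2]; first by rewrite in_setX.
rewrite in_setX => /andP[z1P z2P] /=; rewrite join_black // join_white //.
by rewrite /white_planted -!mulrA; congr (_ * _)%R; rewrite mulrCA !mulrA.
Qed.
End Split.

Section Mirror.
Variables (a l : nat).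
Hypothesis le_l : a + l <= M.+1.
Let b := M.+1 - (a + l).
Let r : {perm T} := perm (@rev_ord_inj M.+1).

Let val_r i : r i = M - i :> nat. Proof. by rewrite permE /= subSS. Qed.

Let rK i : r (r i) = i.
Proof. by apply: val_inj; rewrite /= !val_r; have := ltn_ord i; move: (nat_of_ord i); clear; lia. Qed.

Lemma cyc_mirror : ((cyc a l)^-1 ^ r)%g = cyc b l.
Proof.
apply/permP=> x; rewrite -{1}[x]rK permJ; set y := r x.
have -> : x = r y by rewrite /y rK.
rewrite -[y in RHS](permKV (cyc a l)); move: ((cyc a l)^-1%g y) => u.
apply: val_inj; rewrite val_cyc; last by rewrite /b; move: le_l; clear; lia.
rewrite /= !val_r /= val_cyc // /b; have := ltn_ord u; move: le_l (nat_of_ord u); clear => le_l n.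
by move=> lt_n; repeat case: ifP; lia.
Qed.

Lemma itv_mirror : r @: itv a l = itv b l.
Proof.
apply/setP=> i; apply/imsetP/idP=> [[j ja ->]|ib].
  by move: ja; rewrite !inE val_r /b; have := ltn_ord j; move: (nat_of_ord j) le_l; clear; lia.
exists (r i); rewrite ?rK // inE val_r; move: ib; rewrite inE /b.
by have := ltn_ord i; move: (nat_of_ord i) le_l; clear; lia.
Qed.

Definition mirror (z : decorated) : decorated :=
  (((cyc a l)^-1 * rot z) ^ r, [ffun i => (z : _ * {ffun T -> _}).2 (r i)])%g.

Lemma mirror_bij : bijective mirror.
Proof.
exists (fun z => (cyc a l * (rot z ^ r^-1), [ffun i => (z : _ * {ffun T -> _}).2 (r i)]))%g.
  move=> [s w]; rewrite /mirror /rot /=; congr (_, _); first by rewrite conjgK mulKVg.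
  by apply/ffunP=> i; rewrite !ffunE rK.
move=> [s w]; rewrite /mirror /rot /=; congr (_, _); first by rewrite mulKg conjgKV.
by apply/ffunP=> i; rewrite !ffunE rK.
Qed.

Lemma wt_mirror z i : wt (mirror z) (r i) = wt z i.
Proof. by rewrite /wt /= ffunE rK. Qed.

Lemma mem_mirror i : (r i \in itv b l) = (i \in itv a l).
Proof. by rewrite -itv_mirror mem_imset //; apply: perm_inj. Qed.

Lemma mirror_trees z : (mirror z \in plane_trees b l) = (z \in plane_trees a l).
Proof.
rewrite !inE; congr andb.
  rewrite -cyc_mirror /rot /= -/(rot z) geodesicJ /geodesic ncycV invMg invgK.
  have <- : ncyc ((rot z)^-1 * cyc a l)%g = ncyc ((cyc a l)^-1 * rot z)%g.
    by rewrite -ncycV invMg invgK.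
  by rewrite mulgK ncycV addnC.
apply/forallP/forallP=> H' i; last by rewrite -[i]rK wt_mirror mem_mirror.
by rewrite -wt_mirror -mem_mirror.
Qed.

(** Reflecting the plane while exchanging the colors turns the white-rooted
    planted trees into the black-rooted ones. *)
Lemma white_planted_mirror be om h : white_planted be om a l h = black_planted om be b l h.
Proof.
rewrite /black_planted (reindex mirror) /=; last exact: onW_bij mirror_bij.
apply: eq_big => [z|z zP]; first by rewrite mirror_trees.
rewrite mulrC -itv_mirror; congr (_ * _)%R.
  rewrite /white_prod /black_prod; case: (eqVneq l 0) => // l0.
  rewrite -itv_mirror [rot (mirror z)]/(_ ^ _)%g orbit_prodJ -orbit_prodV invMg invgK.
  apply: orbit_prod_ext => i; rewrite /add_at wt_mirror; congr (_ + (_ : bool) * h).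
  rewrite -val_eqE /= -[in RHS]val_eqE /= val_r !inordK; move: le_l l0 (ltn_ord i);
    by rewrite /b; move: (nat_of_ord i); clear; lia.
have -> : ((rot (mirror z))^-1 * cyc b l)%g = ((rot z)^-1 ^ r)%g.
  by rewrite -cyc_mirror /rot /= -/(rot z) -conjVg -conjMg invMg invgK mulgK.
rewrite orbit_prodJ orbit_prodV; apply: orbit_prod_ext => i; exact/esym/wt_mirror.
Qed.
End Mirror.
End Planted.

Section PlantedCount.
Variables (H : nat) (K : comNzRingType).
Implicit Types (be om : nat -> K).

(** Only the number of edges counts, not the interval that carries them: both
    sides satisfy the same recursion, by strong induction on [l] through the
    mirror image for the other color. *)
Lemma black_planted_shift M M' a a' l be om h :
  a + l <= M.+1 -> a' + l <= M'.+1 ->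
  black_planted M H be om a l h = black_planted M' H be om a' l h.
Proof.
have [n] := ubnP l; elim: n => // n IH in M M' a a' l be om h *.
case: l => [|l] lt_l le_a le_a'; first by rewrite !black_planted0.
rewrite !black_plantedS //; apply: eq_bigr => j _; apply: eq_bigr => k _.
have := ltn_ord j; move: (nat_of_ord j) => {}j lt_j.
rewrite !white_planted_mirror; [|move: le_a le_a' lt_j; clear; lia..].
by congr (_ * _)%R; apply: IH; move: lt_l le_a le_a' lt_j; clear; lia.
Qed.

(** The planted plane trees with [l] edges and deficit [h] at the root, each
    weighted by the product over its vertices of [be] or [om], according to
    color, at the weight of the vertex. *)
Definition planted be om l h : K := black_planted l H be om 0 l h.

Lemma black_plantedE M a l be om h : a + l <= M.+1 ->
  black_planted M H be om a l h = planted be om l h.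
Proof. by move=> le_l; apply: black_planted_shift. Qed.

Lemma white_plantedE M a l be om h : a + l <= M.+1 ->
  white_planted M H be om a l h = planted om be l h.
Proof.
by move=> le_l; rewrite white_planted_mirror // black_plantedE //; move: le_l; clear; lia.
Qed.

Lemma planted0 be om h : planted be om 0 h = be h.
Proof. exact: black_planted0. Qed.

Lemma plantedS be om l h :
  planted be om l.+1 h =
  (\sum_(j < l.+1) \sum_(k < H.+1 | (0 < k)%N) planted be om j (h + k) * planted om be (l - j) k)%R.
Proof.
rewrite {1}/planted black_plantedS //; apply: eq_bigr => j _; apply: eq_bigr => k _.
have := ltn_ord j; move: (nat_of_ord j) => {}j lt_j.
by rewrite black_plantedE ?white_plantedE //; move: lt_j; clear; lia.
Qed.

End PlantedCount.

(** * Bipartite trees *)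

Section BipartiteGraph.
Variables (B W E : finType) (x : E -> B) (y : E -> W).
Local Notation V := (B + W)%type.
Implicit Types (e f : E) (u v : V).

Definition badj : rel V := fun u v =>
  match u, v with
  | inl b, inr w | inr w, inl b => [exists e, (x e == b) && (y e == w)]
  | _, _ => false
  end.

Definition ends e v : bool := match v with inl b => x e == b | inr w => y e == w end.
Definition other e v : V := if v is inl _ then inr (y e) else inl (x e).

Lemma badj_sym : symmetric badj.
Proof. by case=> [b|w] [b'|w']. Qed.

Lemma ends_other e v : ends e (other e v).
Proof. by case: v => z /=. Qed.

Lemma otherK e v : ends e v -> other e (other e v) = v.
Proof. by case: v => z /= /eqP ->. Qed.

Lemma ends_or e u v : ends e u -> ends e v -> u = v \/ u = other e v.
Proof.
by case: u v => [b|w] [b'|w'] /= /eqP <- /eqP <-; [left|right|right|left].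
Qed.

Lemma other_neq e v : other e v != v.
Proof. by case: v. Qed.

Lemma badjP u v : reflect (exists2 e, ends e u & v = other e u) (badj u v).
Proof.
case: u v => [b|w] [b'|w'] /=; try (by constructor=> -[]).
  apply: (iffP existsP) => [[e /andP[xe /eqP <-]]|[e /eqP <- [->]]]; exists e => //.
  by rewrite !eqxx.
apply: (iffP existsP) => [[e /andP[/eqP <- ye]]|[e /eqP <- [->]]]; exists e => //.
by rewrite !eqxx.
Qed.

Hypothesis conn : forall u v, connect badj u v.

Section Rooted.
Variable r : V.

Lemma walk_exists v : exists n, [exists p : n.-tuple V, path badj r p && (last r p == v)].
Proof.
have /connectP[p pp lp] := conn r v; exists (size p); apply/existsP.
by exists (in_tuple p); rewrite /= pp lp eqxx.
Qed.

Definition depth v := ex_minn (walk_exists v).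

Lemma depth_step v : v != r -> exists e, ends e v && (depth (other e v) < depth v).
Proof.
move=> vr; rewrite {2}/depth; case: ex_minnP => n /existsP[[p /= /eqP pn] /andP[pp /eqP lp]] _.
case/lastP: p pn pp lp => [|p z] pn pp lp; first by rewrite /= in lp; rewrite lp eqxx in vr.
move: pp lp; rewrite rcons_path last_rcons => /andP[pp zz] zv; rewrite zv in zz.
rewrite badj_sym in zz; have /badjP[e ev eo] := zz; exists e; rewrite ev /= -eo.
rewrite -pn size_rcons ltnS /depth; case: ex_minnP => m _; apply; apply/existsP.
by exists (in_tuple p); rewrite /= pp eqxx.
Qed.

(** An edge towards the root; the parent edges of different vertices differ. *)
Definition parent v : option E := [pick e | ends e v && (depth (other e v) < depth v)].

Lemma parentP v : v != r ->
  exists e, [/\ parent v = Some e, ends e v & depth (other e v) < depth v].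
Proof.
rewrite /parent; case: pickP => [e /andP[ev dv] _|no /depth_step[e]]; first by exists e.
by rewrite no.
Qed.

Lemma parent_inj : {in [pred v | v != r] &, injective parent}.
Proof.
move=> u v ur vr; have [e [-> eu du]] := parentP ur; have [f [-> fv dv]] := parentP vr.
case=> ef; rewrite -{f}ef in fv dv *; have [//|uv] := ends_or eu fv.
by move: du dv; rewrite uv otherK //; lia.
Qed.

Lemma card_vertices_le : #|{: V}| <= #|E|.+1.
Proof.
rewrite (cardD1 r) inE add1n ltnS.
have -> : #|[predD1 {: V} & r]| = #|parent @: [pred v | v != r]|.
  rewrite card_in_imset; last exact: parent_inj.
  by apply: eq_card => v; rewrite !inE andbT.
have -> : #|E| = #|[set Some e | e in E]|.
  by rewrite card_imset //; move=> e f [].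
apply: subset_leq_card; apply/subsetP=> o /imsetP[v vr ->].
by have [e [-> _ _]] := parentP vr; apply: imset_f.
Qed.

Hypothesis tree_card : #|{: V}| = #|E|.+1.

Lemma parent_onto e : exists2 v, v != r & parent v = Some e.
Proof.
have sub : parent @: [pred v | v != r] \subset [set Some e | e in E].
  apply/subsetP=> o /imsetP[v vr ->].
  by have [f [-> _ _]] := parentP vr; apply: imset_f.
have /eqP EQ : parent @: [pred v | v != r] == [set Some e | e in E].
  rewrite eqEcard sub /= card_imset; last by move=> ? ? [].
  rewrite card_in_imset; last exact: parent_inj.
  rewrite -ltnS -tree_card [#|{: V}|](cardD1 r) inE add1n ltnS.
  by apply: eq_leq; apply: eq_card => v; rewrite !inE andbT.
have : Some e \in [set Some e | e in E] by exact: imset_f.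
by rewrite -EQ => /imsetP[v vr ->]; exists v.
Qed.

(** In a tree every edge has a lower end, and each vertex but the root is the
    lower end of exactly one edge. *)
Lemma lower_end : exists low : E -> V,
  [/\ injective low, forall v, v != r -> exists e, low e = v &
      forall e, [/\ low e != r, ends e (low e) & depth (other e (low e)) < depth (low e)]].
Proof.
have P e : exists v, (v != r) && (parent v == Some e).
  by have [v vr pv] := parent_onto e; exists v; rewrite vr pv eqxx.
pose low e := xchoose (P e).
have lowP e : low e != r /\ parent (low e) = Some e.
  by have /andP[-> /eqP] := xchooseP (P e).
exists low; split=> [e f ef|v vr|e].
- by have [_ pe] := lowP e; have [_ pf] := lowP f; move: pe; rewrite ef pf => -[].
- have [e [pv _ _]] := parentP vr; exists e; apply: parent_inj => //.
    by rewrite inE; have [] := lowP e.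
  by have [_ ->] := lowP e.
- have [lr pl] := lowP e; have [f [pf ef df]] := parentP lr.
  have fe : f = e by move: pf; rewrite pl => -[].
  by rewrite -fe in ef df *; rewrite fe in ef df *.
Qed.

End Rooted.

Section VertexSums.
Variable A : zmodType.
Implicit Types (w : E -> A).

Definition vsum w v : A := (\sum_(e | ends e v) w e)%R.

Lemma depth_bound r : exists n, forall v, depth r v < n.
Proof.
exists (\max_v depth r v).+1 => v; rewrite ltnS; exact: leq_bigmax.
Qed.

(** Going up from the leaves, a weighting of a tree is determined by its vertex
    sums. *)
Lemma tree_vsum0 w : #|{: V}| = #|E|.+1 -> (forall v, vsum w v = 0%R) -> forall e, w e = 0%R.
Proof.
move=> tc w0 e0; pose r : V := inl (x e0).
have [low [low_inj _ lowP]] := lower_end r tc; have [n dn] := depth_bound r.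
suff H k e : n - depth r (low e) < k -> w e = 0%R by exact: (H _ e0 (ltnSn _)).
elim: k e => // k IH e le_k.
have [_ el dl] := lowP e; have := w0 (low e); rewrite /vsum (bigD1 e) //= big1 ?addr0 //.
move=> f /andP[fl fe]; have [_ ff df] := lowP f.
have fo : low f = other f (low e).
  by have [/low_inj fe'|//] := ends_or ff fl; rewrite fe' eqxx in fe.
by apply: IH; move: df (dn (low f)) le_k; rewrite {1}fo otherK //; lia.
Qed.

Lemma tree_vsum_inj w w' : #|{: V}| = #|E|.+1 -> (forall v, vsum w v = vsum w' v) -> w =1 w'.
Proof.
move=> tc ww' e; apply/eqP; rewrite -subr_eq0; apply/eqP.
apply: (tree_vsum0 (w := fun e => (w e - w' e)%R) tc) => v.
by rewrite /vsum sumrB -/(vsum w v) ww' subrr.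
Qed.

Definition vsign v (a : A) : A := if v is inl _ then a else (- a)%R.

(** An amount placed with alternating signs along a path changes the vertex sums
    at the two ends of the path only. *)
Lemma vsum_transport u v (a : A) : exists w, forall z,
  vsum w z = (vsign z (if z == u then a else 0) - vsign z (if z == v then a else 0))%R.
Proof.
have /connectP[p pp ->] := conn u v; elim: p u pp => [|u' p IH] u /= => [_|/andP[uu' pp]].
  by exists (fun _ => 0%R) => z; rewrite subrr /vsum big1.
have [w wP] := IH u' pp; have /badjP[e eu eu'] := uu'.
exists (fun f => w f + (if f == e then vsign u a else 0))%R => z.
rewrite /vsum big_split /= -/(vsum w z) wP -big_mkcondr /= addrC addrCA addrA; congr (_ - _)%R.
have -> : (\sum_(i | ends i z && (i == e)) vsign u a = if ends e z then vsign u a else 0)%R.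
  case: ifP => ez; last by rewrite big_pred0 // => i; case: eqP => [->|_]; rewrite ?ez ?andbF.
  by rewrite (big_pred1 e) // => i /=; case: eqP => [->|_]; rewrite ?ez ?andbF.
have uz : (z == u) || (z == u') = ends e z.
  apply/orP/idP=> [[/eqP->//|/eqP->]|ez]; first by rewrite eu' ends_other.
  by have [->|->] := ends_or ez eu; [left|right; rewrite eu'].
rewrite -uz; case: (eqVneq z u) => [->|zu] /=.
  by rewrite eu' eq_sym (negbTE (other_neq e u)); case: (u) => ? /=; rewrite ?oppr0 add0r.
case: (eqVneq z u') => [->|zu'] /=; last by case: (z) => ? /=; rewrite ?oppr0 addr0.
by rewrite eu'; case: (u) => ? /=; rewrite ?opprK ?oppr0 ?addNr ?subrr.
Qed.

(** In a connected graph every target with equal black and white totals is a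
    family of vertex sums: send the excess of each vertex to a root. *)
Lemma vsum_surj (t : V -> A) :
  (\sum_b t (inl b) = \sum_c t (inr c))%R -> E -> exists w, forall v, vsum w v = t v.
Proof.
move=> bal e0; pose r : V := inl (x e0).
have [w wP] := fin_all_exists (fun u => vsum_transport u r (vsign u (t u))).
exists (fun e => \sum_u w u e)%R => z; rewrite /vsum exchange_big /=.
rewrite (eq_bigr (fun u => vsign z (if z == u then vsign u (t u) else 0) -
  vsign z (if z == r then vsign u (t u) else 0))%R); last by move=> u _; rewrite -wP.
rewrite big_split /= sumrN (bigD1 z) //= eqxx big1 => [|u uz]; last first.
  by rewrite eq_sym (negbTE uz); case: (z) => ? /=; rewrite ?oppr0.
rewrite addr0 [X in (_ - X)%R](_ : _ = 0)%R.
  by case: (z) => ? /=; rewrite ?opprK subr0.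
case: (z == r); last by rewrite big1 // => u _; case: (z) => ? /=; rewrite ?oppr0.
have S : (\sum_u vsign u (t u) = 0)%R.
  by rewrite big_sumType /= sumrN bal subrr.
by case: (z) => ? /=; rewrite ?sumrN S ?oppr0.
Qed.

End VertexSums.

Hypothesis tree_card : #|{: V}| = #|E|.+1.

Lemma tree_ends_inj : injective (fun e => (x e, y e)).
Proof.
move=> e f [ex ey]; pose r : V := inl (x e).
have [low [low_inj _ lowP]] := lower_end r tree_card.
have [_ le de] := lowP e; have [_ lf df] := lowP f; apply: low_inj.
have lfe : ends e (low f) by case: (low f) lf => z /=; rewrite ?ex ?ey.
have [//|lo] := ends_or le lfe; have oe u : other e u = other f u by case: u => ? /=; rewrite ?ex ?ey.
by move: de df; rewrite lo otherK // -oe; lia.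
Qed.

(** On a cycle a vertex of maximal depth would have two edges towards the
    root. *)
Lemma tree_acyclic (c : seq V) : ucycle badj c -> size c <= 2.
Proof.
move=> cc; rewrite leqNgt; apply/negP=> c3.
have [v0 v0c] : exists v, v \in c by case: c c3 {cc} => // v c; exists v; rewrite mem_head.
have [e0 _] : exists e : E, true.
  have /andP[cyc_c _] := cc; case: c c3 cyc_c {cc v0c} => [|u [|v c]] //= _.
  by case/andP=> /badjP[e _ _] _; exists e.
pose r : V := inl (x e0); have [low [low_inj _ lowP]] := lower_end r tree_card.
case: (arg_maxnP (fun v => depth r v) (P := mem c) v0c) => v vc vmax.
have [i s Es] := rot_to vc.
have : ucycle badj (v :: s) by rewrite -Es rot_ucycle.
have s3 : 2 < size (v :: s) by rewrite -Es size_rot.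
have sc u : u \in s -> depth r u <= depth r v.
  by move=> us; apply: vmax; rewrite /= -(mem_rot i) Es inE us orbT.
have up u : u \in s -> badj v u -> exists2 e, low e = v & u = other e v.
  move=> us /badjP[e ev eu]; exists e => //; have [_ el dl] := lowP e.
  have [//|lo] := ends_or el ev; move: dl (sc _ us); rewrite lo eu otherK //; lia.
case/lastP: s s3 sc up {Es} => [|s z] //; case: s => [|u s] // _ _ up.
rewrite /ucycle /= rcons_path last_rcons => /andP[/and3P[vu _ zv] /and3P[_ uz _]].
rewrite badj_sym in zv.
have [|e ev eu] := up u _ vu; first by rewrite mem_head.
have [|f fv fz] := up z _ zv; first by rewrite inE mem_rcons mem_head orbT.
have ef : e = f by apply: low_inj; rewrite ev fv.
by move: uz; rewrite mem_rcons inE eu fz ef eqxx.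
Qed.

End BipartiteGraph.

(** A connected graph without cycles has one vertex more than edges: an edge
    outside of the parent edges would close a cycle. *)
Lemma acyclic_card (B W E : finType) (x : E -> B) (y : E -> W) (r : B + W) :
  (forall u v, connect (badj x y) u v) -> injective (fun e => (x e, y e)) ->
  (forall c, ucycle (badj x y) c -> size c <= 2) -> #|{: B + W}| = #|E|.+1.
Proof.
move=> conn inj_e acyc; pose par := parent conn r.
suff onto e : exists2 v, v != r & par v = Some e.
  apply/eqP; rewrite eqn_leq (card_vertices_le conn r) (cardD1 r) inE add1n ltnS.
  have -> : #|[predD1 {: B + W} & r]| = #|par @: [pred v | v != r]|.
    rewrite card_in_imset; last exact: parent_inj.
    by apply: eq_card => v; rewrite !inE andbT.
  have <- : #|[set Some e | e in E]| = #|E| by rewrite card_imset // => e f [].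
  apply: subset_leq_card; apply/subsetP=> o /imsetP[e _ ->].
  by have [v vr <-] := onto e; apply: imset_f.
case: (boolP [exists v, (v != r) && (par v == Some e)]) => [/existsP[v /andP[vr /eqP pv]]|].
  by exists v.
(* Adjacency by the edges other than [e] already connects all vertices to [r]. *)
move/existsPn=> no; pose adj' u v := [exists f, [&& f != e, ends x y f u & v == other x y f u]].
have adj'_sym : symmetric adj'.
  suff H u v : adj' u v -> adj' v u by move=> u v; apply/idP/idP; apply: H.
  move=> /existsP[f /and3P[fe fu /eqP ->]]; apply/existsP; exists f.
  by rewrite fe ends_other otherK ?eqxx.
have toR v : connect adj' v r.
  have [n] := ubnP (depth conn r v); elim: n v => // n IH v lt_n.
  have [->|vr] := eqVneq v r; first exact: connect0.
  have [f [pf fv df]] := parentP conn vr; apply: connect_trans (IH _ (leq_trans df lt_n)).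
  apply: connect1; apply/existsP; exists f; rewrite fv eqxx !andbT.
  by apply: contraNneq (no v) => <-; rewrite vr /par pf eqxx.
pose u : B + W := inl (x e); pose v : B + W := inr (y e).
have : connect adj' u v by rewrite (same_connect_r (sym_connect_sym adj'_sym) (toR v)).
case/connectP=> p pp pv; move: pv; case/shortenP: pp => {}p pp up _ pv.
have sub : subrel adj' (badj x y).
  by move=> a b /existsP[f /and3P[_ fa /eqP fb]]; apply/badjP; exists f.
have /acyc : ucycle (badj x y) (u :: p).
  rewrite /ucycle up andbT /= rcons_path (sub_path sub pp) -pv /=.
  by apply/existsP; exists e; rewrite !eqxx.
case: p pp up pv => [|z [|? ?]] //= pp _ pv _.
case/andP: pp => /existsP[f /and3P[fe /= /eqP xf /eqP zf]] _.
by rewrite zf in pv; case: pv => yf; move/eqP: fe => []; apply: inj_e; rewrite /= xf yf.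
Qed.

Section OneFace.
Variables (B W E : finType) (x : E -> B) (y : E -> W) (s t : {perm E}).
Hypothesis conn : forall u v, connect (badj x y) u v.
Hypothesis tree_card : #|{: B + W}| = #|E|.+1.
Hypothesis sP : forall e f, (f \in porbit s e) = (x f == x e).
Hypothesis tP : forall e f, (f \in porbit t e) = (y f == y e).
Let c := (s * t)%g.
Local Notation same e f := (porbit c e = porbit c f).

Let same1 e : same e (c e).
Proof. by rewrite (porbit_perm c 1). Qed.

(** By induction from the leaves towards the root, all edges at a vertex lie on
    the same face: the subtree below an edge is enclosed by the face passing
    along both sides of that edge. *)
Lemma tree_one_face e f : f \in porbit c e.
Proof.
pose r : B + W := inl (x e); have [low [low_inj lowE lowP]] := lower_end conn r tree_card.
have [n dn] := depth_bound conn r.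
have chain (g : {perm E}) a : (forall k, same ((g ^+ k)%g a) ((g ^+ k.+1)%g a) \/ (g ^+ k.+1)%g a = a) ->
    forall b, b \in porbit g a -> same b a.
  move=> H b /porbitP[k ->]; elim: k => [|k IH]; first by rewrite expg0 perm1.
  by have [<-//|->] := H k.
have up a v : ends x y a v -> low a <> v -> low a = other x y a v /\ depth conn r v < depth conn r (low a).
  have [_ la da] := lowP a => av /eqP nv; have [lv|lo] := ends_or la av; first by rewrite lv eqxx in nv.
  by split=> //; move: da; rewrite {1}lo otherK.
(* A walk that goes down along [a] comes up again to the next edge at the upper
   end of [a]. *)
pose Q a := if low a is inl _ then same a (t a) else same (s^-1%g a) a.
have cs a : same (s^-1%g a) (t a) by rewrite (same1 (s^-1%g a)) permM permKV.
have key k a : n - depth conn r (low a) < k ->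
    (forall b, ends x y b (low a) -> same b a) /\ Q a.
  elim: k a => // k IH a le_k; have [_ la _] := lowP a.
  have IHb b : ends x y b (low a) -> b <> a -> low b = other x y b (low a) /\ Q b.
    move=> bl ba; have [|lo db] := up b (low a) bl; first by move=> /low_inj.
    by split=> //; apply: (proj2 (IH b _)); move: db (dn (low b)) le_k; lia.
  rewrite /Q; case: (low a) la IHb => [b0|w0] /= /eqP la IHb.
    have S b : x b == b0 -> same b a.
      rewrite -la -sP; apply: chain => j; have [->|nj] := eqVneq ((s ^+ j.+1)%g a) a; first by right.
      left; have [|_] := IHb ((s ^+ j.+1)%g a) _ (elimN eqP nj).
        by rewrite -la -sP mem_porbit.
      rewrite /Q; have [|->] := IHb ((s ^+ j.+1)%g a) _ (elimN eqP nj).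
        by rewrite -la -sP mem_porbit.
      by rewrite expgSr permM permK.
    split=> //; rewrite -(cs a); apply/esym/S; rewrite -la -sP porbit_sym.
    by rewrite -{1}[a](permKV s) (mem_porbit s 1).
  have S b : y b == w0 -> same b a.
    rewrite -la -tP -porbitV; apply: chain => j.
    have [->|nj] := eqVneq ((t^-1 ^+ j.+1)%g a) a; first by right.
    have tj : y ((t^-1 ^+ j.+1)%g a) == w0 by rewrite -la -tP -porbitV mem_porbit.
    left; have [lo] := IHb _ tj (elimN eqP nj).
    by rewrite /Q lo => ->; rewrite expgSr permM permKV.
  split=> //; rewrite (cs a); apply: S; rewrite -la -tP; exact: (mem_porbit t 1).
have vert v a b : ends x y a v -> ends x y b v -> same a b.
  have [->|vr] := eqVneq v r; last first.
    by have [a' <-] := lowE v vr => av bv; have [H _] := key _ a' (ltnSn _); rewrite (H a) // (H b).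
  move=> ar br; have ax : x a = x e := eqP ar.
  apply/esym; have : b \in porbit s a by rewrite sP ax.
  apply: chain => j; left; set h := ((s ^+ j.+1)%g a).
  have hr : ends x y h r by rewrite /= -ax -sP mem_porbit.
  have [|lo _] := up h r hr; first by have [/eqP] := lowP h.
  have [_] := key _ h (ltnSn _); rewrite /Q lo /= => <-.
  by rewrite /h expgSr permM permK.
rewrite -eq_porbit_mem; apply/eqP.
have /connectP[p pp lp] := conn (inl (x f)) (inl (x e)).
have : ends x y f (inl (x f)) by rewrite /=.
move: (inl (x f)) pp lp => u0 pp lp fu.
elim: p f u0 pp lp fu => [|v p IH] a u /= => [_ <- au|/andP[/badjP[g gu gv] pp] lp au].
  by apply: vert au _; rewrite /=.
by rewrite (vert _ a g au gu); apply: (IH g v) => //; rewrite gv ends_other.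
Qed.
End OneFace.

Section FaceConnected.
Variables (B W E : finType) (x : E -> B) (y : E -> W) (s t : {perm E}).
Hypotheses (xs : forall e, x (s e) = x e) (yt : forall e, y (t e) = y e).
Hypothesis trans : forall e f, f \in porbit (s * t)%g e.
Hypotheses (x_surj : forall b, exists e, x e = b) (y_surj : forall w, exists e, y e = w).

(** Walking around a face that meets all edges connects all vertices. *)
Lemma one_face_connected u v : connect (badj x y) u v.
Proof.
have symm : connect_sym (badj x y) by exact/sym_connect_sym/badj_sym.
have edge e : connect (badj x y) (inl (x e)) (inr (y e)).
  by apply: connect1; apply/badjP; exists e => /=.
have face e f : connect (badj x y) (inl (x e)) (inl (x f)).
  have /porbitP[n ->] := trans e f; elim: n => [|n IH]; first by rewrite expg0 perm1.
  apply: connect_trans IH _; rewrite expgSr permM; move: (((s * t) ^+ n)%g e) => a; rewrite permM.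
  rewrite -(xs a); apply: connect_trans (edge _) _; rewrite symm -(yt (s a)); exact: edge.
have H w : exists e, connect (badj x y) (inl (x e)) w.
  by case: w => w; [have [e <-] := x_surj w|have [e <-] := y_surj w]; exists e; [apply: connect0|apply: edge].
have [e eu] := H u; have [f fv] := H v.
by apply: connect_trans (connect_trans (face e f) fv); rewrite symm.
Qed.
End FaceConnected.

(** * Trees given by two permutations *)

Section PermTree.
Variables (E : finType) (s t : {perm E}).
Hypothesis trans : forall e f, f \in porbit (s * t)%g e.

(** The graph whose vertices are the orbits of the two permutations. *)
Definition orbit_vertex (u : {perm E}) := {O : {set E} | O \in porbits u}.
Definition vertex_of (u : {perm E}) e : orbit_vertex u := exist _ (porbit u e) (imset_f _ isT).

Lemma vertex_of_eq (u : {perm E}) e f : (vertex_of u e == vertex_of u f) = (e \in porbit u f).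
Proof. by rewrite -val_eqE /= eq_porbit_mem. Qed.

Lemma vertex_ofP (u : {perm E}) (v : orbit_vertex u) : exists e, v = vertex_of u e.
Proof.
case: v => O OP; have /imsetP[e _ Oe] := OP; exists e; apply: val_inj; exact: Oe.
Qed.

Lemma card_orbit_vertex (u : {perm E}) : #|{: orbit_vertex u}| = ncyc u.
Proof. by rewrite card_sig; apply: eq_card => O. Qed.

Let x := vertex_of s.
Let y := vertex_of t.

Lemma perm_graph_connected u v : connect (badj x y) u v.
Proof.
have inv (r : {perm E}) e : vertex_of r (r e) = vertex_of r e.
  by apply/eqP; rewrite vertex_of_eq (mem_porbit r 1).
apply: (one_face_connected (inv s) (inv t) trans) => w.
  by have [e ->] := vertex_ofP w; exists e.
by have [e ->] := vertex_ofP w; exists e.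
Qed.

Lemma vsum_black (A : zmodType) (w : E -> A) e :
  vsum x y w (inl (x e)) = (\sum_(i in porbit s e) w i)%R.
Proof. by apply: eq_bigl => i /=; rewrite vertex_of_eq. Qed.

Lemma vsum_white (A : zmodType) (w : E -> A) e :
  vsum x y w (inr (y e)) = (\sum_(i in porbit t e) w i)%R.
Proof. by apply: eq_bigl => i /=; rewrite vertex_of_eq. Qed.

Lemma perm_tree_inj (A : zmodType) (w w' : E -> A) : ncyc s + ncyc t = (size_of E).+1 ->
  (forall e, \sum_(i in porbit s e) w i = \sum_(i in porbit s e) w' i)%R ->
  (forall e, \sum_(i in porbit t e) w i = \sum_(i in porbit t e) w' i)%R -> w =1 w'.
Proof.
move=> tc bw ww; apply: (tree_vsum_inj perm_graph_connected).
  by rewrite card_sum !card_orbit_vertex.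
by case=> v; have [e ->] := vertex_ofP v; rewrite ?vsum_black ?vsum_white.
Qed.

Lemma perm_tree_surj (A : zmodType) (a b : {set E} -> A) : E ->
  (\sum_(O in porbits s) a O = \sum_(O in porbits t) b O)%R ->
  exists w : E -> A, forall e, (\sum_(i in porbit s e) w i = a (porbit s e))%R /\
                               (\sum_(i in porbit t e) w i = b (porbit t e))%R.
Proof.
move=> e0 bal; have S (u : {perm E}) (c : {set E} -> A) :
    (\sum_(O in porbits u) c O = \sum_(v : orbit_vertex u) c (val v))%R.
  by rewrite big_sub //; apply: eq_bigl.
pose tgt (v : orbit_vertex s + orbit_vertex t) := match v with inl k => a (val k) | inr k => b (val k) end.
have [|w wP] := vsum_surj perm_graph_connected (t := tgt) _ e0; first by rewrite /= -!S.
exists w => e; split; first by rewrite -vsum_black wP.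
by rewrite -vsum_white wP.
Qed.
End PermTree.

(** * Cyclic covers of a permutation *)

Section SkewProduct.
Variables (T : finType) (d : nat) (A : finZmodType) (u1 : A).
Hypotheses (cardA : #|A| = d) (u1d : (u1 *+ d = 0)%R) (u1_gen : forall x : A, exists k, x = (u1 *+ k)%R).
Local Notation TA := (T * A)%type.
Implicit Types (s : {perm T}) (h : T -> A) (K : {set T}) (O : {set TA}).

(** The permutations commuting with the shift of the second component are the
    skew products of a permutation of [T] with translations of [A]. *)
Definition skew_fun s h (e : TA) : TA := (s e.1, (e.2 + h e.1)%R).

Lemma skew_inj s h : injective (skew_fun s h).
Proof.
by move=> [i x] [j y] [/perm_inj ij]; rewrite ij => E; rewrite (addIr _ E).
Qed.

Definition skew s h : {perm TA} := perm (@skew_inj s h).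

Lemma skewE s h i x : skew s h (i, x) = (s i, (x + h i)%R).
Proof. by rewrite permE. Qed.

Definition shift : {perm TA} := skew 1%g (fun=> u1).

Lemma shift_pow k i x : (shift ^+ k)%g (i, x) = (i, (x + u1 *+ k)%R).
Proof.
elim: k => [|k IH]; first by rewrite expg0 perm1 addr0.
by rewrite expgSr permM IH skewE perm1 -addrA -mulrSr.
Qed.

Lemma shift_order : (shift ^+ d = 1)%g.
Proof.
by apply/permP=> -[i x]; rewrite shift_pow perm1 u1d addr0.
Qed.

Lemma skew_commute s h : commute (skew s h) shift.
Proof.
by apply/permP=> -[i x]; rewrite !permM !skewE !perm1 addrAC.
Qed.

Lemma skew_of_commute (u : {perm TA}) : commute u shift ->
  exists s h, u = skew s h.
Proof.
move=> cu; have H k i x : u (i, (x + u1 *+ k)%R) = ((u (i, x)).1, ((u (i, x)).2 + u1 *+ k)%R).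
  have -> : (i, (x + u1 *+ k)%R) = (shift ^+ k)%g (i, x) by rewrite shift_pow.
  by rewrite -permM -(commuteX k cu) permM {1}(surjective_pairing (u (i, x))) shift_pow.
have H0 i x : u (i, x) = ((u (i, 0%R)).1, ((u (i, 0%R)).2 + x)%R).
  by have [k ->] := u1_gen x; rewrite -{1}[(u1 *+ k)%R]add0r H.
have inj : injective (fun i => (u (i, 0%R)).1).
  move=> i j ij; have E : u (i, (- (u (i, 0%R)).2)%R) = u (j, (- (u (j, 0%R)).2)%R).
    by rewrite H0 [RHS]H0 ij !subrr.
  by have [] := perm_inj E.
exists (perm inj), (fun i => (u (i, 0%R)).2); apply/permP=> -[i x].
by rewrite skewE permE H0 addrC.
Qed.

Section OnePerm.
Variables (s : {perm T}) (h : T -> A).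
Let L := skew s h.

(** Translation accumulated by [k] steps from [i], and around a whole orbit. *)
Definition walk i k : A := (\sum_(j < k) h ((s ^+ j)%g i))%R.
Definition hol (K : {set T}) : A := (\sum_(i in K) h i)%R.

Lemma skew_pow k i x : (L ^+ k)%g (i, x) = ((s ^+ k)%g i, (x + walk i k)%R).
Proof.
elim: k => [|k IH]; first by rewrite !expg0 !perm1 /walk big_ord0 addr0.
by rewrite !expgSr !permM IH skewE /walk big_ord_recr /= addrA.
Qed.

Lemma walk_hol i : walk i #|porbit s i| = hol (porbit s i).
Proof.
rewrite /hol (eq_bigl (mem (traject s i #|porbit s i|))); last exact: porbit_traject.
rewrite -big_uniq ?uniq_traject_porbit //= /walk -(big_mkord xpredT (fun j => h ((s ^+ j)%g i))).
rewrite (big_nth i) size_traject big_nat [RHS]big_nat; apply: eq_bigr => j /= lt_j.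
by rewrite nth_traject // permX.
Qed.

Lemma skew_pow_hol i x : (L ^+ #|porbit s i|)%g (i, x) = (i, (x + hol (porbit s i))%R).
Proof. by rewrite skew_pow walk_hol permX iter_porbit. Qed.

Lemma shadow_porbit i x : fst @: porbit L (i, x) = porbit s i.
Proof.
apply/setP=> j; apply/imsetP/porbitP=> [[_ /porbitP[n ->] ->]|[n ->]].
  by exists n; rewrite skew_pow.
by exists ((L ^+ n)%g (i, x)); rewrite ?mem_porbit // skew_pow.
Qed.

Definition orbits_over K : {set {set TA}} := [set O in porbits L | fst @: O == K].

Lemma orbits_overE i : orbits_over (porbit s i) = [set porbit L (i, x) | x : A].
Proof.
apply/setP=> O; rewrite inE; apply/andP/imsetP=> [[/imsetP[[j x] _ ->] ]|[x _ ->]]; last first.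
  by rewrite shadow_porbit eqxx; split=> //; apply: imset_f.
rewrite shadow_porbit eq_porbit_mem porbit_sym => /porbitP[n jn]; exists ((L ^+ n)%g (j, x)).2 => //.
apply/esym/eqP; rewrite eq_porbit_mem; apply/porbitP; exists n; rewrite skew_pow jn //.
Qed.

Lemma ncyc_skew : ncyc L = \sum_(K in porbits s) #|orbits_over K|.
Proof.
rewrite /ncyc -sum1_card (partition_big (fun O => fst @: O) (mem (porbits s))) /=; last first.
  by move=> _ /imsetP[[i x] _ ->]; rewrite shadow_porbit; apply: imset_f.
by apply: eq_bigr => K _; rewrite -sum1_card; apply: eq_bigl => O; rewrite inE.
Qed.

Lemma shift_porbit e k : ((shift ^+ k)%g @: porbit L e) = porbit L ((shift ^+ k)%g e).
Proof.
rewrite -porbitJ; congr (porbit _ _); rewrite conjgE.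
have -> : (L * shift ^+ k = shift ^+ k * L)%g by apply: commuteX; apply: skew_commute.
by rewrite mulKg.
Qed.

(** The cyclic group generated by the shift permutes the orbits above [K]
    transitively. *)
Lemma card_orbits_over_dvd K : K \in porbits s -> #|orbits_over K| %| d.
Proof.
move=> /imsetP[i _ ->]; rewrite orbits_overE.
have -> : [set porbit L (i, x) | x : A] = orbit 'P^* <[shift]> (porbit L (i, 0%R)).
  apply/setP=> O; apply/imsetP/orbitP=> [[x _ ->]|[a /cycleP[k ->] <-]].
    have [k ->] := u1_gen x; exists (shift ^+ k)%g; first by rewrite mem_cycle.
    have -> : (i, u1 *+ k)%R = (shift ^+ k)%g (i, 0%R) by rewrite shift_pow add0r.
    by rewrite -shift_porbit; apply: eq_imset => e; rewrite /= apermE.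
  exists (u1 *+ k)%R => //; have -> : (i, u1 *+ k)%R = (shift ^+ k)%g (i, 0%R) by rewrite shift_pow add0r.
  by rewrite -shift_porbit; apply: eq_imset => e; rewrite /= apermE.
apply: dvdn_trans (dvdn_orbit _ _ _) _; rewrite -orderE order_dvdn; exact/eqP/shift_order.
Qed.

Lemma hol0_of_card i : #|orbits_over (porbit s i)| = d -> hol (porbit s i) = 0%R.
Proof.
rewrite orbits_overE => cd; have /imset_injP inj : #|[set porbit L (i, x) | x : A]| == #|A| by rewrite cd cardA.
have : porbit L (i, 0%R) = porbit L (i, hol (porbit s i)).
  by rewrite -[hol _]add0r -skew_pow_hol porbit_perm.
by move/(inj _ _ isT isT) => <-.
Qed.

Lemma walk_add i k n : walk i (k + n) = (walk i k + walk ((s ^+ k)%g i) n)%R.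
Proof.
rewrite /walk big_split_ord /=; congr (_ + _)%R; apply: eq_bigr => j _.
by rewrite expgD permM.
Qed.

(** The two extreme cases: above an orbit with trivial holonomy lie [d] copies
    of it, and above one whose holonomy generates [A] lies a single orbit. *)
Lemma card_hol0 i : hol (porbit s i) = 0%R -> #|orbits_over (porbit s i)| = d.
Proof.
move=> h0; rewrite orbits_overE card_imset ?cardA // => x y /eqP; rewrite eq_porbit_mem.
case/porbitP=> n; rewrite skew_pow => -[ni ->]; suff -> : walk i n = 0%R by rewrite addr0.
have [N] := ubnP n; elim: N n ni => // N IH n ni lt_n.
have [lt_c|le_c] := ltnP n #|porbit s i|; last first.
  rewrite -(subnKC le_c) walk_add walk_hol h0 add0r permX iter_porbit; apply: IH.
    by rewrite {1}ni -{1}(subnKC le_c) expgD permM [(s ^+ #|_|)%g i]permX iter_porbit.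
  have := card_porbit_neq0 s i; lia.
case: n ni lt_n lt_c => [|n] ni lt_n lt_c; first by rewrite /walk big_ord0.
have c0 : 0 < #|porbit s i| by rewrite lt0n card_porbit_neq0.
have := @nth_uniq _ i (traject s i #|porbit s i|) 0 n.+1.
rewrite !size_traject => /(_ c0 lt_c (uniq_traject_porbit s i)); rewrite !nth_traject // -!permX expg0 perm1 -ni eqxx.
by [].
Qed.

Lemma card_hol1 i : hol (porbit s i) = u1 -> #|orbits_over (porbit s i)| = 1.
Proof.
move=> h1; rewrite orbits_overE; apply/eqP/cards1P; exists (porbit L (i, 0%R)).
apply/setP=> O; rewrite inE; apply/imsetP/eqP=> [[x _ ->]|->]; last by exists 0%R.
have H k : porbit L (i, 0%R) = porbit L (i, u1 *+ k)%R.
  elim: k => [|k ->] //.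
  by rewrite mulrSr -{3}h1 -skew_pow_hol porbit_perm.
by have [k ->] := u1_gen x; rewrite -H.
Qed.

Variable w : T -> nat.

(** The weight above an orbit is [d] times the weight of the orbit, and the
    orbits above it share it equally. *)
Lemma orbits_over_sum i x :
  #|orbits_over (porbit s i)| * \sum_(e in porbit L (i, x)) w e.1 = d * \sum_(j in porbit s i) w j.
Proof.
have S O : O \in orbits_over (porbit s i) -> \sum_(e in O) w e.1 = \sum_(e in porbit L (i, x)) w e.1.
  rewrite orbits_overE => /imsetP[y _ ->].
  have [k yx] := u1_gen (y - x)%R.
  have -> : (i, y) = (shift ^+ k)%g (i, x) by rewrite shift_pow -yx addrC subrK.
  rewrite -shift_porbit big_imset /=; last by move=> ? ? _ _; apply: perm_inj.
  by apply: eq_bigr => -[j z] _; rewrite shift_pow.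
rewrite -sum_nat_const -(eq_bigr _ S) -cardA mulnC big_distrl /=.
transitivity (\sum_(e : TA | e.1 \in porbit s i) w e.1); last first.
  rewrite (eq_bigl (fun e : TA => (e.1 \in porbit s i) && true)) => [|e]; last by rewrite andbT.
  rewrite -(pair_big_dep (fun j => j \in porbit s i) (fun _ _ => true) (fun j _ => w j)) /=.
  by apply: eq_bigr => j _; rewrite sum_nat_const mulnC.
rewrite [RHS](partition_big (porbit L) (mem (orbits_over (porbit s i)))) /=; last first.
  by move=> [j z] ji; rewrite inE imset_f //= shadow_porbit eq_porbit_mem.
apply: eq_bigr => O; rewrite inE => /andP[/imsetP[[j z] _ ->]].
rewrite shadow_porbit eq_porbit_mem => ji; apply: eq_bigl => -[k v] /=; rewrite eq_porbit_mem.
apply/idP/andP=> [kv|[_ //]]; split=> //.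
have := shadow_porbit j z; have : k \in fst @: porbit L (j, z) by apply/imsetP; exists (k, v).
move=> kf E; rewrite E in kf; rewrite -eq_porbit_mem (eqP (_ : porbit s k == porbit s j)).
  by rewrite eq_porbit_mem.
by rewrite eq_porbit_mem.
Qed.
End OnePerm.
End SkewProduct.

(** * Trees with a rotational symmetry *)

(** For correspondences of which neither direction is given by a formula. *)
Lemma card_rel (S1 S2 : finType) (X : {set S1}) (Y : {set S2}) (R : S1 -> S2 -> bool) :
  (forall a, a \in X -> exists2 b, b \in Y & R a b) ->
  (forall b, b \in Y -> exists2 a, a \in X & R a b) ->
  (forall a b b', a \in X -> b \in Y -> b' \in Y -> R a b -> R a b' -> b = b') ->
  (forall a a' b, a \in X -> a' \in X -> b \in Y -> R a b -> R a' b -> a = a') ->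
  #|X| = #|Y|.
Proof.
have le (S3 S4 : finType) (X' : {set S3}) (Y' : {set S4}) (R' : S3 -> S4 -> bool) :
   (forall a, a \in X' -> exists2 b, b \in Y' & R' a b) ->
   (forall a a' b, a \in X' -> a' \in X' -> b \in Y' -> R' a b -> R' a' b -> a = a') -> #|X'| <= #|Y'|.
  move=> ex un; pose f a := [pick b in Y' | R' a b].
  have fP a : a \in X' -> exists b, [/\ f a = Some b, b \in Y' & R' a b].
    move=> aX; rewrite /f; case: pickP => [b /andP[bY ab]|no]; first by exists b.
    by have [b bY ab] := ex a aX; have := no b; rewrite bY ab.
  have <- : #|f @: X'| = #|X'|.
    apply: card_in_imset => a a' aX aX' ff; have [b [fb bY ab]] := fP a aX.
    have [b' [fb' bY' ab']] := fP a' aX'; apply: (un a a' b) => //.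
    by have [->] : Some b = Some b' by rewrite -fb ff.
  have <- : #|Some @: Y'| = #|Y'| by apply: card_imset => b b' [].
  apply: subset_leq_card; apply/subsetP=> o /imsetP[a aX ->].
  by have [b [-> bY _]] := fP a aX; apply: imset_f.
move=> H1 H2 H3 H4; apply/eqP; rewrite eqn_leq (le _ _ _ _ R) //=.
by apply: (le _ _ _ _ (fun b a => R a b)) => // a a' b aX aX' bY; apply: H3.
Qed.

(** A proper divisor of [d] is at most [d / 2], so that the defect [d - 1] of the
    sum cannot be shared by two terms. *)
Lemma one_exception (I : finType) (P : pred I) (n : I -> nat) d m : 1 < d ->
  (forall i, P i -> n i %| d) -> \sum_(i | P i) n i = m * d + 1 -> #|P| <= m.+1 ->
  #|P| = m.+1 /\ exists i0, [/\ P i0, n i0 = 1 & forall i, P i -> i != i0 -> n i = d].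
Proof.
move=> d1 nd sn cP; have n_le i : P i -> n i <= d by move=> /nd; apply: dvdn_leq; exact: ltnW.
have S : \sum_(i | P i) (d - n i) + (m * d + 1) = #|P| * d.
  by rewrite -sn -big_split -sum_nat_const; apply: eq_bigr => i Pi /=; rewrite subnK ?n_le.
have cPE : #|P| = m.+1.
  apply/eqP; rewrite eqn_leq cP -(ltn_pmul2r (ltnW d1)) -S; lia.
split=> //; have S' : \sum_(i | P i) (d - n i) = d - 1 by move: S; rewrite cPE mulSn; lia.
case: (pickP (fun i => P i && (n i < d))) => [i0 /andP[P0 n0]|no]; last first.
  move: S'; rewrite big1 => [|i Pi]; first by lia.
  by have := no i; rewrite Pi /=; lia.
have half i : P i -> n i < d -> 2 * n i <= d.
  move=> Pi lt_n; have /dvdnP[c dc] := nd i Pi; case: c dc => [|[|c]] dc; [lia|lia|].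
  by rewrite [X in _ <= X]dc leq_mul2r orbT.
have other i : P i -> i != i0 -> n i = d.
  move=> Pi ii; apply/eqP; rewrite eqn_leq n_le //= leqNgt; apply/negP=> lt_n.
  have := half i Pi lt_n; have := half i0 P0 n0; move: S'.
  by rewrite (bigD1 i0) //= (bigD1 i) ?Pi //=; lia.
exists i0; split=> //; move: S'; rewrite (bigD1 i0) //= big1 => [|i /andP[Pi ii]]; first by lia.
by rewrite other ?subnn.
Qed.

Section RotationFixed.
Variables (M H d p q : nat) (A : finZmodType) (u1 : A).
Hypotheses (cardA : #|A| = d) (u1d : (u1 *+ d = 0)%R) (u1_gen : forall x : A, exists k, x = (u1 *+ k)%R).
Hypotheses (d1 : 1 < d) (p0 : 0 < p) (q0 : 0 < q).
Local Notation T := 'I_M.+1.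
Local Notation TA := (T * A)%type.
Local Notation V := ({set T} + {set T})%type.
Let cb : {perm T} := cyc M 0 M.+1.
Implicit Types (s : {perm T}) (h : T -> A) (z : decorated M H).

Definition balanced (E : finType) (s t : {perm E}) (w : E -> nat) : bool :=
  [&& [forall e, 0 < w e], [forall e, \sum_(i in porbit s e) w i == q] &
      [forall e, \sum_(i in porbit t e) w i == p]].

(** The long cycle upstairs runs [d] times along the one downstairs, moving to
    the next sheet at the last edge. *)
Definition seam (i : T) : A := if i == ord_max then u1 else 0%R.
Definition big_cycle : {perm TA} := skew cb seam.

Let tau s := (s^-1 * cb)%g.
(** The translations of the white rotation, determined by those of the black
    one. *)
Definition dual_skew s h : T -> A := fun j => (seam (s^-1%g j) - h (s^-1%g j))%R.

Lemma skew_dual s h : ((skew s h)^-1 * big_cycle)%g = skew (tau s) (dual_skew s h).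
Proof.
apply: (mulgI (skew s h)); rewrite mulKVg; apply/permP=> -[i x].
have cbE : cb i = tau s (s i) by rewrite [RHS]permM permK.
rewrite [RHS]permM !skewE -cbE /dual_skew permK.
by rewrite -addrA [(h i + _)%R]addrC subrK.
Qed.

Let hol_cb : hol seam (porbit cb ord0) = u1.
Proof.
rewrite /hol porbit_cyc ?inE // (bigD1 ord_max) /=; last by rewrite inE /= add0n ltnSn.
by rewrite /seam eqxx big1 ?addr0 // => i /andP[_ /negbTE ->].
Qed.

Let cb_trans i j : j \in porbit cb i.
Proof. by rewrite porbit_cyc ?inE ?ltn_ord. Qed.

Lemma big_cycle_pow : (big_cycle ^+ M.+1)%g = shift T u1.
Proof.
have cp : #|porbit cb ord0| = M.+1.
  by rewrite -[RHS](card_ord M.+1); apply: eq_card => j; rewrite cb_trans.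
apply/permP=> -[i x]; have pc : porbit cb i = porbit cb ord0 by apply/eqP; rewrite eq_porbit_mem cb_trans.
by have := skew_pow_hol cb seam i x; rewrite pc cp hol_cb => ->; rewrite skewE perm1.
Qed.

Lemma big_cycle_trans e f : f \in porbit big_cycle e.
Proof.
case: e f => [i x] [j y]; rewrite -eq_porbit_mem.
have c1 := card_hol1 u1_gen hol_cb; move/eqP/cards1P: c1 => [O EO].
have orb k v : porbit big_cycle (k, v) = O.
  apply/set1P; rewrite -EO inE imset_f //= shadow_porbit eq_porbit_mem; exact: cb_trans.
by rewrite !orb.
Qed.

Lemma ncyc_trans (E : finType) (c : {perm E}) (e0 : E) : (forall e f, f \in porbit c e) -> ncyc c = 1.
Proof.
move=> tr; apply/eqP/cards1P; exists (porbit c e0); apply/setP=> O; rewrite inE.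
apply/imsetP/eqP=> [[e _ ->]|->]; last by exists e0.
by apply/eqP; rewrite eq_porbit_mem.
Qed.

Let ncyc_cb : ncyc cb = 1. Proof. exact: (ncyc_trans ord0 cb_trans). Qed.
Let ncyc_big : ncyc big_cycle = 1. Proof. exact: (ncyc_trans (ord0, 0%R) big_cycle_trans). Qed.
Let size_TA : size_of TA = M.+1 * d. Proof. by rewrite /size_of card_prod card_ord cardA. Qed.
Let size_T : size_of T = M.+1. Proof. by rewrite /size_of card_ord. Qed.

(** The vertices of the quotient tree: [inl] for the black and [inr] for the
    white ones. *)
Definition vertex s : pred V := fun v =>
  match v with inl K => K \in porbits s | inr K => K \in porbits (tau s) end.
Definition vweight (w : T -> nat) (v : V) : nat :=
  match v with inl K | inr K => \sum_(i in K) w i end.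
Definition target (v : V) : nat := if v is inl _ then q else p.

Definition branched s (w : T -> nat) (v0 : V) : bool :=
  [&& vertex s v0, d * vweight w v0 == target v0 &
      [forall v, vertex s v && (v != v0) ==> (vweight w v == target v)]].

(** The exceptional vertex is the center of the rotation; being fixed, it has [d]
    times as many edges upstairs as downstairs. *)
Definition quotient_trees : {set decorated M H} :=
  [set z | (z \in plane_trees M H 0 M.+1) && [exists v0, branched (rot z) (wt z) v0]].

Definition symmetric_trees : {set {perm TA}} :=
  [set u | [&& geodesic u big_cycle, (u * shift T u1 == shift T u1 * u)%g &
    [exists w : {ffun TA -> 'I_H.+1}, balanced u (u^-1 * big_cycle)%g (fun e => w e : nat)]]].

Definition covers (u : {perm TA}) z : bool :=
  [exists h : {ffun T -> A}, u == skew (rot z) h] &&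
  balanced u (u^-1 * big_cycle)%g (fun e => wt z e.1).

(** The number of vertices above a vertex. *)
Definition nab s h (v : V) : nat :=
  match v with inl K => #|orbits_over s h K| | inr K => #|orbits_over (tau s) (dual_skew s h) K| end.

Lemma sum_vertices s (F : V -> nat) :
  \sum_(v | vertex s v) F v = \sum_(K in porbits s) F (inl K) + \sum_(K in porbits (tau s)) F (inr K).
Proof. by rewrite big_sumType. Qed.

Lemma card_vertices s : #|vertex s| = ncyc s + ncyc (tau s).
Proof. by rewrite -sum1_card sum_vertices !sum1_card. Qed.

Lemma sum_nab s h : \sum_(v | vertex s v) nab s h v =
  ncyc (skew s h) + ncyc ((skew s h)^-1 * big_cycle)%g.
Proof. by rewrite sum_vertices skew_dual !ncyc_skew. Qed.

Lemma nab_dvd s h v : vertex s v -> nab s h v %| d.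
Proof. by case: v => K /= KP; apply: (card_orbits_over_dvd u1d u1_gen). Qed.

Definition vhol s h (v : V) : A :=
  match v with inl K => hol h K | inr K => hol (dual_skew s h) K end.

Let sum_inv s (k : T -> A) : (\sum_j k (s^-1%g j) = \sum_j k j)%R.
Proof. by rewrite [RHS](reindex_inj (@perm_inj _ s^-1%g)). Qed.

Let sum_orbits (t : {perm T}) (k : T -> A) : (\sum_(K in porbits t) hol k K = \sum_i k i)%R.
Proof.
rewrite [RHS](partition_big (porbit t) (mem (porbits t))) /= => [|i _]; last exact: imset_f.
apply: eq_bigr => _ /imsetP[i _ ->]; apply: eq_bigl => j; by rewrite eq_porbit_mem.
Qed.

Let sum_seam : (\sum_i seam i = u1)%R.
Proof. by rewrite (bigD1 ord_max) //= /seam eqxx big1 ?addr0 // => i /negbTE ->. Qed.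

(** Each edge contributes its translation to the holonomy of its black end and
    the opposite, corrected by the seam, to that of its white end. *)
Lemma vhol_total s h : (\sum_(v | vertex s v) vhol s h v = u1)%R.
Proof.
rewrite big_sumType /= !sum_orbits /dual_skew sumrB.
rewrite !sum_inv addrC subrK.
exact: sum_seam.
Qed.

Lemma vhol0 s h v : vertex s v -> nab s h v = d -> vhol s h v = 0%R.
Proof. by case: v => K /= /imsetP[i _ ->]; apply: (hol0_of_card cardA). Qed.
Lemma nab_hol0 s h v : vertex s v -> vhol s h v = 0%R -> nab s h v = d.
Proof. by case: v => K /= /imsetP[i _ ->]; apply: (card_hol0 cardA). Qed.
Lemma nab_hol1 s h v : vertex s v -> vhol s h v = u1 -> nab s h v = 1.
Proof. by case: v => K /= /imsetP[i _ ->]; apply: (card_hol1 u1_gen). Qed.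

(** The vertices above [v] all have the prescribed weight, and together [d] times
    the weight of [v]. *)
Lemma nab_weight s h w v : vertex s v ->
  balanced (skew s h) ((skew s h)^-1 * big_cycle)%g (fun e => w e.1) ->
  nab s h v * target v = d * vweight w v.
Proof.
rewrite skew_dual => vP /and3P[_ /forallP bq /forallP bp]; case: v vP => K /= /imsetP[i _ ->].
  by rewrite -(orbits_over_sum cardA u1_gen _ h w i 0%R) (eqP (bq _)).
by rewrite -(orbits_over_sum cardA u1_gen _ (dual_skew s h) w i 0%R) (eqP (bp _)).
Qed.

Lemma nab_balanced s h w : (forall i, 0 < w i) ->
  (forall v, vertex s v -> nab s h v * target v = d * vweight w v) ->
  balanced (skew s h) ((skew s h)^-1 * big_cycle)%g (fun e => w e.1).
Proof.
move=> w0 H1; have pos v : vertex s v -> 0 < nab s h v by move/(nab_dvd h)/dvdn_gt0; apply; exact: ltnW.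
rewrite skew_dual; apply/and3P; split; apply/forallP=> -[i x] //=; apply/eqP.
  have vP : vertex s (inl (porbit s i)) by apply: imset_f.
  have := H1 _ vP; rewrite /= -(orbits_over_sum cardA u1_gen _ h w i x).
  by move/eqP; rewrite eqn_pmul2l ?(pos _ vP) // => /eqP.
have vP : vertex s (inr (porbit (tau s) i)) by apply: imset_f.
have := H1 _ vP; rewrite /= -(orbits_over_sum cardA u1_gen _ (dual_skew s h) w i x).
by move/eqP; rewrite eqn_pmul2l ?(pos _ vP) // => /eqP.
Qed.

Lemma geodesic_card (E : finType) (u c : {perm E}) : ncyc c = 1 ->
  geodesic u c = (ncyc u + ncyc (u^-1 * c)%g == (size_of E).+1).
Proof. by move=> c1; rewrite /geodesic c1 addn1. Qed.

(** The tree upstairs has [d * M.+1 + 1] vertices and the quotient has at most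
    [M.+2]; each vertex has at most [d] vertices above it, their number being a
    divisor of [d]. *)
Lemma geodesic_skew s h : geodesic (skew s h) big_cycle ->
  geodesic s cb /\ exists v0, [/\ vertex s v0, nab s h v0 = 1 &
    forall v, vertex s v -> v != v0 -> nab s h v = d].
Proof.
rewrite geodesic_card // -sum_nab size_TA => /eqP S.
have [le_s _] := porbits_triangle s cb.
have [|c1 ex] := one_exception d1 (@nab_dvd s h) (etrans S (esym (addn1 _))).
  by rewrite card_vertices; move: le_s; rewrite -/(tau s) ncyc_cb size_T addn1.
split=> //; rewrite geodesic_card // size_T; apply/eqP; rewrite -c1 card_vertices //.
Qed.

Lemma eq_balanced (E : finType) (s t : {perm E}) (w w' : E -> nat) :
  w =1 w' -> balanced s t w = balanced s t w'.
Proof.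
move=> ww; rewrite /balanced; congr [&& _, _ & _]; apply: eq_forallb => e; first by rewrite ww.
  by congr (_ == _); apply: eq_bigr.
by congr (_ == _); apply: eq_bigr.
Qed.

Lemma balanced_inj (E : finType) (s t : {perm E}) (w w' : E -> nat) :
  (forall e f, f \in porbit (s * t)%g e) -> ncyc s + ncyc t = (size_of E).+1 ->
  balanced s t w -> balanced s t w' -> w =1 w'.
Proof.
move=> tr c /and3P[_ /forallP b1 /forallP c1] /and3P[_ /forallP b2 /forallP c2] e.
have N (O : {set E}) (k : E -> nat) : (\sum_(i in O) Posz (k i) = Posz (\sum_(i in O) k i))%R.
  by rewrite (big_morph Posz PoszD (erefl (Posz 0))).
have [] // : Posz (w e) = Posz (w' e).
apply: (perm_tree_inj tr c (w := fun i => Posz (w i)) (w' := fun i => Posz (w' i))) => f; rewrite !N.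
  by rewrite (eqP (b1 f)) (eqP (b2 f)).
by rewrite (eqP (c1 f)) (eqP (c2 f)).
Qed.

Let trans_big (u : {perm TA}) e f : f \in porbit (u * (u^-1 * big_cycle))%g e.
Proof. by rewrite mulKVg; apply: big_cycle_trans. Qed.

Let trans_cb s i j : j \in porbit (s * tau s)%g i.
Proof. by rewrite /tau mulKVg. Qed.

Let count_big u : geodesic u big_cycle -> ncyc u + ncyc (u^-1 * big_cycle)%g = (size_of TA).+1.
Proof. by rewrite geodesic_card // => /eqP. Qed.

Let count_cb s : geodesic s cb -> ncyc s + ncyc (tau s) = (size_of T).+1.
Proof. by rewrite geodesic_card // => /eqP. Qed.

Lemma mem_plane_trees z :
  (z \in plane_trees M H 0 M.+1) = geodesic (rot z) cb && [forall i, 0 < wt z i].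
Proof.
by rewrite inE; congr (_ && _); apply: eq_forallb => i; rewrite inE add0n ltn_ord; case: (0 < _).
Qed.

(** The weights are invariant, as they are determined by their sums at the
    vertices; so they descend to the quotient. *)
Lemma symmetric_covers u : u \in symmetric_trees -> exists2 z, z \in quotient_trees & covers u z.
Proof.
rewrite inE => /and3P[gu /eqP cu /existsP[w bw]].
have [s [h uE]] := skew_of_commute u1_gen cu.
have inv e : (w (shift T u1 e) : nat) = w e.
  apply: (balanced_inj (trans_big u) (count_big gu) _ bw (w := fun e => w (shift T u1 e))).
  have orb (v : {perm TA}) s' h' m : v = skew s' h' -> [forall e, \sum_(i in porbit v e) (w i : nat) == m] ->
      [forall e, \sum_(i in porbit v e) (w (shift T u1 i) : nat) == m].
    move=> -> /forallP vm; apply/forallP=> f; rewrite -(eqP (vm (shift T u1 f))); apply/eqP.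
    have := shift_porbit u1 s' h' f 1; rewrite expg1 => <-.
    by rewrite big_imset //= => ? ? _ _; apply: perm_inj.
  move: bw => /and3P[/forallP w0 b1 b2]; apply/and3P; split.
  - by apply/forallP=> f; apply: w0.
  - exact: orb uE b1.
  - by apply: orb b2; rewrite uE; apply: skew_dual.
pose z : decorated M H := (s, [ffun i => w (i, 0%R)]).
have wE e : (w e : nat) = wt z e.1.
  case: e => i x; rewrite /wt ffunE /=; have [k ->] := u1_gen x.
  have := shift_pow u1 k i 0%R; rewrite add0r => <-.
  by elim: k => [|k IH]; rewrite ?expg0 ?perm1 // expgSr permM inv.
have bz : balanced u (u^-1 * big_cycle)%g (fun e => wt z e.1) by rewrite -(eq_balanced _ _ wE).
have uz : covers u z.
  by rewrite /covers bz andbT; apply/existsP; exists [ffun i => h i]; apply/eqP;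
     rewrite uE; apply/permP=> -[i x]; rewrite !skewE ffunE.
exists z => //; move: gu bz; rewrite uE => gu bz; have [gs [v0 [P0 n0 no]]] := geodesic_skew gu.
rewrite inE mem_plane_trees gs /=; apply/andP; split.
  by move: bw => /and3P[/forallP w0 _ _]; apply/forallP=> i; rewrite -(wE (i, 0%R)).
apply/existsP; exists v0; rewrite /branched P0 /= -(nab_weight P0 bz) n0 mul1n eqxx /=.
apply/forallP=> v; apply/implyP=> /andP[vP vv]; have := nab_weight vP bz.
by rewrite (no v) // => /eqP; rewrite eqn_pmul2l 1?eq_sym // ltnW.
Qed.

Let hol_inv s (k : T -> A) i : hol (fun j => k (s j)) (porbit s i) = hol k (porbit s i).
Proof.
rewrite /hol [RHS](reindex_inj (@perm_inj _ s)) /=; apply: eq_bigl => j.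
by rewrite -!eq_porbit_mem; have := mem_porbit s 1 j; rewrite expg1 -eq_porbit_mem => /eqP ->.
Qed.

(** Translations are weights of the quotient tree with values in [A]; they exist
    for any holonomies with the right total. *)
Lemma vhol_prescribed s v0 : geodesic s cb -> vertex s v0 ->
  exists h, forall v, vertex s v -> vhol s h v = (if v == v0 then u1 else 0)%R.
Proof.
move=> gs P0; pose one v : A := (if v == v0 then u1 else 0)%R.
pose a K := one (inl K); pose b L := (hol (fun j => seam (s^-1%g j)) L - one (inr L))%R.
have [|h hP] := @perm_tree_surj _ s (tau s) (trans_cb s) A a b ord0.
  rewrite sumrB sum_orbits sum_inv sum_seam; apply/eqP; rewrite eq_sym subr_eq; apply/eqP.
  have : (\sum_(v | vertex s v) one v = u1)%R.
    by rewrite (bigD1 v0) //= /one eqxx big1 ?addr0 // => v /andP[_ /negbTE ->].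
  by rewrite big_sumType.
exists (fun i => h (s i)) => -[K|K] /= /imsetP[i _ ->]; rewrite -/(one _).
  by rewrite hol_inv; have [] := hP i.
have [_ hb] := hP i.
have -> : (hol (dual_skew s (fun i => h (s i))) (porbit (tau s) i) =
    hol (fun j => seam (s^-1%g j)) (porbit (tau s) i) - \sum_(j in porbit (tau s) i) h j)%R.
  by rewrite /hol -sumrB; apply: eq_bigr => j _; rewrite /dual_skew permKV.
by rewrite hb /b opprB addrC subrK.
Qed.

Lemma quotient_covered z : z \in quotient_trees -> exists2 u, u \in symmetric_trees & covers u z.
Proof.
rewrite inE mem_plane_trees => /andP[/andP[gs /forallP w0] /existsP[v0 /and3P[P0 /eqP d0 /forallP ot]]].
have [h hP] := vhol_prescribed gs P0; set s := rot z in gs P0 ot h hP *.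
have n0 : nab s h v0 = 1 by apply: nab_hol1 => //; rewrite hP // eqxx.
have no v : vertex s v -> v != v0 -> nab s h v = d.
  by move=> vP /negbTE vv; apply: nab_hol0 => //; rewrite hP // vv.
have bz : balanced (skew s h) ((skew s h)^-1 * big_cycle)%g (fun e => wt z e.1).
  apply: nab_balanced => // v vP; have [->|vv] := eqVneq v v0; first by rewrite n0 mul1n d0.
  by rewrite no //; have /implyP := ot v; rewrite vP vv => /(_ isT) /eqP ->.
have gu : geodesic (skew s h) big_cycle.
  rewrite geodesic_card // -sum_nab size_TA (bigD1 v0) //= n0.
  rewrite (eq_bigr (fun=> d)) => [|v /andP[vP vv]]; last exact: no.
  rewrite sum_nat_const; have := count_cb gs; rewrite -card_vertices size_T.
  have -> : #|vertex s| = #|[pred v | vertex s v & v != v0]|.+1.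
    by rewrite -!sum1_card (bigD1 v0) //= add1n; congr _.+1; apply: eq_bigl.
  by case=> cE; rewrite add1n; apply/eqP; congr (_ * d).+1; exact: cE.
exists (skew s h).
  rewrite inE gu /=; apply/andP; split; first by apply/eqP; apply: skew_commute.
  by apply/existsP; exists [ffun e => z.2 e.1];
     rewrite (eq_balanced _ _ (w' := fun e => wt z e.1)) // => e; rewrite ffunE.
rewrite /covers bz andbT; apply/existsP; exists [ffun i => h i]; apply/eqP.
by apply/permP=> -[i x]; rewrite !skewE ffunE.
Qed.

Let skew_fst s s' h h' : skew s h = skew s' h' :> {perm TA} -> s = s'.
Proof. by move=> E; apply/permP=> i; have := congr1 (fun u : {perm TA} => (u (i, 0%R)).1) E; rewrite !skewE. Qed.

Lemma covers_uniq u z z' : u \in symmetric_trees -> covers u z -> covers u z' -> z = z'.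
Proof.
rewrite inE => /and3P[gu _ _] /andP[/existsP[h /eqP uE] b] /andP[/existsP[h' /eqP uE'] b'].
have sE : rot z = rot z' by apply: (@skew_fst _ _ h h'); rewrite -uE -uE'.
have wE := balanced_inj (trans_big u) (count_big gu) b b'.
case: z z' sE wE {uE uE' b b'} => s w [s' w'] /= sE wE; congr (_, _); first exact: sE.
by apply/ffunP=> i; apply: val_inj; apply: (wE (i, 0%R)).
Qed.

(** The holonomies of a cover are known: the weights tell which vertex is the
    center, the others have none, and their total is [u1].  They determine the
    translations. *)
Lemma covered_uniq u u' z : u \in symmetric_trees -> u' \in symmetric_trees ->
  covers u z -> covers u' z -> u = u'.
Proof.
rewrite !inE => /and3P[gu _ _] /and3P[gu' _ _] /andP[/existsP[h /eqP uE] b] /andP[/existsP[h' /eqP uE'] b'].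
move: gu gu' b b'; rewrite {u}uE {u'}uE'; set s := rot z => gu gu' b b'.
have [gs [v0 [P0 n0 no]]] := geodesic_skew gu; have [_ [v1 [P1 n1 no']]] := geodesic_skew gu'.
have v01 : v1 = v0.
  apply/eqP; apply: contraT; rewrite eq_sym => vv; have := nab_weight P0 b; rewrite -(nab_weight P0 b') n0 no' //.
  have : 0 < target v0 by case: (v0).
  by move: (target v0) d1; clear=> t d1 t0; rewrite mul1n => tE; have := ltn_Pmull d1 t0; rewrite -tE ltnn.
rewrite {v1}v01 in P1 n1 no'.
have hE k : (forall v, vertex s v -> v != v0 -> nab s k v = d) ->
    forall v, vertex s v -> vhol s k v = (if v == v0 then u1 else 0)%R.
  move=> nk v vP; have [->|vv] := eqVneq v v0; last by apply: vhol0 => //; apply: nk.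
  rewrite -(vhol_total s k) (bigD1 v0) //= big1 ?addr0 // => w /andP[wP ww].
  by apply: vhol0 => //; apply: nk.
have E v : vertex s v -> vhol s h v = vhol s h' v by move=> vP; rewrite (hE h no v vP) (hE h' no' v vP).
have hh : (fun i => h (s^-1%g i)) =1 (fun i => h' (s^-1%g i)).
  apply: (perm_tree_inj (trans_cb s) (count_cb gs)) => i.
    have H1 (k : T -> A) : (\sum_(j in porbit s i) k (s^-1%g j) = hol k (porbit s i))%R.
      rewrite -[LHS]/(hol (fun j => k (s^-1%g j)) _) -(hol_inv s (fun j => k (s^-1%g j))).
      by apply: eq_bigr => j _; rewrite permK.
    by rewrite !H1; apply: (E (inl _)); apply: imset_f.
  have H1 (k : T -> A) : (\sum_(j in porbit (tau s) i) k (s^-1%g j) =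
       hol (fun j => seam (s^-1%g j)) (porbit (tau s) i) - hol (dual_skew s k) (porbit (tau s) i))%R.
    by rewrite /hol /dual_skew sumrB opprB addrC subrK.
  by rewrite !H1; congr (_ - _)%R; apply: (E (inr _)); apply: imset_f.
apply/permP=> -[i x]; rewrite !skewE; have := hh (s i); rewrite permK => ->; by [].
Qed.

Lemma card_symmetric : #|symmetric_trees| = #|quotient_trees|.
Proof.
apply: (card_rel (R := covers)).
- exact: symmetric_covers.
- exact: quotient_covered.
- by move=> u z z' uS _ _; apply: covers_uniq.
- by move=> u u' z uS uS' _; apply: covered_uniq.
Qed.
End RotationFixed.

(** * Formal power series *)

Import Order.TTheory Num.Theory.
Local Open Scope ring_scope.

Section FpsRing.
Variable A : comNzRingType.

Definition fps := nat -> A.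
HB.instance Definition _ := boolp.gen_eqMixin fps.
HB.instance Definition _ := boolp.gen_choiceMixin fps.

Implicit Types f g h : fps.

Definition fps_add f g : fps := fun n => f n + g n.
Definition fps_opp f : fps := fun n => - f n.
Definition fps0 : fps := fun _ => 0.
Definition fps1 : fps := fun n => (n == 0)%:R.
Definition fps_mul f g : fps := fun n => \sum_(i < n.+1) f i * g (n - i)%N.

Lemma fps_addA : associative fps_add.
Proof. by move=> f g h; apply: boolp.funext => n; apply: addrA. Qed.
Lemma fps_addC : commutative fps_add.
Proof. by move=> f g; apply: boolp.funext => n; apply: addrC. Qed.
Lemma fps_add0 : left_id fps0 fps_add.
Proof. by move=> f; apply: boolp.funext => n; apply: add0r. Qed.
Lemma fps_addN : left_inverse fps0 fps_opp fps_add.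
Proof. by move=> f; apply: boolp.funext => n; apply: addNr. Qed.
HB.instance Definition _ := GRing.isZmodule.Build fps fps_addA fps_addC fps_add0 fps_addN.

Definition fps_trunc N f : {poly A} := \poly_(i < N) f i.

Lemma coef_trunc_mul N f g n : (n < N)%N ->
  (fps_trunc N f * fps_trunc N g)`_n = fps_mul f g n.
Proof.
move=> ltn; rewrite coefM; apply: eq_bigr => i _; rewrite !coef_poly.
by rewrite !ifT //; have := ltn_ord i; lia.
Qed.

Lemma fps_mulC : commutative fps_mul.
Proof.
by move=> f g; apply: boolp.funext => n; rewrite -!(@coef_trunc_mul n.+1) // mulrC.
Qed.
Lemma fps_mulA : associative fps_mul.
Proof.
move=> f g h; apply: boolp.funext => n; have H f1 g1 h1 :
    (fps_trunc n.+1 f1 * (fps_trunc n.+1 g1 * fps_trunc n.+1 h1))`_n = fps_mul f1 (fps_mul g1 h1) n.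
  rewrite coefM; apply: eq_bigr => i _; rewrite coef_poly ltn_ord coef_trunc_mul //.
  by rewrite ltnS leq_subr.
by rewrite -H mulrA mulrC H fps_mulC.
Qed.
Lemma fps_mul1 : left_id fps1 fps_mul.
Proof.
move=> f; apply: boolp.funext => n; rewrite /fps_mul big_ord_recl /= mul1r subn0 big1 ?addr0 //.
by move=> i _; rewrite mul0r.
Qed.
Lemma fps_mulD : left_distributive fps_mul fps_add.
Proof.
move=> f g h; apply: boolp.funext => n; rewrite /fps_mul /fps_add -big_split /=.
by apply: eq_bigr => i _; rewrite mulrDl.
Qed.
Lemma fps1_neq0 : fps1 != 0 :> fps.
Proof.
apply/eqP=> /(congr1 (fun f : fps => f 0%N)) /eqP; rewrite /fps1 /= => /eqP E.
by move/eqP: (oner_neq0 A).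
Qed.
HB.instance Definition _ :=
  GRing.Zmodule_isComNzRing.Build fps fps_mulA fps_mulC fps_mul1 fps_mulD fps1_neq0.

Lemma fpsP f g : (forall n, f n = g n) -> f = g.
Proof. exact: boolp.funext. Qed.
Lemma fpsD f g n : (f + g) n = f n + g n. Proof. by []. Qed.
Lemma fpsN f n : (- f) n = - f n. Proof. by []. Qed.
Lemma fpsB f g n : (f - g) n = f n - g n. Proof. by []. Qed.
Lemma fps0E n : (0 : fps) n = 0. Proof. by []. Qed.
Lemma fps1E n : (1 : fps) n = (n == 0%N)%:R. Proof. by []. Qed.
Lemma fpsM f g n : (f * g) n = \sum_(i < n.+1) f i * g (n - i)%N. Proof. by []. Qed.
Lemma fps_sum I (r : seq I) (P : pred I) (F : I -> fps) n :
  (\sum_(i <- r | P i) F i) n = \sum_(i <- r | P i) F i n.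
Proof. by elim/big_rec2: _ => // i x y _ <-. Qed.
Lemma fpsMn f k n : (f *+ k) n = f n *+ k.
Proof. by elim: k => // k IH; rewrite !mulrS fpsD IH. Qed.

Definition fpsC (c : A) : fps := fun n => if n == 0%N then c else 0.
Definition fpsX : fps := fun n => (n == 1%N)%:R.

Lemma fpsCM c f n : (fpsC c * f) n = c * f n.
Proof.
rewrite fpsM big_ord_recl /= subn0 big1 ?addr0 // => i _; exact: mul0r.
Qed.

Lemma fpsC_is_zmod : zmod_morphism fpsC.
Proof. by move=> c d; apply: fpsP => n; rewrite fpsB /fpsC; case: eqP; rewrite ?subrr. Qed.
Lemma fpsC_is_monoid : monoid_morphism fpsC.
Proof.
split; first by apply: fpsP => n; rewrite /fpsC fps1E; case: eqP.
by move=> c d; apply: fpsP => n; rewrite fpsCM /fpsC; case: eqP; rewrite ?mulr0.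
Qed.
HB.instance Definition _ := GRing.isZmodMorphism.Build A fps fpsC fpsC_is_zmod.
HB.instance Definition _ := GRing.isMonoidMorphism.Build A fps fpsC fpsC_is_monoid.

Lemma fpsXM f n : (fpsX * f) n = if n is k.+1 then f k else 0.
Proof.
case: n => [|n]; first by rewrite fpsM big_ord_recl big_ord0 /= mul0r addr0.
rewrite fpsM 2!big_ord_recl /= mul0r add0r mul1r subSS subn0 big1 ?addr0 //.
by move=> i _; rewrite /fpsX /= mul0r.
Qed.

Lemma fpsXnM k f n : (fpsX ^+ k * f) n = if (k <= n)%N then f (n - k)%N else 0.
Proof.
elim: k n => [|k IH] n; first by rewrite expr0 mul1r subn0.
by rewrite exprS -mulrA fpsXM; case: n => // n; rewrite IH subSS.
Qed.

(** Congruence modulo [u^N]. *)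
Definition agree N f g := forall n, (n < N)%N -> f n = g n.

Lemma agreeP f g : (forall N, agree N f g) -> f = g.
Proof. by move=> H; apply: fpsP => n; apply: (H n.+1). Qed.
Lemma agree_refl N f : agree N f f. Proof. by []. Qed.
Lemma agree_sym N f g : agree N f g -> agree N g f.
Proof. by move=> H n ln; rewrite H. Qed.
Lemma agree_trans N f g h : agree N f g -> agree N g h -> agree N f h.
Proof. by move=> H H' n ln; rewrite H // H'. Qed.
Lemma agreeM N f f' g g' : agree N f f' -> agree N g g' -> agree N (f * g) (f' * g').
Proof.
move=> H H' n ln; rewrite !fpsM; apply: eq_bigr => i _.
by rewrite H ?H' //; have := ltn_ord i; lia.
Qed.

Lemma fpsX_dvd g : g 0%N = 0 -> g = fpsX * (fun n => g n.+1).
Proof. by move=> g0; apply: fpsP => -[|n]; rewrite fpsXM. Qed.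

Lemma fps_exp_lt g k n : g 0%N = 0 -> (n < k)%N -> (g ^+ k) n = 0.
Proof. by move=> g0 lt_n; rewrite (fpsX_dvd g0) exprMn fpsXnM leqNgt lt_n. Qed.

(** [fps_comp a g] is the substitution of [g] (without constant term) in the
    series with coefficients [a]; only the first powers of [g] contribute to a
    given coefficient. *)
Definition fps_comp (a : fps) g : fps := fun n => (\sum_(k < n.+1) fpsC (a k) * g ^+ k) n.

Lemma fps_comp_agree (a : fps) g N : g 0%N = 0 ->
  agree N (fps_comp a g) (\sum_(k < N) fpsC (a k) * g ^+ k).
Proof.
move=> g0 n ln; rewrite /fps_comp !fps_sum (big_ord_widen N (fun k => (fpsC (a k) * g ^+ k) n) ln).
rewrite [RHS](bigID (fun k : 'I_N => (k < n.+1)%N)) /= [X in _ + X]big1 ?addr0 // => k.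
by rewrite -leqNgt => nk; rewrite fpsCM fps_exp_lt ?mulr0.
Qed.

Lemma fps_compM (a b : fps) g : g 0%N = 0 -> fps_comp (a * b) g = fps_comp a g * fps_comp b g.
Proof.
move=> g0; apply: agreeP => N.
apply: agree_trans (agree_sym (agreeM (fps_comp_agree a g0) (fps_comp_agree b g0))).
apply: agree_trans (fps_comp_agree _ g0) _ => n ln.
pose P (c : fps) : {poly fps} := \poly_(k < N) fpsC (c k).
have PE (c : fps) : \sum_(k < N) fpsC (c k) * g ^+ k = (P c).[g] by rewrite horner_poly.
rewrite !PE -hornerM; set R := P a * P b; have sR : (size R <= N + N)%N.
  apply: leq_trans (size_polyMleq _ _) _; apply: leq_trans (leq_pred _) _.
  by apply: leq_add; apply: size_poly.
rewrite (horner_coef_wide _ sR) big_split_ord /= fpsD [X in _ + X](_ : _ = 0) ?addr0.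
  rewrite horner_poly !fps_sum; apply: eq_bigr => k _.
  suff -> : fpsC ((a * b) k) = R`_k by [].
  rewrite coefM fpsM rmorph_sum; apply: eq_bigr => i _; rewrite rmorphM !coef_poly.
  by rewrite !ifT //; have := ltn_ord k; have := ltn_ord i; lia.
rewrite fps_sum big1 // => k _; rewrite mulrC exprD -mulrA fpsM big1 // => i _.
by rewrite fps_exp_lt ?mul0r //; have := ltn_ord i; lia.
Qed.

Lemma fps_comp_shift (a : fps) g : g 0%N = 0 ->
  fps_comp a g = fpsC (a 0%N) + g * fps_comp (fun k => a k.+1) g.
Proof.
move=> g0; apply: agreeP => -[//|N]; apply: agree_trans (fps_comp_agree _ g0) _.
rewrite big_ord_recl expr0 mulr1 => n ln; rewrite !fpsD; congr (_ + _).
have H h k : (g * h) k = if k is j.+1 then (((fun m => g m.+1) : fps) * h) j else 0.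
  by rewrite {1}(fpsX_dvd g0) -mulrA fpsXM.
have -> : \sum_(i < N) fpsC (a (lift ord0 i)) * g ^+ lift ord0 i =
    g * \sum_(i < N) fpsC (a i.+1) * g ^+ i.
  by rewrite mulr_sumr; apply: eq_bigr => i _; rewrite mulrCA -exprS.
rewrite !H; case: n ln => // n ln.
exact: (agreeM (@agree_refl N _) (agree_sym (fps_comp_agree _ g0))).
Qed.

(** The geometric series. *)
Lemma fps_geom g : g 0%N = 0 -> exists h, (1 - g) * h = 1 /\
  forall N, agree N h (\sum_(k < N) g ^+ k).
Proof.
move=> g0; pose h := fps_comp (fun _ => 1) g; have hE N : agree N h (\sum_(k < N) g ^+ k).
  apply: agree_trans (fps_comp_agree _ g0) _ => n _; rewrite !fps_sum.
  by apply: eq_bigr => k _; rewrite rmorph1 mul1r.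
exists h; split=> //; apply: agreeP => N; apply: agree_trans (agreeM (@agree_refl N _) (@hE N)) _.
have <- : 1 - g ^+ N = (1 - g) * (\sum_(k < N) g ^+ k).
  by have := subrXX 1 g N; rewrite expr1n => ->; congr (_ * _); apply: eq_bigr => k _; rewrite expr1n mul1r.
by move=> n ln; rewrite fpsB fps_exp_lt ?subr0.
Qed.

(** The Euler derivation [u d/du]. *)
Definition theta f : fps := fun n => f n *+ n.

Lemma thetaE f n : theta f n = f n *+ n. Proof. by []. Qed.
Lemma thetaM f g : theta (f * g) = theta f * g + f * theta g.
Proof.
apply: fpsP => n; rewrite /theta fpsD !fpsM -big_split /= -sumrMnl.
by apply: eq_bigr => i _; rewrite mulrnAl mulrnAr -mulrnDr subnKC // -ltnS.
Qed.
Lemma thetaD f g : theta (f + g) = theta f + theta g.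
Proof. by apply: fpsP => n; rewrite /theta !fpsD mulrnDl. Qed.
Lemma thetaN f : theta (- f) = - theta f.
Proof. by apply: fpsP => n; rewrite /theta !fpsN mulNrn. Qed.
Lemma thetaC c : theta (fpsC c) = 0.
Proof. by apply: fpsP => -[|n]; rewrite /theta /fpsC /= ?mulr0n ?mul0rn. Qed.
Lemma theta1 : theta 1 = 0.
Proof. by rewrite -(rmorph1 fpsC) thetaC. Qed.
Lemma thetaX : theta fpsX = fpsX.
Proof. by apply: fpsP => -[|[|n]]; rewrite /theta /fpsX /= ?mulr0n ?mulr1n ?mul0rn. Qed.
Lemma thetaXn f k : theta (f ^+ k.+1) = f ^+ k * theta f *+ k.+1.
Proof.
elim: k => [|k IH]; first by rewrite expr0 mul1r expr1.
by rewrite exprS thetaM IH mulrnAr mulrA -exprS mulrC [RHS]mulrS.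
Qed.

Lemma theta_agree N f g : agree N f g -> agree N (theta f) (theta g).
Proof. by move=> H n ln; rewrite /theta H. Qed.

(** The chain rule, for a logarithmic derivative [e] of the inner series. *)
Lemma theta_comp (a : fps) g e : g 0%N = 0 -> theta g = g * e ->
  theta (fps_comp a g) = fps_comp (theta a) g * e.
Proof.
move=> g0 ge; apply: agreeP => N; apply: agree_trans (theta_agree (fps_comp_agree a g0)) _.
apply: agree_trans _ (agreeM (agree_sym (fps_comp_agree _ g0)) (@agree_refl N _)).
have -> : theta (\sum_(k < N) fpsC (a k) * g ^+ k) = (\sum_(k < N) fpsC (theta a k) * g ^+ k) * e.
  rewrite mulr_suml; elim/big_rec2: _ => [|k x y _ IH]; first by rewrite -(rmorph0 fpsC) thetaC rmorph0.
  rewrite thetaD IH; congr (_ + _); rewrite thetaM thetaC mul0r add0r thetaE.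
  case: (nat_of_ord k) => [|j]; first by rewrite expr0 theta1 mulr0 mulr0n rmorph0 !mul0r.
  by rewrite thetaXn ge rmorphMn !mulrnAl mulrnAr !mulrA -[_ * g](mulrA) -exprSr.
exact: agree_refl.
Qed.
End FpsRing.

(** * Lagrange inversion and a Wiener-Hopf factorization *)

Section CompLinear.
Variables (A : comNzRingType) (g : fps A).
Lemma fps_compD a b : fps_comp (a + b) g = fps_comp a g + fps_comp b g.
Proof.
apply: fpsP => n; rewrite fpsD /fps_comp !fps_sum -big_split; apply: eq_bigr => k _ /=.
by rewrite fpsD rmorphD mulrDl.
Qed.
Lemma fps_compN a : fps_comp (- a) g = - fps_comp a g.
Proof.
apply: fpsP => n; rewrite fpsN /fps_comp !fps_sum -sumrN; apply: eq_bigr => k _ /=.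
by rewrite fpsN rmorphN mulNr.
Qed.
Lemma fps_comp1 : fps_comp 1 g = 1.
Proof.
apply: fpsP => n; rewrite /fps_comp big_ord_recl big1 ?addr0 => [|k _].
  by rewrite fps1E rmorph1 mul1r expr0.
by rewrite fps1E rmorph0 mul0r.
Qed.
Lemma fps_compMn a k : fps_comp (a *+ k) g = fps_comp a g *+ k.
Proof.
elim: k => [|k IH]; last by rewrite !mulrS fps_compD IH.
by have := fps_compD 0 0; rewrite addr0 => /eqP; rewrite -subr_eq0 opprD addNKr oppr_eq0 => /eqP.
Qed.
End CompLinear.

(** For [V = u / S], the differential equation [S_ode] says that the logarithmic
    derivative of [V] is the inverse of [a] evaluated at [V]. *)
Section Lagrange.
Variables (a E S T : fps rat) (m : nat).
Let V := fpsX rat * T.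
Let CA := fps_comp a V.
Hypotheses (S0 : S 0%N = 1) (ST : S * T = 1).
Hypothesis S_ode : theta S * CA = S * (CA - 1).
Hypotheses (E0 : E 0%N = 1) (E_ode : theta E = - ((a - 1) * E) *+ m).
Let eta := T * (S - theta S).

Let V0 : V 0%N = 0.
Proof. by rewrite /V fpsXM. Qed.

Let CA_eta : CA * eta = 1.
Proof.
have H : CA * (S - theta S) = S by rewrite mulrBr [CA * theta S]mulrC S_ode; ring.
by rewrite /eta mulrCA H mulrC.
Qed.

Let theta_V : theta V = V * eta.
Proof.
have H : theta T = - (T * T * theta S).
  have := congr1 (@theta rat) ST; rewrite thetaM theta1 => /(congr1 (fun f => T * f)).
  rewrite mulr0 mulrDr => H; apply/eqP; rewrite -subr_eq0 opprK; apply/eqP.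
  by rewrite -[RHS]H -[theta T in LHS]mul1r -ST; ring.
rewrite /V thetaM thetaX H /eta.
have -> : fpsX rat * T * (T * (S - theta S)) =
  fpsX rat * T * (S * T) - fpsX rat * T * T * theta S by ring.
rewrite ST; ring.
Qed.

Let theta_Sn n : theta (S ^+ n) = S ^+ n * (1 - eta) *+ n.
Proof.
case: n => [|n]; first by rewrite expr0 theta1.
have e1 : 1 - eta = T * theta S by rewrite /eta mulrBr [T * S]mulrC ST; ring.
rewrite thetaXn e1 exprSr; congr (_ *+ _).
have -> : S ^+ n * S * (T * theta S) = S ^+ n * (S * T) * theta S by ring.
by rewrite ST mulr1.
Qed.

(** Both factors have opposite logarithmic derivatives. *)
Lemma comp_inverse_pow : S ^+ m * fps_comp E V = 1.
Proof.
set Q := _ * _; suff H : theta Q = 0.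
  apply: fpsP => -[|n]; rewrite fps1E /=.
    by rewrite /Q fpsM big_ord_recl big_ord0 /fps_comp big_ord_recl big_ord0 !addr0 expr0 mulr1
      [fpsC _ _]E0 mulr1; elim: (m) => // k IH; rewrite exprS fpsM big_ord_recl big_ord0 S0 IH mulr1 addr0.
  have := congr1 (fun f : fps rat => f n.+1) H; rewrite thetaE fps0E => /eqP.
  by rewrite mulrn_eq0 /= => /eqP.
rewrite /Q thetaM theta_Sn (theta_comp E V0 theta_V) E_ode fps_compMn fps_compN fps_compM //.
rewrite fps_compD fps_compN fps_comp1 -/CA; set CE := fps_comp E V.
have -> : - ((CA - 1) * CE) *+ m * eta = - (CE * (CA * eta - eta)) *+ m.
  by rewrite mulrnAl; congr (_ *+ _); ring.
by rewrite CA_eta mulrnAl mulrnAr -mulrnDl -[RHS](mul0rn _ m); congr (_ *+ _); ring.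
Qed.

Let S_eta n : (S ^+ n * eta) n = (n == 0%N)%:R.
Proof.
case: n => [|n].
  rewrite expr0 mul1r /eta fpsM big_ord_recl big_ord0 addr0 fpsB thetaE mulr0n subr0 S0 mulr1.
  by have := congr1 (fun f : fps rat => f 0%N) ST; rewrite fpsM big_ord_recl big_ord0 S0 mul1r addr0.
have -> : S ^+ n.+1 * eta = S ^+ n.+1 - S ^+ n * theta S.
  rewrite /eta exprSr; have -> : S ^+ n * S * (T * (S - theta S)) = S ^+ n * (S * T) * (S - theta S) by ring.
  by rewrite ST mulr1 mulrBr.
rewrite fpsB; have := thetaXn S n => /(congr1 (fun f : fps rat => f n.+1)).
rewrite thetaE fpsMn => /eqP; rewrite -subr_eq0 -mulrnBl mulrn_eq0 /= => /eqP.
exact.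
Qed.

(** Lagrange inversion for the change of variable [V = u / S]: by
    [comp_inverse_pow], [R1] is the sum over [k] of [(sg * E) k] times
    [u * V^k * S^m * eta], and only [k = m] reaches the degree [m.+1], as
    [S^n * eta] has no coefficient of degree [n > 0]. *)
Lemma lagrange_coef (sg R1 : fps rat) :
  R1 * CA = fpsX rat * fps_comp sg V -> R1 m.+1 = (sg * E) m.
Proof.
move=> HR; have -> : R1 = fpsX rat * (S ^+ m * eta * fps_comp (sg * E) V).
  rewrite fps_compM // -[R1]mulr1 -CA_eta mulrA HR -[LHS]mulr1 -comp_inverse_pow; ring.
rewrite fpsXM (agreeM (@agree_refl _ m.+1 _) (fps_comp_agree (sg * E) V0)) // mulr_sumr fps_sum.
rewrite big_ord_recr /= big1 => [|k _].
  rewrite add0r mulrCA fpsCM /V exprMn mulrCA fpsXnM leqnn subnn.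
  have -> : S ^+ m * eta * T ^+ m = (S * T) ^+ m * eta by rewrite exprMn; ring.
  by rewrite ST expr1n mul1r -[eta]mul1r -(expr0 S) S_eta mulr1.
rewrite mulrCA fpsCM /V exprMn mulrCA fpsXnM ltnW //.
have -> : S ^+ m * eta * T ^+ k = (S * T) ^+ k * (S ^+ (m - k) * eta).
  by rewrite exprMn -{1}(subnK (ltnW (ltn_ord k))) exprD; ring.
by rewrite ST expr1n mul1r S_eta subn_eq0 leqNgt ltn_ord mulr0.
Qed.
End Lagrange.

Section Diagonal.
Variable H : nat.
Local Notation U := {poly rat}.
Implicit Types (f g : fps U) (S T : fps rat).

(** The exponent of [t] at the power [n] of [u], minus [H * n], is the height of
    a monomial; [lift0 S] has height zero throughout. *)
Definition lift0 S : fps U := fun n => (S n)%:P * 'X^(H * n).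
Definition diag f : fps rat := fun n => (f n)`_(H * n).

Lemma lift0M S T : lift0 (S * T) = lift0 S * lift0 T.
Proof.
apply: fpsP => n; rewrite /lift0 !fpsM rmorph_sum mulr_suml; apply: eq_bigr => i _.
rewrite rmorphM /= mulrACA -exprD -mulnDr subnKC //.
by rewrite -ltnS.
Qed.
Lemma lift0_1 : lift0 1 = 1.
Proof. by apply: fpsP => -[|n]; rewrite /lift0 !fps1E /= ?muln0 ?mul0r // mulr1. Qed.
Lemma lift0B S T : lift0 (S - T) = lift0 S - lift0 T.
Proof. by apply: fpsP => n; rewrite /lift0 !fpsB rmorphB mulrBl. Qed.
Lemma lift0X S n : lift0 (S ^+ n) = lift0 S ^+ n.
Proof. by elim: n => [|n IH]; rewrite ?lift0_1 // !exprS lift0M IH. Qed.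

Lemma diagB f g : diag (f - g) = diag f - diag g.
Proof. by apply: fpsP => n; rewrite fpsB /diag fpsB coefB. Qed.
Lemma diagD f g : diag (f + g) = diag f + diag g.
Proof. by apply: fpsP => n; rewrite fpsD /diag fpsD coefD. Qed.
Lemma diag0 : diag 0 = 0.
Proof. by apply: fpsP => n; rewrite /diag fps0E coef0. Qed.
Lemma diag_sum I (r : seq I) (P : pred I) (F : I -> fps U) :
  diag (\sum_(i <- r | P i) F i) = \sum_(i <- r | P i) diag (F i).
Proof. by elim/big_rec2: _ => [|i x y _ IH]; rewrite ?diag0 // diagD IH. Qed.

Lemma diag_lift0M S f : diag (lift0 S * f) = S * diag f.
Proof.
apply: fpsP => n; rewrite /diag !fpsM coef_sum; apply: eq_bigr => i _.
rewrite /lift0 -mulrA coefCM coefXnM; congr (_ * _).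
have := ltn_ord i; rewrite ltnS => le_i; rewrite ltnNge leq_mul2l le_i orbT /=.
by rewrite -mulnBr.
Qed.

Lemma diag_agree N f g : agree N f g -> agree N (diag f) (diag g).
Proof. by move=> fg n ln; rewrite /diag fg. Qed.

(** The heights of all monomials are at least [s], or at most [- s]. *)
Definition above (s : nat) f := forall n e, (e < H * n + s)%N -> (f n)`_e = 0.
Definition below (s : nat) f := forall n e, (H * n < e + s)%N -> (f n)`_e = 0.

Lemma aboveM s s' f g : above s f -> above s' g -> above (s + s') (f * g).
Proof.
move=> fs gs n e lt_e; rewrite fpsM coef_sum big1 // => i _; rewrite coefM big1 // => j _.
have := ltn_ord i; have := ltn_ord j; rewrite !ltnS => le_j le_i.
have [lt_j|le_j'] := ltnP j (H * i + s); first by rewrite fs ?mul0r.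
rewrite gs ?mulr0 //; have : (H * n = H * i + H * (n - i))%N by rewrite -mulnDr subnKC.
by move: (H * n)%N (H * i)%N (H * (n - i))%N lt_e le_j le_j'; clear; lia.
Qed.

Lemma belowM s s' f g : below s f -> below s' g -> below (s + s') (f * g).
Proof.
move=> fs gs n e lt_e; rewrite fpsM coef_sum big1 // => i _; rewrite coefM big1 // => j _.
have := ltn_ord i; have := ltn_ord j; rewrite !ltnS => le_j le_i.
have [lt_j|le_j'] := ltnP (H * i) (j + s); first by rewrite fs ?mul0r.
rewrite gs ?mulr0 //; have : (H * n = H * i + H * (n - i))%N by rewrite -mulnDr subnKC.
by move: (H * n)%N (H * i)%N (H * (n - i))%N lt_e le_j le_j'; clear; lia.
Qed.

Lemma above1 : above 0 1.
Proof. by move=> [|n] e; rewrite fps1E /= ?coef0 // muln0. Qed.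
Lemma below1 : below 0 1.
Proof. by move=> [|n] e; rewrite fps1E /= ?coef0 // muln0 addn0 coef1; case: e. Qed.

Lemma aboveS f : above 1 f -> above 0 f.
Proof. by move=> fs n e lt_e; apply: fs; lia. Qed.
Lemma belowS f : below 1 f -> below 0 f.
Proof. by move=> fs n e lt_e; apply: fs; lia. Qed.

Lemma above_inv f : f 0%N = 0 -> above 1 f -> exists2 h, (1 - f) * h = 1 & above 0 h.
Proof.
move=> f0 fs; have [h [h1 hE]] := fps_geom f0; exists h => // n e lt_e.
rewrite (hE n.+1) // fps_sum coef_sum big1 // => k _.
have : above 0 (f ^+ k); last exact.
elim: (nat_of_ord k) => [|j IH]; first exact: above1.
by rewrite exprS; apply: (aboveM (aboveS fs) IH).
Qed.
Lemma below_inv f : f 0%N = 0 -> below 1 f -> exists2 h, (1 - f) * h = 1 & below 0 h.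
Proof.
move=> f0 fs; have [h [h1 hE]] := fps_geom f0; exists h => // n e lt_e.
rewrite (hE n.+1) // fps_sum coef_sum big1 // => k _.
have : below 0 (f ^+ k); last exact.
elim: (nat_of_ord k) => [|j IH]; first exact: below1.
by rewrite exprS; apply: (belowM (belowS fs) IH).
Qed.

Lemma diag_above f : above 1 f -> diag f = 0.
Proof. by move=> fs; apply: fpsP => n; rewrite /diag fs ?addn1. Qed.
Lemma diag_below f : below 1 f -> diag f = 0.
Proof. by move=> fs; apply: fpsP => n; rewrite /diag fs ?addn1. Qed.

(** The series [B1] and [W1] vary the factors [1 - B] and [1 - W] of a product.
    Dividing the variation by the product gives [B1 / (1 - B) + W1 / (1 - W)],
    which has no part of height zero, as the first term has positive heights and
    the second one negative heights. *)
Lemma wiener_hopf (B W B1 W1 : fps U) S T R1 (a s : U) :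
  B 0%N = 0 -> W 0%N = 0 -> above 1 B -> below 1 W -> above 1 B1 -> below 1 W1 ->
  S * T = 1 ->
  (1 - B) * (1 - W) = lift0 S - fpsX U * fpsC a ->
  B1 * (1 - W) + W1 * (1 - B) = fpsX U * fpsC s - lift0 R1 ->
  R1 * fps_comp (fun n => (a ^+ n)`_(H * n)) (fpsX rat * T) =
  fpsX rat * fps_comp (fun n => (s * a ^+ n)`_(H * n.+1)) (fpsX rat * T).
Proof.
move=> B0 W0 uB lW uB1 lW1 ST HF HL.
have [be Bbe ube] := above_inv B0 uB; have [om Wom lom] := below_inv W0 lW.
pose z := fpsX U * lift0 T * fpsC a.
have z0 : z 0%N = 0 by rewrite /z -mulrA fpsXM.
have [g [zg gE]] := fps_geom z0; have DST : lift0 S * lift0 T = 1 by rewrite -lift0M ST lift0_1.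
have beom : be * om = lift0 T * g.
  have E1 : lift0 S * (1 - z) * (be * om) = 1.
    have -> : lift0 S * (1 - z) = lift0 S - fpsX U * fpsC a.
      have -> : lift0 S * (1 - z) = lift0 S - fpsX U * (lift0 S * lift0 T) * fpsC a by rewrite /z; ring.
      by rewrite DST mulr1.
    rewrite -HF; have -> : (1 - B) * (1 - W) * (be * om) = ((1 - B) * be) * ((1 - W) * om) by ring.
    by rewrite Bbe Wom mulr1.
  have -> : be * om = (lift0 S * lift0 T) * ((1 - z) * g) * (be * om) by rewrite DST zg !mul1r.
  have -> : lift0 S * lift0 T * ((1 - z) * g) * (be * om) =
    (lift0 S * (1 - z) * (be * om)) * (lift0 T * g) by ring.
  by rewrite E1 mul1r.
have E2 : B1 * be + W1 * om = (fpsX U * fpsC s - lift0 R1) * (lift0 T * g).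
  rewrite -HL -beom; have -> : B1 * be = B1 * be * ((1 - W) * om) by rewrite Wom mulr1.
  have -> : W1 * om = W1 * om * ((1 - B) * be) by rewrite Bbe mulr1.
  by ring.
have D0 : diag (B1 * be + W1 * om) = 0.
  rewrite diagD diag_above ?diag_below ?addr0 //.
    by rewrite -[1%N]addn0; apply: belowM.
  by rewrite -[1%N]addn0; apply: aboveM.
have zn k : z ^+ k = lift0 (T ^+ k) * (fpsX U ^+ k * fpsC (a ^+ k)).
  by rewrite /z !exprMn lift0X rmorphXn; ring.
have V0 : (fpsX rat * T) 0%N = 0 by rewrite fpsXM.
have dXC k (c : U) : diag (fpsX U ^+ k * fpsC c) = fpsC (c`_(H * k)) * fpsX rat ^+ k.
  apply: fpsP => n; rewrite /diag fpsXnM fpsCM -[fpsX rat ^+ k]mulr1 fpsXnM fps1E /fpsC.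
  case: leqP => [le_k|_]; last by rewrite coef0 mulr0.
  by rewrite subn_eq0; case: (leqP n k) => le_n; rewrite ?coef0 ?mulr0 // mulr1 (_ : n = k) //; lia.
have dg : diag g = fps_comp (fun n => (a ^+ n)`_(H * n)) (fpsX rat * T).
  apply: agreeP => N; apply: agree_trans (diag_agree (gE N)) _.
  apply: agree_trans _ (agree_sym (fps_comp_agree _ V0)).
  rewrite diag_sum (eq_bigr (fun k : 'I_N => fpsC ((a ^+ k)`_(H * k)) * (fpsX rat * T) ^+ k)) // => k _.
  by rewrite zn diag_lift0M dXC exprMn; ring.
have dsg : diag (fpsX U * fpsC s * g) =
    fpsX rat * fps_comp (fun n => (s * a ^+ n)`_(H * n.+1)) (fpsX rat * T).
  apply: agreeP => N.
  apply: agree_trans (diag_agree (agreeM (@agree_refl _ N (fpsX U * fpsC s)) (gE N))) _.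
  apply: agree_trans _ (agreeM (@agree_refl _ N _) (agree_sym (fps_comp_agree _ V0))).
  rewrite !mulr_sumr diag_sum (eq_bigr (fun k : 'I_N =>
    fpsX rat * (fpsC ((s * a ^+ k)`_(H * k.+1)) * (fpsX rat * T) ^+ k))) // => k _.
  have -> : fpsX U * fpsC s * z ^+ k = lift0 (T ^+ k) * (fpsX U ^+ k.+1 * fpsC (s * a ^+ k)).
    by rewrite zn rmorphM exprS; ring.
  by rewrite diag_lift0M dXC exprMn exprS; ring.
rewrite -dg -dsg; move: D0; rewrite E2.
have -> : (fpsX U * fpsC s - lift0 R1) * (lift0 T * g) =
  lift0 T * (fpsX U * fpsC s * g - lift0 R1 * g) by ring.
rewrite diag_lift0M diagB diag_lift0M => /(congr1 (fun f : fps rat => S * f)).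
by rewrite mulr0 mulrA ST mul1r => /eqP; rewrite subr_eq0 => /eqP ->.
Qed.
End Diagonal.

(** * Generating series by height *)

Section HeightSeries.
Variable H : nat.
Local Notation U := {poly rat}.
Local Notation lift0 := (lift0 H).
Implicit Types (a b : nat -> rat) (f g : nat -> nat -> rat).

Lemma shift_sum (V : zmodType) (F : nat -> V) k : (forall h, (H < h)%N -> F h = 0) ->
  \sum_(1 <= h < H.+1 | (k < h)%N) F h = \sum_(1 <= h < H.+1) F (h + k)%N.
Proof.
move=> F0; have -> : \sum_(1 <= h < H.+1) F (h + k)%N = \sum_(1 + k <= h < H.+1 + k) F h.
  by rewrite big_addn addnK.
rewrite add1n [RHS](big_nat_widenl _ 1) //=.
rewrite [LHS](big_nat_widen _ _ (H.+1 + k)) ?leq_addr //.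
rewrite big_mkcond [RHS]big_mkcond; apply: eq_bigr => h _ /=.
by case: ltnP => //= kh; case: ltnP => // hH; rewrite F0.
Qed.

Lemma height_split a b N1 N2 : (H <= N2)%N ->
  (forall h, (H < h)%N -> a h = 0) -> (forall h, (H < h)%N -> b h = 0) ->
  (\sum_(1 <= h < H.+1) a h *: 'X^(N1 + h)) * (\sum_(1 <= k < H.+1) b k *: 'X^(N2 - k)) =
  \sum_(1 <= h < H.+1) (\sum_(1 <= k < H.+1) a (h + k)%N * b k) *: 'X^(N1 + N2 + h) +
  \sum_(1 <= h < H.+1) (\sum_(1 <= k < H.+1) b (h + k)%N * a k) *: 'X^(N1 + N2 - h) +
  (\sum_(1 <= k < H.+1) a k * b k)%:P * 'X^(N1 + N2) :> U.
Proof.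
move=> leN a0 b0; pose G h k : U := (a h * b k) *: 'X^(N1 + N2 + h - k).
have -> : (\sum_(1 <= h < H.+1) a h *: 'X^(N1 + h)) * (\sum_(1 <= k < H.+1) b k *: 'X^(N2 - k)) =
    \sum_(1 <= h < H.+1) \sum_(1 <= k < H.+1) G h k.
  rewrite mulr_suml; apply: eq_bigr => h _; rewrite mulr_sumr big_nat [RHS]big_nat.
  apply: eq_bigr => k /andP[_ kH]; rewrite -scalerAl -scalerAr scalerA -exprD /G.
  by congr (_ *: 'X^_); lia.
have -> : \sum_(1 <= h < H.+1) \sum_(1 <= k < H.+1) G h k =
   \sum_(1 <= k < H.+1) \sum_(1 <= h < H.+1 | (k < h)%N) G h k +
   \sum_(1 <= h < H.+1) \sum_(1 <= k < H.+1 | (h < k)%N) G h k +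
   \sum_(1 <= k < H.+1) G k k.
  rewrite [X in _ = X + _ + _](exchange_big_dep xpredT) //= -!big_split big_nat [RHS]big_nat.
  apply: eq_bigr => h /andP[h1 hH] /=.
  rewrite (bigID (fun k => (k < h)%N)) /= -addrA; congr (_ + _).
  rewrite (bigID (fun k => (h < k)%N)) /=; congr (_ + _).
    by apply: eq_bigl => k; lia.
  rewrite (bigID (pred1 h)) /= [X in _ + X]big1 ?addr0 => [|k /= kh]; last by exfalso; lia.
  rewrite (eq_bigl (pred1 h)) => [|k /=]; last by apply/idP/idP; lia.
  by rewrite big_nat1_eq h1 hH.
congr (_ + _ + _).
- rewrite (eq_bigr (fun k => \sum_(1 <= h < H.+1) G (h + k)%N k)) => [|k _]; last first.
    by apply: shift_sum => h hH; rewrite /G a0 // mul0r scale0r.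
  rewrite exchange_big; apply: eq_bigr => h _; rewrite scaler_suml; apply: eq_bigr => k _.
  by rewrite /G; congr (_ *: 'X^_); lia.
- rewrite (eq_bigr (fun h => \sum_(1 <= k < H.+1) G h (k + h)%N)) => [|h _]; last first.
    by apply: shift_sum => k kH; rewrite /G b0 // mulr0 scale0r.
  rewrite exchange_big big_nat [RHS]big_nat; apply: eq_bigr => k /andP[_ kH].
  rewrite scaler_suml; apply: eq_bigr => h _.
  by rewrite /G mulrC; congr (_ *: 'X^_); lia.
- rewrite rmorph_sum mulr_suml; apply: eq_bigr => k _.
  by rewrite /G mul_polyC addnK.
Qed.

(** The generating series of black-planted trees with positive heights, and of
    white-planted trees with negative heights. *)
Definition up f : fps U := fun n =>
  if n is j.+1 then \sum_(1 <= h < H.+1) f j h *: 'X^(H * n + h) else 0.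
Definition dn f : fps U := fun n =>
  if n is j.+1 then \sum_(1 <= h < H.+1) f j h *: 'X^(H * n - h) else 0.
Definition conv f g : nat -> nat -> rat := fun j h =>
  \sum_(i < j) \sum_(1 <= k < H.+1) f i (h + k)%N * g (j.-1 - i)%N k.
(** The trees glued from two planted trees with the same missing weight. *)
Definition balance f g : fps rat := fun n =>
  if n is j.+1 then \sum_(i < j) \sum_(1 <= k < H.+1) f i k * g (j.-1 - i)%N k else 0.
Definition bounded f := forall j h, (H < h)%N -> f j h = 0.

(** Gluing a black-planted and a white-planted tree along their root edges: the
    deficits subtract. *)
Lemma up_dn f g : bounded f -> bounded g ->
  up f * dn g = up (conv f g) + dn (conv g f) + lift0 (balance f g).
Proof.
move=> f0 g0; apply: fpsP => -[|j].
  by rewrite fpsM big_ord_recl big_ord0 /= mul0r !fpsD /lift0 /= !add0r mul0r.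
rewrite fpsM big_ord_recl /= mul0r add0r big_ord_recr /= subnn mulr0 addr0.
rewrite !fpsD /up /dn /lift0 /balance /conv.
pose F i h := f i h; pose G' i h := g (j.-1 - i)%N h.
rewrite (eq_bigr (fun i : 'I_j =>
  \sum_(1 <= h < H.+1) (\sum_(1 <= k < H.+1) F i (h + k)%N * G' i k) *: 'X^(H * j.+1 + h) +
  \sum_(1 <= h < H.+1) (\sum_(1 <= k < H.+1) G' i (h + k)%N * F i k) *: 'X^(H * j.+1 - h) +
  (\sum_(1 <= k < H.+1) F i k * G' i k)%:P * 'X^(H * j.+1))); last first.
  move=> i _; have lt_i := ltn_ord i; rewrite /= /bump /= add1n.
  have -> : (j.+1 - i.+1 = (j.-1 - i).+1)%N by lia.
  rewrite height_split; [|by rewrite mulnS leq_addr|exact: f0|exact: g0].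
  by have -> : (H * i.+1 + H * (j.-1 - i).+1 = H * j.+1)%N by rewrite -mulnDr; congr (_ * _)%N; lia.
rewrite !big_split /=; congr (_ + _ + _).
- by rewrite exchange_big; apply: eq_bigr => h _; rewrite scaler_suml.
- rewrite exchange_big; apply: eq_bigr => h _; rewrite [in RHS]scaler_suml.
  rewrite (reindex_inj rev_ord_inj); apply: eq_bigr => i _; have lt_i := ltn_ord i.
  by congr (_ *: _); apply: eq_bigr => k _; rewrite /F /G' /=; congr (g _ _ * f _ _); lia.
- by rewrite rmorph_sum mulr_suml.
Qed.

Lemma above_up f : above H 1 (up f).
Proof.
move=> [|n] e lt_e; first by rewrite coef0.
rewrite coef_sum big_nat big1 // => h /andP[h1 _].
by rewrite coefZ coefXn; case: eqP; rewrite ?mulr0 //; lia.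
Qed.

Lemma below_dn f : below H 1 (dn f).
Proof.
move=> [|n] e lt_e; first by rewrite coef0.
rewrite coef_sum big_nat big1 // => h /andP[h1 hH].
rewrite coefZ coefXn; case: eqP; rewrite ?mulr0 // mulnS in lt_e *; lia.
Qed.
End HeightSeries.

(** * Solving the recursion of planted trees *)

Section PlantedSeries.
Variable H : nat.
Local Notation U := {poly rat}.

Lemma planted_bounded (K : comNzRingType) (be om : nat -> K) :
  (forall h, (H < h)%N -> be h = 0) -> forall j h, (H < h)%N -> planted H be om j h = 0.
Proof.
move=> b0 j; have [n] := ubnP j; elim: n j => // n IH [|j] lt_j h hH; first by rewrite planted0 b0.
rewrite plantedS big1 // => i _; rewrite big1 // => k _.
by rewrite IH ?mul0r //; [have := ltn_ord i; lia|lia].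
Qed.

Lemma plantedE (K : comNzRingType) (be om : nat -> K) j h :
  planted H be om j.+1 h =
  \sum_(i < j.+1) \sum_(1 <= k < H.+1) planted H be om i (h + k)%N * planted H om be (j - i)%N k.
Proof.
rewrite plantedS; apply: eq_bigr => i _.
rewrite [RHS](big_nat_widenl _ 0) // big_mkord.
by apply: eq_bigl => k.
Qed.

Section Deviation.
Variables (b0 w0 b1 w1 : nat -> rat).
Hypotheses (b0H : forall h, (H < h)%N -> b0 h = 0) (w0H : forall h, (H < h)%N -> w0 h = 0).
Hypotheses (b1H : forall h, (H < h)%N -> b1 h = 0) (w1H : forall h, (H < h)%N -> w1 h = 0).

(** First order perturbation in the variable ['X] of the polynomial
    coefficients: the coefficient of degree 1 of a sum over trees has one vertex
    marked, with the weights [y] there. *)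
Definition marked (x y : nat -> rat) h : U := (x h)%:P + y h *: 'X.
Let be := marked b0 b1.
Let om := marked w0 w1.
Let P j h : U := planted H be om j h.
Let Q j h : U := planted H om be j h.
Let p0 j h := (P j h)`_0.
Let p1 j h := (P j h)`_1.
Let q0 j h := (Q j h)`_0.
Let q1 j h := (Q j h)`_1.

Lemma coef_marked x y h : ((marked x y h)`_0 = x h) * ((marked x y h)`_1 = y h).
Proof.
by rewrite /marked !coefD !coefC !coefZ !coefX /= mulr0 mulr1 addr0 add0r.
Qed.

Let marked_bounded x y : (forall h, (H < h)%N -> x h = 0) -> (forall h, (H < h)%N -> y h = 0) ->
  forall h, (H < h)%N -> marked x y h = 0.
Proof. by move=> xH yH h hH; rewrite /marked xH // yH // scale0r addr0. Qed.

Let beH := marked_bounded b0H b1H.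
Let omH := marked_bounded w0H w1H.

Let p0H : bounded H p0. Proof. by move=> j h hH; rewrite /p0 /P planted_bounded ?coef0. Qed.
Let p1H : bounded H p1. Proof. by move=> j h hH; rewrite /p1 /P planted_bounded ?coef0. Qed.
Let q0H : bounded H q0. Proof. by move=> j h hH; rewrite /q0 /Q planted_bounded ?coef0. Qed.
Let q1H : bounded H q1. Proof. by move=> j h hH; rewrite /q1 /Q planted_bounded ?coef0. Qed.

Let coefM1 (x y : U) : (x * y)`_1 = x`_0 * y`_1 + x`_1 * y`_0.
Proof. by rewrite coefM !big_ord_recl big_ord0 addr0. Qed.

Let p0S j h : p0 j.+1 h = conv H p0 q0 j.+1 h.
Proof.
rewrite /p0 /P plantedE /conv coef_sum; apply: eq_bigr => i _.
by rewrite coef_sum; apply: eq_bigr => k _; rewrite coef0M.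
Qed.
Let q0S j h : q0 j.+1 h = conv H q0 p0 j.+1 h.
Proof.
rewrite /q0 /Q plantedE /conv coef_sum; apply: eq_bigr => i _.
by rewrite coef_sum; apply: eq_bigr => k _; rewrite coef0M.
Qed.
Let p1S j h : p1 j.+1 h = conv H p0 q1 j.+1 h + conv H p1 q0 j.+1 h.
Proof.
rewrite /p1 /P plantedE /conv coef_sum -big_split; apply: eq_bigr => i _ /=.
by rewrite coef_sum -big_split; apply: eq_bigr => k _ /=; rewrite coefM1.
Qed.
Let q1S j h : q1 j.+1 h = conv H q0 p1 j.+1 h + conv H q1 p0 j.+1 h.
Proof.
rewrite /q1 /Q plantedE /conv coef_sum -big_split; apply: eq_bigr => i _ /=.
by rewrite coef_sum -big_split; apply: eq_bigr => k _ /=; rewrite coefM1.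
Qed.

Let conv0 f g h : conv H f g 0 h = 0.
Proof. by rewrite /conv big_ord0. Qed.

Definition up_letters (x : nat -> rat) : U := \sum_(1 <= h < H.+1) x h *: 'X^(H + h).
Definition dn_letters (x : nat -> rat) : U := \sum_(1 <= h < H.+1) x h *: 'X^(H - h).
(** A letter for each admitted weight of a vertex. *)
Definition letters x y : U := up_letters x + dn_letters y.

Let up_rec (f g : nat -> nat -> rat) x : (forall h, f 0%N h = x h) -> (forall h, g 0%N h = 0) ->
  (forall j h, f j.+1 h = g j.+1 h) -> up H f = up H g + fpsX U * fpsC (up_letters x).
Proof.
move=> f0 g0 fg; apply: fpsP => -[|[|j]]; rewrite fpsD fpsXM /fpsC /= ?addr0 //.
  rewrite [X in _ = X + _]big1 => [|h _]; last by rewrite g0 scale0r.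
  by rewrite add0r muln1; apply: eq_bigr => h _; rewrite f0.
by apply: eq_bigr => h _; rewrite fg.
Qed.
Let dn_rec (f g : nat -> nat -> rat) x : (forall h, f 0%N h = x h) -> (forall h, g 0%N h = 0) ->
  (forall j h, f j.+1 h = g j.+1 h) -> dn H f = dn H g + fpsX U * fpsC (dn_letters x).
Proof.
move=> f0 g0 fg; apply: fpsP => -[|[|j]]; rewrite fpsD fpsXM /fpsC /= ?addr0 //.
  rewrite [X in _ = X + _]big1 => [|h _]; last by rewrite g0 scale0r.
  by rewrite add0r muln1; apply: eq_bigr => h _; rewrite f0.
by apply: eq_bigr => h _; rewrite fg.
Qed.
Let upD f g : up H (fun j h => f j h + g j h) = up H f + up H g.
Proof.
apply: fpsP => -[|j]; rewrite fpsD /= ?addr0 // -big_split /=.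
by apply: eq_bigr => h _; rewrite scalerDl.
Qed.
Let dnD f g : dn H (fun j h => f j h + g j h) = dn H f + dn H g.
Proof.
apply: fpsP => -[|j]; rewrite fpsD /= ?addr0 // -big_split /=.
by apply: eq_bigr => h _; rewrite scalerDl.
Qed.

Let p00 h : p0 0%N h = b0 h. Proof. by rewrite /p0 /P planted0 coef_marked. Qed.
Let p10 h : p1 0%N h = b1 h. Proof. by rewrite /p1 /P planted0 coef_marked. Qed.
Let q00 h : q0 0%N h = w0 h. Proof. by rewrite /q0 /Q planted0 coef_marked. Qed.
Let q10 h : q1 0%N h = w1 h. Proof. by rewrite /q1 /Q planted0 coef_marked. Qed.

Let S := 1 + balance H p0 q0.
Let R1 := balance H p0 q1 + balance H p1 q0.
Let B := up H p0.
Let W := dn H q0.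
Let a := letters b0 w0.
Let s := letters b1 w1.

Let lift0D (f g : fps rat) : lift0 H (f + g) = lift0 H f + lift0 H g.
Proof. by apply: fpsP => n; rewrite /lift0 !fpsD rmorphD mulrDl. Qed.

Let base_factor : (1 - B) * (1 - W) = lift0 H S - fpsX U * fpsC a.
Proof.
have eB : B = up H (conv H p0 q0) + fpsX U * fpsC (up_letters b0) by exact: up_rec.
have eW : W = dn H (conv H q0 p0) + fpsX U * fpsC (dn_letters w0) by exact: dn_rec.
have BW : B * W = up H (conv H p0 q0) + dn H (conv H q0 p0) + lift0 H (balance H p0 q0).
  exact: up_dn.
have -> : (1 - B) * (1 - W) = 1 - B - W + B * W by ring.
rewrite BW eB eW /S lift0D lift0_1 /a /letters rmorphD; ring.
Qed.

Let linear_factor :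
  up H p1 * (1 - W) + dn H q1 * (1 - B) = fpsX U * fpsC s - lift0 H R1.
Proof.
have e1 : up H p1 = up H (conv H p0 q1) + up H (conv H p1 q0) + fpsX U * fpsC (up_letters b1).
  by rewrite -upD; apply: up_rec => // h; rewrite !conv0 addr0.
have e2 : dn H q1 = dn H (conv H q0 p1) + dn H (conv H q1 p0) + fpsX U * fpsC (dn_letters w1).
  by rewrite -dnD; apply: dn_rec => // h; rewrite !conv0 addr0.
have BW1 : up H p1 * W = up H (conv H p1 q0) + dn H (conv H q0 p1) + lift0 H (balance H p1 q0).
  exact: up_dn.
have BW2 : B * dn H q1 = up H (conv H p0 q1) + dn H (conv H q1 p0) + lift0 H (balance H p0 q1).
  exact: up_dn.
have -> : up H p1 * (1 - W) + dn H q1 * (1 - B) =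
  up H p1 + dn H q1 - up H p1 * W - B * dn H q1 by ring.
rewrite BW1 BW2 e1 e2 /R1 lift0D /s /letters rmorphD; ring.
Qed.

(** Words of height zero, and such words starting with a special letter. *)
Definition balanced_words n : rat := (letters b0 w0 ^+ n)`_(H * n).
Definition marked_words n : rat := (letters b1 w1 * letters b0 w0 ^+ n)`_(H * n.+1).

Let S0 : S 0%N = 1. Proof. by rewrite /S fpsD fps1E addr0. Qed.
Let S_succ m : S m.+1 = if m is m'.+1 then p0 m 0%N else 0.
Proof.
rewrite /S fpsD fps1E add0r /balance; case: m => [|m]; first by rewrite big_ord0.
by rewrite p0S /conv.
Qed.
Let R1_succ m : R1 m.+1 = if m is m'.+1 then p1 m 0%N else 0.
Proof.
rewrite /R1 fpsD /balance; case: m => [|m]; first by rewrite !big_ord0 addr0.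
by rewrite p1S /conv.
Qed.

Section Solve.
Variables (m : nat) (E : fps rat).
Hypothesis m0 : (0 < m)%N.
Hypothesis E0 : E 0%N = 1.
Hypothesis E_rec : forall k, E k *+ k = - (\sum_(i < k) balanced_words i.+1 * E (k.-1 - i)%N) *+ m.

Let A : fps rat := balanced_words.

Let A0 : A 0%N = 1.
Proof. by rewrite /A /balanced_words expr0 muln0 coef1. Qed.

Let E_ode : theta E = - ((A - 1) * E) *+ m.
Proof.
apply: fpsP => k; rewrite thetaE E_rec fpsMn fpsN fpsM big_ord_recl fpsB fps1E /=.
rewrite /A /balanced_words expr0 muln0 coef1 /= subrr mul0r add0r; congr (- _ *+ _).
case: k => [|k]; first by rewrite !big_ord0.
apply: eq_bigr => i _; rewrite fpsB fps1E /= subr0 /bump /= add1n; congr (_ * E _).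
Qed.

Let inverse_S : exists T, S * T = 1.
Proof.
have H0 : (1 - S) 0%N = 0 by rewrite fpsB fps1E S0 subrr.
have [T [ST _]] := fps_geom H0; exists T; rewrite -ST; congr (_ * _); ring.
Qed.

(** The variation given by the derivation [u d/du] itself is a case of the
    Wiener-Hopf factorization. *)
Let theta_sum T : S * T = 1 ->
  theta S * fps_comp A (fpsX rat * T) = S * (fps_comp A (fpsX rat * T) - 1).
Proof.
move=> ST; have V0 : (fpsX rat * T) 0%N = 0 by rewrite fpsXM.
have uB1 : above H 1 (theta B).
  by move=> n e le_e; rewrite thetaE coefMn above_up // mul0rn.
have lW1 : below H 1 (theta W).
  by move=> n e le_e; rewrite thetaE coefMn below_dn // mul0rn.
have HL : theta B * (1 - W) + theta W * (1 - B) = fpsX U * fpsC a - lift0 H (theta S).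
  have -> : theta B * (1 - W) + theta W * (1 - B) = - theta ((1 - B) * (1 - W)).
    by rewrite thetaM !thetaD !thetaN theta1; ring.
  rewrite base_factor thetaD thetaN thetaM thetaX thetaC.
  have -> : theta (lift0 H S) = lift0 H (theta S).
    by apply: fpsP => n; rewrite /lift0 !thetaE rmorphMn mulrnAl.
  by ring.
rewrite (wiener_hopf (erefl : B 0%N = 0) (erefl : W 0%N = 0) (@above_up H p0) (@below_dn H q0)
  uB1 lW1 ST base_factor HL).
rewrite (fps_comp_shift A V0) A0 rmorph1.
set CC := fps_comp (fun k => A k.+1) _; have -> : 1 + fpsX rat * T * CC - 1 = fpsX rat * T * CC by ring.
rewrite mulrA; have -> : S * (fpsX rat * T) = S * T * fpsX rat by ring.
rewrite ST mul1r; congr (_ * fps_comp _ _).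
by apply: fpsP => n; rewrite /A /balanced_words exprS.
Qed.

(** The number of edge-rooted weighted plane trees with [m] edges, from the
    balanced words in its letters. *)
Lemma planted_total : m%:R * (planted H be om m 0)`_0 = - E m.+1.
Proof.
have [T ST] := inverse_S; have HT := theta_sum ST.
have V0 : (fpsX rat * T) 0%N = 0 by rewrite fpsXM.
have HR : theta S * fps_comp A (fpsX rat * T) =
    fpsX rat * fps_comp (fun n => balanced_words n.+1) (fpsX rat * T).
  rewrite HT (fps_comp_shift A V0) A0 rmorph1.
  set CC := fps_comp (fun k => A k.+1) _; have -> : 1 + fpsX rat * T * CC - 1 = fpsX rat * T * CC by ring.
  rewrite mulrA; have -> : S * (fpsX rat * T) = S * T * fpsX rat by ring.
  by rewrite ST mul1r.
have := lagrange_coef S0 ST HT E0 E_ode HR; rewrite thetaE S_succ fpsM.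
have := E_rec m.+1; rewrite /=; case: (m) m0 => // m' _ H1 H2.
apply: (@pmulrnI _ m'.+2) => //; rewrite mulNrn H1 -H2 /p0 /P.
by rewrite mulNrn opprK mulr_natl -!mulrnA mulnC.
Qed.

(** The number of those with one marked vertex, which has the weight of a
    special letter. *)
Lemma planted_marked :
  (planted H be om m 0)`_1 = \sum_(n < m.+1) marked_words n * E (m - n)%N.
Proof.
have [T ST] := inverse_S; have HT := theta_sum ST.
have HR := wiener_hopf (erefl : B 0%N = 0) (erefl : W 0%N = 0) (@above_up H p0) (@below_dn H q0)
  (@above_up H p1) (@below_dn H q1) ST base_factor linear_factor.
have := lagrange_coef S0 ST HT E0 E_ode HR; rewrite R1_succ fpsM.
by case: (m) m0.
Qed.
End Solve.
End Deviation.
End PlantedSeries.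

(** * Sums over partitions *)

Section PartitionSum.
Variables (g : nat) (x : nat -> rat).

Definition part_term (n : {ffun 'I_g -> 'I_g.+1}) : rat :=
  \prod_(j < g) (x j ^+ n j / (n j)`!%:R).

(** The coefficient of degree [k] of the exponential of [\sum_j x j * u^(j+1)]. *)
Definition part_sum k : rat :=
  \sum_(n : {ffun 'I_g -> 'I_g.+1} | (\sum_(j < g) j.+1 * n j == k)%N) part_term n.

Lemma part_sum0 : part_sum 0 = 1.
Proof.
rewrite /part_sum (big_pred1 [ffun=> ord0]) => [|n /=].
  by rewrite /part_term big1 // => j _; rewrite ffunE expr0 divr1.
rewrite sum_nat_eq0; apply/forallP/eqP=> [n0|-> j]; last by rewrite ffunE muln0.
by apply/ffunP=> j; rewrite ffunE; apply/val_inj/eqP; have := n0 j; rewrite implyTb muln_eq0.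
Qed.

(** Adding and removing a part of size [i.+1]. *)
Let incr (i : 'I_g) (n : {ffun 'I_g -> 'I_g.+1}) : {ffun 'I_g -> 'I_g.+1} :=
  [ffun j => if j == i then inord (n j).+1 else n j].
Let decr (i : 'I_g) (n : {ffun 'I_g -> 'I_g.+1}) : {ffun 'I_g -> 'I_g.+1} :=
  [ffun j => if j == i then inord (n j).-1 else n j].

Let weight (n : {ffun 'I_g -> 'I_g.+1}) := (\sum_(j < g) j.+1 * n j)%N.

Let incrE i (n : {ffun 'I_g -> 'I_g.+1}) : (n i < g)%N ->
  [/\ incr i n i = (n i).+1 :> nat, weight (incr i n) = (weight n + i.+1)%N &
      part_term (incr i n) * (n i).+1%:R = x i * part_term n].
Proof.
move=> lt_i; have e : incr i n i = (n i).+1 :> nat by rewrite ffunE eqxx inordK.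
split=> //.
  rewrite /weight (bigD1 i) //= [in RHS](bigD1 i) //= e.
  rewrite (eq_bigr (fun j : 'I_g => j.+1 * n j)%N) => [|j ji]; first by lia.
  by rewrite ffunE (negbTE ji).
rewrite /part_term (bigD1 i) //= [in RHS](bigD1 i) //= e.
rewrite (eq_bigr (fun j : 'I_g => x j ^+ n j / (n j)`!%:R)) => [|j ji]; last by rewrite ffunE (negbTE ji).
rewrite factS natrM exprS; have := fact_gt0 (n i); rewrite -(ltr0n rat) => f0.
by field; rewrite gt_eqF // nat1r pnatr_eq0.
Qed.

Let decr_incr i (n : {ffun 'I_g -> 'I_g.+1}) : (decr i (incr i n) == n) = (n i < g)%N.
Proof.
apply/eqP/idP=> [nd|lt_n]; last first.
  apply/ffunP=> j; rewrite !ffunE; case: eqP => [->|//].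
  by apply: val_inj; rewrite /= !inordK //; exact: ltnW.
rewrite ltn_neqAle -ltnS ltn_ord andbT; apply/eqP=> ng.
have := congr1 (fun f : {ffun 'I_g -> 'I_g.+1} => f i : nat) nd.
have ino c : (inord c : 'I_g.+1) = (if (c < g.+1)%N then c else 0%N) :> nat.
  by rewrite -[nat_of_ord _]/(val _) /inord val_insubd.
by rewrite !ffunE !eqxx ng !ino ltnn /= => g0; have := ltn_ord i; lia.
Qed.

(** The derivative of an exponential, read on coefficients: mark one part in
    each partition. *)
Lemma part_sum_rec k : (k <= g)%N ->
  part_sum k *+ k = \sum_(j < k) (x j * part_sum (k - j.+1)%N) *+ j.+1.
Proof.
move=> le_k; rewrite /part_sum -sumrMnl.
transitivity (\sum_(j < g) \sum_(n | weight n == k) (part_term n * (n j)%:R) *+ j.+1).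
  rewrite exchange_big; apply: eq_bigr => n /eqP nk.
  rewrite -{1}nk /weight -sumrMnr; apply: eq_bigr => j _.
  by rewrite mulnC mulrnA mulr_natr.
rewrite (big_ord_widen g (fun j => (x j * \sum_(n | weight n == (k - j.+1)%N) part_term n) *+ j.+1)) //.
rewrite [RHS]big_mkcond; apply: eq_bigr => i _ /=.
case: ltnP => [lt_i|le_i]; last first.
  rewrite big1 // => n /eqP nk; have [->|ni] := eqVneq (n i : nat) 0%N; first by rewrite mulr0 mul0rn.
  have : (i.+1 * n i <= weight n)%N by rewrite /weight (bigD1 i) //= leq_addr.
  by rewrite nk; case: (nat_of_ord (n i)) ni => // c _; lia.
rewrite sumrMnl; congr (_ *+ _); rewrite (bigID (fun n : {ffun 'I_g -> 'I_g.+1} => (n i : nat) == 0%N)) /=.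
rewrite big1 => [|n /andP[_ /eqP ->]]; last by rewrite mulr0.
rewrite add0r (reindex_onto (incr i) (decr i)) /=; last first.
  move=> n /andP[_ ni]; apply/ffunP=> j; rewrite !ffunE; case: eqP => [->|//].
  apply: val_inj; rewrite /= !inordK ?eqxx //; move: ni (ltn_ord (n i));
    by case: (nat_of_ord (n i)) => //= c _; lia.
rewrite mulr_sumr; apply: eq_big => [n|n /andP[/andP[nk _]]]; rewrite decr_incr.
  apply/idP/eqP=> [/andP[/andP[/eqP nk _] lt_n]|nk].
    by have [_ e _] := incrE lt_n; rewrite -nk e addnK.
  have lt_n : (n i < g)%N.
    have : (i.+1 * n i <= weight n)%N by rewrite /weight (bigD1 i) //= leq_addr.
    by rewrite nk; have := leq_pmull (n i) (ltn0Sn i); lia.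
  by have [e1 e2 _] := incrE lt_n; rewrite e2 nk subnK // eqxx e1 lt_n.
by move=> lt_n; have [e1 _ e3] := incrE lt_n; rewrite e1 e3.
Qed.
End PartitionSum.

(** Course-of-values recursion; [F k] may look only at values below [k]. *)
Lemma strong_recursion (V : Type) (v : V) (F : nat -> (nat -> V) -> V) :
  (forall k f g, (forall i, (i < k)%N -> f i = g i) -> F k f = F k g) ->
  exists f, forall k, f k = F k f.
Proof.
move=> Fext; pose fix pre k : nat -> V :=
  if k is k'.+1 then fun i => if i == k' then F k' (pre k') else pre k' i else fun _ => v.
pose f k := pre k.+1 k; have preE K i : (i < K)%N -> pre K i = f i.
  elim: K => // K IH; rewrite ltnS leq_eqVlt => /orP[/eqP ->|lt_i] //=.
  by rewrite ltn_eqF // IH.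
by exists f => k; rewrite {1}/f /= eqxx; apply: Fext => i; apply: preE.
Qed.

(** * Balanced words *)

Definition single (q : nat) : nat -> rat := fun h => (h == q)%:R.

Section Words.
Variables (H p q : nat).
Hypotheses (p0 : (0 < p)%N) (q0 : (0 < q)%N) (pH : (p <= H)%N) (qH : (q <= H)%N).

Lemma up_single r : (0 < r <= H)%N -> up_letters H (single r) = 'X^(H + r).
Proof.
move=> /andP[r0 rH]; rewrite /up_letters (eq_bigr (fun h => if h == r then 'X^(H + h) else 0)) => [|h _].
  by rewrite -big_mkcond big_nat1_eq r0 ltnS rH.
by rewrite /single; case: eqP; rewrite ?scale1r ?scale0r.
Qed.

Lemma dn_single r : (0 < r <= H)%N -> dn_letters H (single r) = 'X^(H - r).
Proof.
move=> /andP[r0 rH]; rewrite /dn_letters (eq_bigr (fun h => if h == r then 'X^(H - h) else 0)) => [|h _].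
  by rewrite -big_mkcond big_nat1_eq r0 ltnS rH.
by rewrite /single; case: eqP; rewrite ?scale1r ?scale0r.
Qed.

Lemma letters_single : letters H (single q) (single p) = 'X^(H + q) + 'X^(H - p).
Proof. by rewrite /letters up_single ?q0 // dn_single // p0. Qed.

Lemma letters_marked r : (0 < r <= H)%N -> letters H (single r) (fun=> 0) = 'X^(H + r).
Proof.
move=> rH; rewrite /letters up_single // /dn_letters big1 ?addr0 // => h _; exact: scale0r.
Qed.

(** A binomial expansion of which at most one term has the right degree. *)
Lemma word_count e n : ('X^(H + e) * (letters H (single q) (single p)) ^+ n)`_(H * n.+1) =
  if (p + q %| q * n + e)%N then 'C(n, (q * n + e) %/ (p + q))%:R else 0.
Proof.
have pq0 : (0 < p + q)%N by rewrite addn_gt0 p0.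
rewrite letters_single exprDn mulr_sumr coef_sum.
have T (i : 'I_n.+1) :
    ('X^(H + e) * (('X^(H + q) ^+ (n - i) * 'X^(H - p) ^+ i) *+ 'C(n, i)) : {poly rat})`_(H * n.+1) =
    if (q * n + e == (p + q) * i)%N then 'C(n, i)%:R else 0.
  rewrite mulrnAr coefMn -!exprM -!exprD coefXn.
  have le_i : (i <= n)%N by rewrite -ltnS ltn_ord.
  have -> : (H * n.+1 == H + e + ((H + q) * (n - i) + (H - p) * i))%N = (q * n + e == (p + q) * i)%N.
    move: (nat_of_ord i) le_i => {}i le_i.
    have [H' ->] : exists H', H = (p + H')%N by exists (H - p)%N; lia.
    have [k ->] : exists k, n = (i + k)%N by exists (n - i)%N; lia.
    by rewrite !addKn; apply/eqP/eqP; nia.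
  by case: eqP; rewrite ?mul0rn ?mulr1n.
rewrite (eq_bigr _ (fun i _ => T i)); case: ifP => [/dvdnP[y yE]|ndiv]; last first.
  by rewrite big1 // => i _; case: eqP => // E; rewrite E dvdn_mulr in ndiv.
rewrite yE mulnK //; have [le_y|lt_y] := leqP y n; last first.
  rewrite bin_small // big1 // => i _; case: eqP => // E; have := ltn_ord i; rewrite ltnS.
  by move/eqP: E; rewrite mulnC eqn_pmul2l // => /eqP <-; lia.
rewrite (bigD1 (Ordinal (le_y : (y < n.+1)%N))) //= mulnC eqxx big1 ?addr0 // => i /eqP ni.
by rewrite eqn_pmul2l //; case: eqP => // E; case: ni; apply: val_inj.
Qed.

Lemma balanced_wordsE n : balanced_words H (single q) (single p) n =
  if (p + q %| q * n)%N then 'C(n, (q * n) %/ (p + q))%:R else 0.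
Proof.
have := word_count 0 n; rewrite !addn0 => <-.
by rewrite /balanced_words coefXnM mulnS ltnNge leq_addr /= addKn.
Qed.

Lemma marked_wordsE r n : (0 < r <= H)%N ->
  marked_words H (single q) (single p) (single r) (fun=> 0) n =
  if (p + q %| q * n + r)%N then 'C(n, (q * n + r) %/ (p + q))%:R else 0.
Proof. by move=> rH; rewrite /marked_words letters_marked // word_count. Qed.

End Words.

Section Coefficients.
Variables (p q : nat).
Hypotheses (p0 : (0 < p)%N) (q0 : (0 < q)%N).
Let g := gcdn p q.
Let P := (p %/ g)%N.
Let Q := (q %/ g)%N.
Let l := (P + Q)%N.

Let g0 : (0 < g)%N. Proof. by rewrite gcdn_gt0 p0. Qed.
Let pE : p = (P * g)%N. Proof. by rewrite divnK // dvdn_gcdl. Qed.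
Let qE : q = (Q * g)%N. Proof. by rewrite divnK // dvdn_gcdr. Qed.
Let P0 : (0 < P)%N. Proof. by rewrite divn_gt0 // dvdn_leq // dvdn_gcdl. Qed.
Let Q0 : (0 < Q)%N. Proof. by rewrite divn_gt0 // dvdn_leq // dvdn_gcdr. Qed.
Let coPQ : coprime P Q.
Proof. by rewrite /coprime -(eqn_pmul2r g0) muln_gcdl -pE -qE mul1n. Qed.
Let lE : (p + q = l * g)%N. Proof. by rewrite mulnDl -pE -qE. Qed.
Let l0 : (0 < l)%N. Proof. by rewrite addn_gt0 P0. Qed.
Let colQ : coprime l Q. Proof. by rewrite coprime_sym /coprime /l addnC gcdnDl gcdnC. Qed.

(** The bracket of the closed formulas, for the index [j.+1]. *)
Definition cycle_coef j : rat :=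
  ((j.+1 * (p + q) %/ g) - 1)`!%:R / ((j.+1 * p %/ g)`!%:R * (j.+1 * q %/ g)`!%:R).

Lemma balanced_words_mul H j : (p <= H)%N -> (q <= H)%N ->
  balanced_words H (single q) (single p) (j.+1 * l) = cycle_coef j *+ (j.+1 * l).
Proof.
move=> pH qH; rewrite balanced_wordsE // lE.
have -> : (q * (j.+1 * l) = (Q * j.+1) * (l * g))%N by rewrite {1}qE; lia.
rewrite dvdn_mull // mulnK ?muln_gt0 ?l0 //.
have -> : cycle_coef j = (j.+1 * l - 1)`!%:R / ((j.+1 * P)`!%:R * (j.+1 * Q)`!%:R).
  by rewrite /cycle_coef lE mulnA mulnK // {1}pE mulnA mulnK // {1}qE mulnA mulnK.
have jl0 : (0 < j.+1 * l)%N by rewrite muln_gt0 l0.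
have leQ : (Q * j.+1 <= j.+1 * l)%N by rewrite mulnC leq_mul2l /l leq_addl orbT.
have := bin_fact leQ; have -> : (j.+1 * l - Q * j.+1 = j.+1 * P)%N by rewrite /l; nia.
have -> : ((j.+1 * l)`! = j.+1 * l * (j.+1 * l - 1)`!)%N.
  by rewrite subn1 -{1}(prednK jl0) factS prednK.
rewrite (mulnC Q) => /(congr1 (fun n => n%:R : rat)).
rewrite !natrM => E; rewrite -[RHS]mulr_natl natrM.
have f1 : (j.+1 * Q)`!%:R != 0 :> rat by rewrite pnatr_eq0 -lt0n fact_gt0.
have f2 : (j.+1 * P)`!%:R != 0 :> rat by rewrite pnatr_eq0 -lt0n fact_gt0.
apply: (mulIf (mulf_neq0 f1 f2)); rewrite E; field; by rewrite f1 f2.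
Qed.

Lemma balanced_words_ndiv H n : (p <= H)%N -> (q <= H)%N -> ~~ (l %| n)%N ->
  balanced_words H (single q) (single p) n = 0.
Proof.
move=> pH qH nl; rewrite balanced_wordsE // lE {1}qE mulnAC dvdn_pmul2r //.
by rewrite Gauss_dvdr // (negbTE nl).
Qed.

Lemma sum_multiples (F : nat -> rat) K : (forall i, ~~ (l %| i)%N -> F i = 0) ->
  \sum_(i < K * l) F i.+1 = \sum_(j < K) F (j.+1 * l)%N.
Proof.
move=> F0; rewrite -(big_mkord xpredT (fun i => F i.+1)).
elim: K => [|K IH]; first by rewrite mul0n big_geq // big_ord0.
rewrite big_ord_recr /= -IH (big_cat_nat _ (n := K * l)) //=; last by rewrite leq_mul2r leqnSn orbT.
congr (_ + _); have e : (K.+1 * l = (K * l + l.-1).+1)%N by rewrite mulSn addnC -addnS prednK.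
rewrite e big_nat_recr ?leq_addr //= -e big_nat big1 ?add0r // => i /andP[le_i lt_i].
apply: F0; apply/negP=> /dvdnP[c ic]; move: le_i lt_i; rewrite -ltnS ic ltn_pmul2r //.
move=> Kc; have : (K.+1 * l <= c * l)%N by rewrite leq_mul2r Kc orbT.
by rewrite -ic e; lia.
Qed.

Section Solution.
Variables (H m : nat).
Hypotheses (pH : (p <= H)%N) (qH : (q <= H)%N).

Let A := balanced_words H (single q) (single p).

Definition scaled_coef j : rat := - (cycle_coef j *+ m).

(** The exponential of [- m] times the sum of [balanced_words k * u^k / k] is
    defined by the recursion from its logarithmic derivative.  The exponent has
    only the degrees divisible by [l], where its coefficients are the
    [scaled_coef j]. *)
Lemma words_exp : exists E : nat -> rat, [/\ E 0%N = 1,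
  forall k, E k *+ k = - (\sum_(i < k) A i.+1 * E (k.-1 - i)%N) *+ m,
  forall k, ~~ (l %| k)%N -> E k = 0 &
  forall k, (k <= g)%N -> E (l * k)%N = part_sum g scaled_coef k].
Proof.
have [|E ER] := strong_recursion (0 : rat) (F := fun k f =>
    if k is 0%N then 1 else - ((\sum_(i < k) A i.+1 * f (k.-1 - i)%N) *+ m) / k%:R).
  move=> [|k] f f' ff' //; congr (- (_ *+ _) / _); apply: eq_bigr => i _.
  by rewrite ff' //; have := ltn_ord i; lia.
have E0 : E 0%N = 1 by rewrite ER.
have E_rec k : E k *+ k = - (\sum_(i < k) A i.+1 * E (k.-1 - i)%N) *+ m.
  case: k => [|k]; first by rewrite big_ord0 mulr0n oppr0 mul0rn.
  by rewrite {1}ER -[LHS]mulr_natr divfK ?pnatr_eq0 // mulNrn.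
have E_ndiv k : ~~ (l %| k)%N -> E k = 0.
  have [n] := ubnP k; elim: n k => // n IH [|k] lt_k nl; first by rewrite dvdn0 in nl.
  have := E_rec k.+1; rewrite big1 => [|i _].
    by rewrite oppr0 mul0rn => /eqP; rewrite mulrn_eq0 => /eqP.
  have [li|li] := boolP (l %| i.+1)%N; last by rewrite /A balanced_words_ndiv // mul0r.
  rewrite IH ?mulr0 //; first by have := ltn_ord i; rewrite /=; lia.
  rewrite -(dvdn_addr _ li); apply: contra nl; rewrite /=; have -> // : (i.+1 + (k - i) = k.+1)%N.
  by have := ltn_ord i; lia.
exists E; split=> // k; have [n] := ubnP k; elim: n k => // n IH [|k] lt_k le_k.
  by rewrite muln0 E0 part_sum0.
have k0 : (0 < l * k.+1)%N by rewrite muln_gt0 l0.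
apply: (@pmulrnI _ (l * k.+1)) => //; rewrite E_rec mulnC mulrnA part_sum_rec //.
pose F i := A i * E (k.+1 * l - i)%N.
have -> : \sum_(i < k.+1 * l) A i.+1 * E ((k.+1 * l).-1 - i)%N = \sum_(i < k.+1 * l) F i.+1.
  by apply: eq_bigr => i _; rewrite /F; congr (_ * E _); lia.
have -> : \sum_(i < k.+1 * l) F i.+1 = \sum_(j < k.+1) F (j.+1 * l)%N.
  by apply: sum_multiples => i nl; rewrite /F /A balanced_words_ndiv // mul0r.
rewrite -sumrMnl -sumrN -sumrMnl; apply: eq_bigr => j _; have lt_j := ltn_ord j.
rewrite /F /A balanced_words_mul // -mulnBl subSS (mulnC (k - j)%N) IH; [|lia..].
by rewrite /scaled_coef mulNr !mulNrn !mulrnAl -!mulrnA [(_ * m)%N]mulnC mulnA.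
Qed.
End Solution.
End Coefficients.

(** * The closed formulas *)

Lemma cancel_multiple n l k s d r :
  ((n + l * k) * d + 1 = l * ((k + s) * d + r) -> n * d + 1 = l * (s * d + r))%N.
Proof. nia. Qed.

Section FormulaMatch.
Variables (p q : nat).
Hypotheses (p0 : (0 < p)%N) (q0 : (0 < q)%N).
Let g := gcdn p q.
Let al := (p + q - 1)%N.
Let al0 : (0 < al)%N. Proof. by rewrite /al; lia. Qed.
Let alR : al%:R != 0 :> rat. Proof. by rewrite pnatr_eq0 -lt0n. Qed.

Lemma prod_factor_term m (n : {ffun 'I_g -> 'I_g.+1}) :
  part_term (scaled_coef p q m) n = (- m%:R) ^+ (\sum_j n j)%N * prod_factor n.
Proof.
rewrite /part_term /prod_factor -prodrXr -big_split /=; apply: eq_bigr => j _.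
have -> : scaled_coef p q m j = - m%:R * cycle_coef p q j by rewrite mulNr mulr_natl.
by rewrite exprMn -mulrA; congr (_ * _); rewrite mulrC.
Qed.

Lemma C1_term (n : {ffun 'I_g -> 'I_g.+1}) :
  C1 n = - (al%:R ^- 2) * part_term (scaled_coef p q al) n.
Proof.
rewrite /C1 prod_factor_term; set N := (\sum_j n j)%N.
have -> : (-1) ^ (N%:Z - 1) = - (-1) ^+ N :> rat.
  by rewrite expfzDr ?oppr_eq0 ?oner_eq0 // exprN1 invrN1 mulrN1.
have -> : (p + q - 1)%:R ^ (N%:Z - 2) = al%:R ^+ N * al%:R ^- 2 :> rat.
  by rewrite expfzDr // -exprnN.
rewrite [(- _ ) ^+ N in RHS]exprNn.
by move: ((-1) ^+ N) (al%:R ^+ N) (al%:R ^- 2) (prod_factor n) => ? ? ? ?; ring.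
Qed.

Lemma G1_part_sum : G1 p q = - (al%:R ^- 2) * part_sum g (scaled_coef p q al) g.
Proof.
rewrite /G1 /part_sum mulr_sumr; apply: eq_bigr => n _; exact: C1_term.
Qed.

Lemma Cd_term r d s (n : {ffun 'I_g -> 'I_g.+1}) m : al = (m * d)%N ->
  Cd r d s n = al%:R^-1 * (qbinomial ((s%:R + fracpart (g%:R / d%:R)) * ((p + q)%:R / g%:R) - d%:R^-1)
     ((s%:R + fracpart (g%:R / d%:R)) * (r%:R / g%:R)) * part_term (scaled_coef p q m) n).
Proof.
move=> ald; rewrite /Cd prod_factor_term; set N := (\sum_j n j)%N.
have e : (1 + N)%N%:Z - 1 = N%:Z by rewrite PoszD addrAC subrr add0r.
have d0 : d%:R != 0 :> rat by move: alR; rewrite ald natrM mulf_eq0 negb_or => /andP[].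
rewrite e -!exprnP -/al; have -> : (al%:R : rat) ^ ((1 + N)%N%:Z - 2) = al%:R ^+ N / al%:R.
  have -> : (1 + N)%N%:Z - 2 = N%:Z - 1 by rewrite PoszD; ring.
  by rewrite expfzDr // exprN1.
set b := qbinomial _ _; rewrite exprNn.
have -> : (m%:R : rat) ^+ N = al%:R ^+ N / d%:R ^+ N.
  by rewrite ald natrM exprMn mulfK // expf_neq0.
by move: ((-1) ^+ N) (al%:R ^+ N) (al%:R^-1) (d%:R ^- N) (prod_factor n) b => ? ? ? ? ? ?; ring.
Qed.

(** The index [s] of the closed formula is split off; what remains is a sum over
    partitions of [g %/ d - s]. *)
Lemma Gd_part_sum r d m : al = (m * d)%N -> (1 < d)%N ->
  al%:R * Gd p q r d = \sum_(s < (g %/ d).+1)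
    qbinomial ((s%:R + fracpart (g%:R / d%:R)) * ((p + q)%:R / g%:R) - d%:R^-1)
     ((s%:R + fracpart (g%:R / d%:R)) * (r%:R / g%:R)) * part_sum g (scaled_coef p q m) (g %/ d - s)%N.
Proof.
move=> ald d1; rewrite /Gd.
rewrite (eq_bigr (fun sn : 'I_g.+1 * {ffun 'I_g -> 'I_g.+1} => 
     al%:R^-1 * (qbinomial ((sn.1%:R + fracpart (g%:R / d%:R)) * ((p + q)%:R / g%:R) - d%:R^-1)
     ((sn.1%:R + fracpart (g%:R / d%:R)) * (r%:R / g%:R)) * part_term (scaled_coef p q m) sn.2))); last first.
  by move=> sn _; apply: Cd_term.
rewrite -mulr_sumr mulrA divff // mul1r.
have lt_gd : (g %/ d < g.+1)%N by rewrite ltnS leq_div.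
rewrite (big_ord_widen g.+1 (fun s => qbinomial ((s%:R + fracpart (g%:R / d%:R)) * ((p + q)%:R / g%:R) - d%:R^-1)
     ((s%:R + fracpart (g%:R / d%:R)) * (r%:R / g%:R)) * part_sum g (scaled_coef p q m) (g %/ d - s)%N)) //.
rewrite -(pair_big_dep xpredT 
    (fun (s : 'I_g.+1) (n : {ffun 'I_g -> 'I_g.+1}) => (s + \sum_(j < g) j.+1 * n j == g %/ d)%N)
  (fun s n => qbinomial ((s%:R + fracpart (g%:R / d%:R)) * ((p + q)%:R / g%:R) - d%:R^-1)
     ((s%:R + fracpart (g%:R / d%:R)) * (r%:R / g%:R)) * part_term (scaled_coef p q m) n)) /=.
rewrite [RHS]big_mkcond; apply: eq_bigr => s _; rewrite ltnS.
case: leqP => [le_s|lt_s]; last first.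
  by rewrite big1 // => n /eqP E; move: lt_s; rewrite -E ltnNge leq_addr.
rewrite /part_sum mulr_sumr; apply: eq_bigl => n.
by rewrite -{1}(subnKC le_s) eqn_add2l.
Qed.

Lemma planted_count_total H (y y' : nat -> rat) : (p <= H)%N -> (q <= H)%N ->
  (forall h, (H < h)%N -> y h = 0) -> (forall h, (H < h)%N -> y' h = 0) ->
  (planted H (marked (single q) y) (marked (single p) y') al 0)`_0 = al%:R * G1 p q.
Proof.
move=> pH qH yH y'H.
have sH r : (r <= H)%N -> forall h, (H < h)%N -> single r h = 0.
  by move=> rH h hH; rewrite /single; case: eqP => // hr; move: hH; rewrite hr ltnNge rH.
have [E [E0 E_rec E_ndiv E_mul]] := words_exp p0 q0 al pH qH.
have := planted_total (sH _ qH) (sH _ pH) yH y'H al0 E0 E_rec.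
have -> : al.+1 = ((p %/ g + q %/ g) * g)%N.
  by rewrite mulnDl !divnK ?dvdn_gcdl ?dvdn_gcdr // /al; lia.
rewrite E_mul // G1_part_sum => E1.
apply: (mulfI alR); rewrite E1 !(mulNr, mulrN); congr (- _).
by rewrite !mulrA -expr2 divff ?expf_neq0 // mul1r.
Qed.

(** In the sum over [n] of [planted_marked] only the [n] with [l] dividing
    [m - n] contribute; they are [m - l * (f - s)] for [s] up to
    [f = g %/ d], and the words of this length with one special letter give the
    binomial coefficient of index [s]. *)
Lemma planted_count_marked H d : (p <= H)%N -> (q <= H)%N -> (1 < d)%N -> (d %| q)%N -> (d %| p - 1)%N ->
  (planted H (marked (single q) (single (q %/ d))) (marked (single p) (fun=> 0)) (al %/ d) 0)`_1 =
  al%:R * Gd p q q d.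
Proof.
move=> pH qH d1 dq dp; set m := (al %/ d)%N.
have d0 : (0 < d)%N by exact: ltnW.
have dal : (d %| al)%N by rewrite /al -addnBAC // dvdn_addr.
have ald : al = (m * d)%N by rewrite divnK.
have m0 : (0 < m)%N by rewrite divn_gt0 // dvdn_leq.
have qd0 : (0 < q %/ d)%N by rewrite divn_gt0 // dvdn_leq.
have qdH : (q %/ d <= H)%N by apply: leq_trans (leq_div _ _) qH.
have sH r : (r <= H)%N -> forall h, (H < h)%N -> single r h = 0.
  by move=> rH h hH; rewrite /single; case: eqP => // hr; move: hH; rewrite hr ltnNge rH.
have [E [E0 E_rec E_ndiv E_mul]] := words_exp p0 q0 m pH qH.
have -> := planted_marked (sH _ qH) (sH _ pH) (sH _ qdH) (fun h _ => erefl : (fun=> 0 : rat) h = 0)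
  m0 E0 E_rec.
rewrite (Gd_part_sum _ ald d1); set l := (p %/ g + q %/ g)%N.
have g0 : (0 < g)%N by rewrite gcdn_gt0 p0.
have lg : (p + q = l * g)%N by rewrite mulnDl !divnK ?dvdn_gcdl ?dvdn_gcdr.
have cop : coprime d p.
  have -> : p = (p - 1).+1 by lia.
  by have /dvdnP[c ->] := dp; rewrite /coprime -addn1 gcdnMDl gcdn1.
have cog : coprime d g by apply: coprime_dvdr cop; apply: dvdn_gcdl.
have gd0 : (0 < g %% d)%N.
  by rewrite lt0n; apply: contraTneq cog => /eqP dg; rewrite /coprime (gcdn_idPl dg) gtn_eqF.
set f := (g %/ d)%N; set r := (g %% d)%N in gd0.
have gE : g = (f * d + r)%N by exact: divn_eq.
have l0 : (0 < l)%N by rewrite addn_gt0 divn_gt0 // dvdn_leq // dvdn_gcdl.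
have md : (m * d + 1 = l * g)%N by rewrite -ald -lg /al; lia.
pose N s := ((m * d - l * (f - s) * d) %/ d)%N.
pose F n := (if (p + q %| q * n + q %/ d)%N then 'C(n, (q * n + q %/ d) %/ (p + q))%:R else 0 : rat).
rewrite (eq_bigr (fun n : 'I_m.+1 => F n * E (m - n)%N)) => [|n _]; last first.
  by rewrite marked_wordsE ?qd0.
have lf s : (s <= f)%N -> (l * (f - s) <= m)%N.
  move=> le_s; rewrite -(@leq_pmul2r d) //.
  have : (l * (f - s) * d <= l * (f * d))%N by rewrite -mulnA leq_mul2l leq_mul2r leq_subr !orbT.
  have : (l * (f * d) + l <= l * g)%N by rewrite -mulnSr leq_mul2l gE -addn1 leq_add2l gd0 orbT.
  lia.
(* The terms outside of the arithmetic progression vanish. *)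
pose G n : rat := if (l %| m - n)%N then F n * E (m - n)%N else 0.
transitivity (\sum_(n < m.+1) G n).
  by apply: eq_bigr => n _; rewrite /G; case: ifP => // /negbT nl; rewrite E_ndiv ?mulr0.
transitivity (\sum_(s < f.+1) F (m - l * (f - s))%N * E (l * (f - s))%N).
  have le_f k : (l %| k)%N -> (k <= m)%N -> (k %/ l <= f)%N.
    move=> /dvdnP[c ->]; rewrite mulnK // => le_c; rewrite -ltnS -(ltn_pmul2r d0) mulSn.
    have : (c * d < g)%N.
      rewrite -(ltn_pmul2l l0) -md addn1 ltnS mulnA (mulnC l); apply: leq_mul => //.
    have : (r < d)%N by rewrite ltn_mod.
    by rewrite gE; clear; lia.
  rewrite (bigID (fun n : 'I_m.+1 => (l %| m - n)%N)) /= [X in _ + X]big1 ?addr0 => [|n]; last first.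
    by rewrite /G => /negbTE ->.
  rewrite (reindex_onto (fun s : 'I_f.+1 => inord (m - l * (f - s)) : 'I_m.+1)
                        (fun n : 'I_m.+1 => inord (f - (m - n) %/ l) : 'I_f.+1)) /=; last first.
    move=> n ln; apply: val_inj; rewrite /= !inordK ?ltnS ?leq_subr //.
    have le_n : (n <= m)%N by rewrite -ltnS.
    by rewrite subKn ?le_f ?leq_subr // mulnC divnK // subKn.
  apply: eq_big => [s|s _]; have le_s : (s <= f)%N by rewrite -ltnS.
    rewrite !inordK ?ltnS ?leq_subr // subKn ?lf // dvdn_mulr //= mulKn // subKn //.
    by apply/eqP/val_inj; rewrite /= inordK.
  by rewrite /G inordK ?ltnS ?leq_subr // subKn ?lf // dvdn_mulr.
apply: eq_bigr => s _; have le_s : (s <= f)%N by rewrite -ltnS.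
rewrite E_mul; last first.
  by rewrite (leq_trans (leq_subr _ _)) // leq_div.
congr (_ * _); rewrite /F; set n := (m - l * (f - s))%N; set T := (s * d + r)%N.
have nT : (n * d + 1 = l * T)%N.
  have E1 : (n + l * (f - s) = m)%N by rewrite subnK ?lf.
  have E2 : (f = (f - s) + s)%N by rewrite subnK.
  have : ((n + l * (f - s)) * d + 1 = l * (((f - s) + s) * d + r))%N by rewrite E1 -E2 -gE.
  exact: cancel_multiple.
have /dvdnP[u uE] : (g %| q %/ d)%N.
  by rewrite -(Gauss_dvdl _ (_ : coprime g d)) ?divnK ?dvdn_gcdr // coprime_sym.
have nq : (q * n + q %/ d = (u * T) * (p + q))%N.
  have -> : (q * n = q %/ d * (n * d))%N by rewrite -{1}(divnK dq) -mulnA (mulnC d).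
  by rewrite -mulnSr -addn1 nT uE lg; clear; lia.
rewrite nq dvdn_mull // mulnK; last by rewrite addn_gt0 p0.
have dR : d%:R != 0 :> rat by rewrite pnatr_eq0 -lt0n.
have gR : g%:R != 0 :> rat by rewrite pnatr_eq0 -lt0n.
(* With [g = f * d + r], the fractional part of [g / d] is [r / d]. *)
have tE : s%:R + fracpart (g%:R / d%:R) = T%:R / d%:R.
  have ge : g%:R / d%:R = f%:R + r%:R / d%:R :> rat.
    by rewrite {1}gE natrD natrM mulrDl mulfK.
  rewrite /fracpart (@floor_def _ _ f%:Z) ?ge; last first.
    rewrite -!pmulrn; apply/andP; split; first by rewrite lerDl divr_ge0 ?ler0n.
    rewrite rmorphD /= ltrD2l ltr_pdivrMr ?ltr0n // mul1r ltr_nat; exact: ltn_pmod.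
  by rewrite -pmulrn [f%:R + _]addrC addrK /T natrD natrM mulrDl mulfK.
rewrite tE.
have -> : T%:R / d%:R * ((p + q)%:R / g%:R) - d%:R^-1 = n%:R :> rat.
  rewrite lg natrM mulfK // mulrAC -natrM mulnC -nT natrD mulrDl natrM mulfK //.
  by rewrite mul1r addrK.
have -> : T%:R / d%:R * (q%:R / g%:R) = (u * T)%:R :> rat.
  have -> : q = (u * g * d)%N by rewrite -uE divnK.
  rewrite !natrM; field; by rewrite dR gR.
by rewrite /qbinomial !natrK.
Qed.
End FormulaMatch.

Lemma cycle_coefC p q j : cycle_coef p q j = cycle_coef q p j.
Proof. by rewrite /cycle_coef gcdnC [(p + q)%N]addnC [X in _ / X]mulrC. Qed.

Lemma part_sum_ext g x y k : x =1 y -> part_sum g x k = part_sum g y k.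
Proof.
by move=> xy; apply: eq_bigr => n _; apply: eq_bigr => j _; rewrite xy.
Qed.

(** Apart from [r], the closed formula is symmetric in [p] and [q]. *)
Lemma GdC p q r d m : (0 < p)%N -> (0 < q)%N -> (p + q - 1 = m * d)%N -> (1 < d)%N ->
  Gd p q r d = Gd q p r d.
Proof.
move=> p0 q0 ald d1; have al0 : (p + q - 1)%:R != 0 :> rat by rewrite pnatr_eq0; lia.
apply: (mulfI al0); rewrite (Gd_part_sum p0 q0 r ald d1).
rewrite addnC in ald; rewrite [in RHS]addnC (Gd_part_sum q0 p0 r ald d1) gcdnC addnC.
apply: eq_bigr => s _; congr (_ * _); apply: part_sum_ext => j.
by rewrite /scaled_coef cycle_coefC.
Qed.

(** Exchanging the colors does not change the number of edge-rooted trees. *)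
Lemma plantedC H (K : comNzRingType) (be om : nat -> K) m : (0 < m)%N ->
  planted H be om m 0 = planted H om be m 0.
Proof.
case: m => // m _; rewrite !plantedE (reindex_inj rev_ord_inj); apply: eq_bigr => i _ /=.
have le_i : (i <= m)%N by rewrite -ltnS.
by apply: eq_bigr => k _; rewrite mulrC subSS subKn.
Qed.

Lemma planted_count_marked_white p q H d : (0 < p)%N -> (0 < q)%N -> (p <= H)%N -> (q <= H)%N ->
  (1 < d)%N -> (d %| p)%N -> (d %| q - 1)%N ->
  (planted H (marked (single q) (fun=> 0)) (marked (single p) (single (p %/ d))) ((p + q - 1) %/ d) 0)`_1 =
  (p + q - 1)%:R * Gd p q p d.
Proof.
move=> p0 q0 pH qH d1 dp dq; have dal : (d %| p + q - 1)%N by rewrite -addnBA // dvdn_addr.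
have al0 : (0 < p + q - 1)%N by lia.
rewrite plantedC; last by rewrite divn_gt0 ?(ltnW d1) // dvdn_leq.
rewrite (GdC _ p0 q0 (esym (divnK dal)) d1) [(p + q)%N]addnC.
exact: planted_count_marked.
Qed.

(** * Counting trees by their rotations *)

Lemma coef0_prod (R : comNzRingType) (I : finType) (P : pred I) (f : I -> {poly R}) :
  (\prod_(i | P i) f i)`_0 = \prod_(i | P i) (f i)`_0.
Proof.
by rewrite (big_morph _ (fun g h : {poly R} => coef0M g h) (coef1 R 0)).
Qed.

Lemma coef1_prod (R : comNzRingType) (I : finType) (P : pred I) (f : I -> {poly R}) :
  (\prod_(i | P i) f i)`_1 = \sum_(i | P i) (f i)`_1 * \prod_(j | P j && (j != i)) (f j)`_0.
Proof.
have [n] := ubnP #|P|; elim: n P => // n IH P cP.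
case: (pickP P) => [i0 P0|P0]; last by rewrite !big_pred0 // coefC.
rewrite (bigD1 i0) //= coefM big_ord_recl big_ord1 /= IH; last first.
  rewrite -ltnS; apply: leq_trans cP; rewrite ltnS -[#|P|]sum1_card (bigD1 i0) //= add1n ltnS.
  by rewrite -sum1_card.
rewrite [RHS](bigD1 i0) //= addrC coef0_prod; congr (_ + _).
rewrite big_distrr /=; apply: eq_bigr => i /andP[Pi ii].
rewrite [in RHS](bigD1 i0) /= ?P0 1?eq_sym // mulrCA; congr (_ * (_ * _)).
by apply: eq_bigl => j; rewrite andbAC.
Qed.

Section Count.
Variables (M H p q : nat).
Local Notation T := 'I_M.+1.
Implicit Types (z : decorated M H).

(** The rotations of the plane trees with face permutation [c] that carry a
    balanced weighting. *)
Definition balanced_rotations (E : finType) (c : {perm E}) : {set {perm E}} :=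
  [set u | geodesic u c &&
    [exists w : {ffun E -> 'I_H.+1}, balanced p q u (u^-1 * c)%g (fun e => w e : nat)]].

Lemma orbit_prod_setT (K : comNzRingType) (s : {perm T}) w (f : nat -> K) :
  orbit_prod (itv M 0 M.+1) s w f = \prod_(O in porbits s) f (\sum_(i in O) w i)%N.
Proof.
rewrite /orbit_prod; have -> : orbits_in (itv M 0 M.+1) s = porbits s.
  by apply/setP=> O; apply/imsetP/imsetP=> -[i _ ->]; exists i; rewrite // inE add0n ltn_ord.
by [].
Qed.

Lemma planted_whole (K : comNzRingType) (be om : nat -> K) :
  planted H be om M.+1 0 =
  \sum_(z in plane_trees M H 0 M.+1)
    \prod_(v | vertex (rot z) v) (if v is inl _ then be else om) (vweight (wt z) v).
Proof.
rewrite -(@black_plantedE _ _ M 0) // /black_planted; apply: eq_bigr => z _.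
rewrite /black_prod /= !orbit_prod_setT big_sumType /=; congr (_ * _).
by apply: eq_bigr => O _; congr be; apply: eq_bigr => i _; rewrite /add_at muln0 addn0.
Qed.

Lemma prod_bool (R : comNzRingType) (I : finType) (P : pred I) (b : I -> bool) :
  \prod_(i | P i) (b i)%:R = [forall i, P i ==> b i]%:R :> R.
Proof.
have [/forallP al|/forallPn[i]] := boolP [forall i, P i ==> b i].
  by rewrite big1 // => i Pi; have := al i; rewrite Pi /= => ->.
by rewrite negb_imply => /andP[Pi /negbTE bi]; rewrite (bigD1 i) //= bi mul0r.
Qed.

Lemma marked_coef0 x y h : (marked x y h)`_0 = x h.
Proof. by rewrite /marked coefD coefC coefZ coefX mulr0 addr0. Qed.

Lemma marked_coef1 x y h : (marked x y h)`_1 = y h.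
Proof. by rewrite /marked coefD coefC coefZ coefX mulr1 add0r. Qed.

(** A quotient tree has exactly one exceptional vertex, which is counted by the
    coefficient of degree 1 in the perturbed product over the vertices. *)
Lemma card_quotient d y y' : (1 < d)%N -> (0 < p)%N -> (0 < q)%N ->
  y =1 (fun h => (d * h == q)%N%:R) -> y' =1 (fun h => (d * h == p)%N%:R) ->
  #|quotient_trees M H d p q|%:R = (planted H (marked (single q) y) (marked (single p) y') M.+1 0)`_1.
Proof.
move=> d1 p0 q0 yE y'E; rewrite planted_whole coef_sum -sum1dep_card natr_sum big_mkcondr /=.
apply: eq_bigr => z _; rewrite coef1_prod.
pose br v := branched d p q (rot z) (wt z) v.
transitivity (\sum_(v | vertex (rot z) v) (br v)%:R : rat); last first.
  apply: eq_bigr => v vP; rewrite /br /branched vP /=.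
  rewrite (eq_bigr (fun v => (vweight (wt z) v == target p q v)%:R)); last first.
    by move=> [K|K] _; rewrite marked_coef0 /single.
  rewrite prod_bool -mulnb natrM; congr (_ * _).
  by case: v vP => K _; rewrite marked_coef1 ?yE ?y'E.
case: ifPn => [/existsP[v0 b0]|nb]; last first.
  rewrite big1 // => v _; rewrite /br; case: (boolP (branched _ _ _ _ _ _)) => // b.
  by case/existsP: nb; exists v.
have := b0; case/and3P=> P0 /eqP d0 /forallP _.
rewrite (bigD1 v0) //= /br b0 big1 ?addr0 // => v /andP[vP vv].
case: (boolP (branched _ _ _ _ _ _)) => // /and3P[_ _ /forallP/(_ v0)]; rewrite P0 eq_sym vv /= => /eqP e0.
move: d0; rewrite e0; have : (0 < target p q v0)%N by case: (v0).
by move: (target p q v0) d1; clear=> t d1 t0 E; have := ltn_Pmull d1 t0; rewrite E ltnn.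
Qed.

(** The weighting of a balanced rotation is unique, so that rotations and
    balanced decorated trees are equally many. *)
Lemma card_balanced y y' :
  #|balanced_rotations (cyc M 0 M.+1)|%:R =
  (planted H (marked (single q) y) (marked (single p) y') M.+1 0)`_0.
Proof.
set c := cyc M 0 M.+1.
have c_trans (i j : T) : j \in porbit c i by rewrite porbit_cyc ?inE ?ltn_ord.
have nc : ncyc c = 1%N by exact: (ncyc_trans ord0 c_trans).
pose bal z := balanced p q (rot z) ((rot z)^-1 * c)%g (wt z).
pose Z := [set z in plane_trees M H 0 M.+1 | bal z].
have -> : balanced_rotations c = @rot M H @: Z.
  apply/setP=> s; rewrite inE; apply/andP/imsetP=> [[gs /existsP[w bw]]|[z + ->]].
    exists (s, w) => //; rewrite inE /bal bw mem_plane_trees /rot /= gs /=.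
    by rewrite andbT; case/and3P: bw.
  rewrite inE mem_plane_trees => /andP[/andP[gs _] bz]; split=> //.
  by apply/existsP; exists z.2.
rewrite card_in_imset => [|[s w] [s' w']]; last first.
  rewrite !inE => /andP[/andP[gs _] b] /andP[_ b'] /= E; rewrite /rot /= in E gs b b'.
  move: b'; rewrite /bal /rot /= -E => b'; congr (_, _); apply/ffunP=> i; apply: val_inj.
  apply: (balanced_inj _ _ b b') => [e f|]; first by rewrite mulKVg.
  by apply/eqP; rewrite -geodesic_card.
rewrite planted_whole coef_sum -sum1dep_card natr_sum big_mkcondr /=.
apply: eq_bigr => z; rewrite mem_plane_trees => /andP[_ w0]; rewrite coef0_prod.
rewrite (eq_bigr (fun v => (vweight (wt z) v == target p q v)%:R)); last first.
  by move=> [K|K] _; rewrite marked_coef0 /single.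
rewrite prod_bool.
suff -> : bal z = [forall v, vertex (rot z) v ==> (vweight (wt z) v == target p q v)].
  by case: [forall v, _].
apply/and3P/forallP=> [[_ /forallP b /forallP b'] [K|K]|al].
- by apply/implyP=> /imsetP[i _ ->]; apply: b.
- by apply/implyP=> /imsetP[i _ ->]; apply: b'.
split=> //; apply/forallP=> i.
  by have /implyP := al (inl (porbit (rot z) i)); apply; apply: imset_f.
by have /implyP := al (inr (porbit ((rot z)^-1 * c)%g i)); apply; apply: imset_f.
Qed.
End Count.

(** * Transport along a bijection *)

Local Close Scope ring_scope.

Section Transport.
Variables (E E' : finType) (f : E -> E') (g : E' -> E).
Hypotheses (fK : cancel f g) (gK : cancel g f).
Implicit Types (u v c : {perm E}).

Lemma transport_inj u : injective (fun e' => f (u (g e'))).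
Proof. by move=> x y /(can_inj fK)/perm_inj/(can_inj gK). Qed.

Definition transport u : {perm E'} := perm (@transport_inj u).

Lemma transportE u e : transport u (f e) = f (u e).
Proof. by rewrite permE fK. Qed.

Lemma transport_eq u (v' : {perm E'}) : (forall e, v' (f e) = f (u e)) -> v' = transport u.
Proof. by move=> H; apply/permP=> e'; rewrite -(gK e') H transportE. Qed.

Lemma transportM u v : transport (u * v)%g = (transport u * transport v)%g.
Proof. by apply/permP=> e'; rewrite -(gK e') permM !transportE permM. Qed.

Lemma transport_can_inj : injective transport.
Proof.
move=> u v uv; apply/permP=> e; apply: (can_inj fK).
by rewrite -!transportE uv.
Qed.

Lemma transportV u : transport u^-1%g = ((transport u)^-1)%g.
Proof.
apply: (mulgI (transport u)); rewrite mulgV -transportM mulgV.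
by apply/permP=> e'; rewrite -(gK e') transportE !perm1.
Qed.

Lemma transportX u k : transport (u ^+ k)%g = (transport u ^+ k)%g.
Proof.
elim: k => [|k IH]; last by rewrite !expgS transportM IH.
by apply/permP=> e'; rewrite -(gK e') transportE !expg0 !perm1.
Qed.

Lemma transport_porbit u e : porbit (transport u) (f e) = f @: porbit u e.
Proof.
apply/setP=> e'; rewrite -(gK e'); apply/porbitP/imsetP=> [[k ->]|[_ /porbitP[k ->] ->]].
  by exists ((u ^+ k)%g e); [apply: mem_porbit|rewrite -transportX transportE].
by exists k; rewrite -transportX transportE.
Qed.

Lemma transport_size : size_of E' = size_of E.
Proof. by apply/esym; apply: (bij_eq_card (f := f)); exists g. Qed.

Lemma transport_ncyc u : ncyc (transport u) = ncyc u.
Proof.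
rewrite /ncyc -(card_imset _ (imset_inj (can_inj fK))); congr #|pred_of_set _|.
apply/setP=> O; apply/imsetP/imsetP=> [[e' _ ->]|[_ /imsetP[e _ ->] ->]].
  by exists (porbit u (g e')); [apply: imset_f|rewrite -transport_porbit gK].
by exists (f e); rewrite ?transport_porbit.
Qed.

Lemma transport_geodesic u c : geodesic (transport u) (transport c) = geodesic u c.
Proof. by rewrite /geodesic -transportV -transportM !transport_ncyc transport_size. Qed.

Lemma transport_balanced p q u v w :
  balanced p q (transport u) (transport v) w = balanced p q u v (fun e => w (f e)).
Proof.
have S t m : [forall e', \sum_(i in porbit (transport t) e') w i == m] =
               [forall e, \sum_(i in porbit t e) w (f i) == m] :> bool.
  apply/forallP/forallP => al e.
    by rewrite -(eqP (al (f e))) transport_porbit big_imset //= => ? ? _ _; apply: can_inj fK _ _.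
  by rewrite -(gK e) transport_porbit big_imset ?(eqP (al _)) //= => ? ? _ _; apply: can_inj fK _ _.
rewrite /balanced !S; congr (_ && _); apply/forallP/forallP=> al e; first exact: al.
by rewrite -(gK e); apply: al.
Qed.
End Transport.

Lemma mem_balanced H p q (E : finType) (u c : {perm E}) :
  reflect (geodesic u c /\ exists w : E -> nat, (forall e, w e <= H) /\ balanced p q u (u^-1 * c)%g w)
    (u \in balanced_rotations H p q c).
Proof.
rewrite inE; apply: (iffP andP) => -[gu].
  by case/existsP=> w bw; split=> //; exists (fun e => w e : nat); split=> // e; rewrite -ltnS.
case=> w [wH bw]; split=> //; apply/existsP; exists [ffun e => inord (w e)].
by rewrite (eq_balanced _ _ _ _ (w' := w)) // => e; rewrite ffunE inordK // ltnS.
Qed.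

Lemma transport_rotations H p q (E E' : finType) (f : E -> E') g (fK : cancel f g) (gK : cancel g f) u c :
  (transport fK gK u \in balanced_rotations H p q (transport fK gK c)) = (u \in balanced_rotations H p q c).
Proof.
apply/mem_balanced/mem_balanced; rewrite transport_geodesic -transportV -transportM => -[gu [w [wH bw]]].
  by split=> //; exists (fun e => w (f e)); split=> //; rewrite -(transport_balanced fK gK).
split=> //; exists (fun e' => w (g e')); split=> //; rewrite transport_balanced.
by rewrite (eq_balanced _ _ _ _ (w' := w)) // => e; rewrite fK.
Qed.

Lemma card_commuting_rotations H p q (E E' : finType) (f : E -> E') g (fK : cancel f g) (gK : cancel g f) a c :
  #|[set u in balanced_rotations H p q c | (u * a == a * u)%g]| =
  #|[set u in balanced_rotations H p q (transport fK gK c) |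
       (u * transport fK gK a == transport fK gK a * u)%g]|.
Proof.
rewrite -(card_imset _ (transport_can_inj (fK := fK) (gK := gK))); apply: eq_card => u'.
apply/imsetP/idP=> [[u]|].
  rewrite in_set => /andP[uX /eqP ua] ->.
  by rewrite in_set -!transportM ua eqxx andbT transport_rotations.
have -> : u' = transport fK gK (transport gK fK u').
  by apply: transport_eq => e; apply: (can_inj gK); rewrite fK permE.
move: (transport gK fK u') => u; rewrite in_set transport_rotations -!transportM.
by rewrite (inj_eq (transport_can_inj (gK := gK))) => uX; exists u; rewrite // in_set.
Qed.

Section CycleModel.
Variables (M : nat) (E : finType) (c' : {perm E}) (e0 : E).
Hypotheses (tr : forall e, e \in porbit c' e0) (cE : #|E| = M.+1).
Local Notation c := (cyc M 0 M.+1).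

(** The edges of a face, numbered from [e0] on. *)
Lemma cycle_model : exists f g, [/\ cancel f g, cancel g f & forall i : 'I_M.+1, f (c i) = c' (f i)].
Proof.
pose f (i : 'I_M.+1) := (c' ^+ i)%g e0.
have per : (c' ^+ M.+1)%g e0 = e0.
  by rewrite -cE -[X in (c' ^+ X)%g](eq_card (A := porbit c' e0)) ?permX ?iter_porbit // => e; rewrite tr.
have perk k : (c' ^+ (k * M.+1))%g e0 = e0.
  by elim: k => [|k IH]; rewrite ?mul0n ?expg0 ?perm1 // mulSn expgD permM per.
have surj e : exists i, e = f i.
  have /porbitP[n ->] := tr e; exists (inord (n %% M.+1)); rewrite /f inordK ?ltn_pmod //.
  by rewrite {1}(divn_eq n M.+1) expgD permM perk.
have /imset_injP inj' : #|[set f i | i : 'I_M.+1]| == #|'I_M.+1|.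
  apply/eqP; apply: etrans (etrans (_ : _ = #|E|) cE) (esym (card_ord _)).
  apply: eq_card => e; rewrite inE; have [i ->] := surj e.
  exact: imset_f.
have inj : injective f by move=> i j; apply: inj'.
have [g fK gK] : bijective f by apply: inj_card_bij => //; rewrite card_ord cE.
exists f, g; split=> // i; rewrite /f val_cyc // add0n /= ltn_ord; case: eqP => [iM|_].
  by rewrite expg0 perm1 -permM -expgSr iM per.
by rewrite expgSr permM.
Qed.
End CycleModel.

(** * Counting orbits of rotations *)

(** A cyclic group has one subgroup of each order [d] dividing its own, with
    [totient d] generators. *)
Lemma sum_cycle (gT : finGroupType) (x : gT) (F : gT -> nat) :
  (forall a b, <[a]>%g = <[b]>%g -> F a = F b) ->
  \sum_(a in <[x]>%g) F a = \sum_(d <- divisors #[x]%g) totient d * F (x ^+ (#[x] %/ d))%g.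
Proof.
move=> Fg; have x0 : 0 < #[x]%g by apply: order_gt0.
have step (a : gT) : a \in <[x]>%g -> F a = \sum_(d <- divisors #[x]%g | d == #[a]%g) F a.
  move=> ax; rewrite big_mkcond (bigD1_seq #[a]%g) ?divisors_uniq //=; last first.
    by rewrite -dvdn_divisors // order_dvdG.
  by rewrite eqxx big1 ?addn0 // => d /negbTE ->.
rewrite (eq_bigr _ step) (exchange_big_dep xpredT) //= !big_seq; apply: eq_bigr => d.
rewrite -dvdn_divisors // => dx; set b := (x ^+ _)%g.
have ob : #[b]%g = d by rewrite orderXdiv ?dvdn_div // divnA ?mulKn.
have gen a : (a \in <[x]>%g) && (d == #[a]%g) = (<[a]>%g == <[b]>%g).
  apply/andP/eqP=> [[ax /eqP da]|E].
    apply/eqP; rewrite (eq_subG_cyclic (cycle_cyclic x)) ?cycle_subG ?mem_cycle //.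
    by rewrite -!orderE ob da.
  rewrite -ob !orderE E -cycle_subG E cycle_subG mem_cycle eqxx //.
rewrite (eq_bigl _ _ gen) (eq_bigr (fun=> F b)) => [|a /eqP E]; last exact: Fg.
rewrite sum_nat_const -ob totient_gen; congr (_ * _).
by apply: eq_card => a; rewrite !inE /generator eq_sym.
Qed.

Section Burnside.
Variables (M p q : nat).
Hypotheses (p0 : 0 < p) (q0 : 0 < q) (qp : q <= p) (alE : M.+1 = p + q - 1).
Local Notation T := 'I_M.+1.
Let c : {perm T} := cyc M 0 M.+1.
Let X := balanced_rotations p p q c.

Let c_trans (i j : T) : j \in porbit c i.
Proof. by rewrite porbit_cyc ?inE ?ltn_ord. Qed.

(** Conjugating by a power of [c] moves the edge at which the face is read. *)
Definition rotation_classes : {set {set {perm T}}} := [set orbit 'J <[c]>%g u | u in X].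

Lemma rotations_conj a u : a \in <[c]>%g -> ((u ^ a)%g \in X) = (u \in X).
Proof.
move=> /cycleP[k ak].
have tE v : (v ^ a)%g = transport (permK a) (permKV a) v.
  by apply: transport_eq => e; rewrite permJ.
have ca : (c ^ a)%g = c by apply/conjg_fixP/commgP; rewrite ak; apply: commuteX.
by rewrite /X -[in LHS]ca !tE transport_rotations.
Qed.

Let c_order : #[c]%g = M.+1.
Proof.
have pc i : #|porbit c i| = M.+1.
  by rewrite -[RHS](card_ord M.+1); apply: eq_card => j; rewrite c_trans.
apply/eqP; rewrite eqn_leq; apply/andP; split; last first.
  have : #|porbit c ord0| <= #[c]%g by rewrite orderE porbit.unlock; apply: leq_imset_card.
  by rewrite pc.
apply: dvdn_leq => //; rewrite order_dvdn; apply/eqP/permP=> i.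
by rewrite perm1; have := iter_porbit c i; rewrite pc permX.
Qed.

Lemma card_Fix a : #|'Fix_(X | 'J)[a]%g| = #|[set u in X | (u * a == a * u)%g]|.
Proof.
apply: eq_card => u; rewrite in_setI in_set; congr (_ && _).
by apply/afix1P/eqP => [E|E] /=; [rewrite -{2}E /= conjgE mulKVg|rewrite conjgE E mulKg].
Qed.

Section Fixed.
Variables (d m : nat).
Hypotheses (d1 : 1 < d) (alm : M.+1 = m.+1 * d).

(** Reading the edges in the order of the long cycle upstairs turns [c ^+ m.+1]
    into the shift of sheets. *)
Lemma card_Fix_rotation : #|'Fix_(X | 'J)[(c ^+ m.+1)%g]%g| = #|quotient_trees m p d p q|.
Proof.
case: d d1 alm => [|[|e]] // _ alm'; pose A := 'Z_e.+2.
have cA : #|A| = e.+2 by rewrite card_ord.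
have u1d : ((1 : A) *+ e.+2 = 0)%R by apply: char_Zp.
have gen (x : A) : exists k, x = ((1 : A) *+ k)%R by exists x; rewrite natr_Zp.
rewrite -(card_symmetric m p cA u1d gen) // card_Fix.
have cE : #|{: 'I_m.+1 * A}| = M.+1 by rewrite card_prod card_ord cA alm'.
have [f [g [fK gK fE]]] := cycle_model (big_cycle_trans gen (ord0, 0%R)) cE.
have cb : transport fK gK c = big_cycle m 1%R by apply/esym/transport_eq.
have sh : transport fK gK (c ^+ m.+1)%g = shift 'I_m.+1 (1 : A)%R.
  by rewrite transportX cb big_cycle_pow.
rewrite (card_commuting_rotations p p q fK gK) sh cb; apply: eq_card => u; rewrite !inE.
by rewrite -andbA; congr (_ && _); rewrite andbC.
Qed.

(** As [d] divides [q] and [p + q - 1], it is prime to [p], so that the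
    exceptional vertex is black. *)
Lemma card_Fix_black : d %| q ->
  (#|'Fix_(X | 'J)[(c ^+ m.+1)%g]%g|%:R = M.+1%:R * Gd p q q d :> rat)%R.
Proof.
move=> dq; have dp : d %| p - 1.
  have := dvdn_mull m.+1 (dvdnn d); rewrite -alm alE -addnBAC //; rewrite dvdn_addl //.
have ndp h : (d * h == p) = false.
  apply/negbTE/eqP=> E; have : d %| 1 by rewrite -(subKn p0) dvdn_sub // -E dvdn_mulr.
  by rewrite dvdn1; move: d1; case: eqP => // ->.
rewrite card_Fix_rotation (@card_quotient _ _ _ _ _ (single (q %/ d)) (fun=> 0%R)) //.
- have <- : (p + q - 1) %/ d = m.+1 by rewrite -alE alm mulnK // ltnW.
  by rewrite planted_count_marked // alE.
- move=> h; rewrite /single -(eqn_pmul2l (ltnW d1)) [d * (_ %/ d)]mulnC divnK //.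
- by move=> h; rewrite ndp.
Qed.

Lemma card_Fix_white : d %| p ->
  (#|'Fix_(X | 'J)[(c ^+ m.+1)%g]%g|%:R = M.+1%:R * Gd p q p d :> rat)%R.
Proof.
move=> dp; have dq : d %| q - 1.
  have := dvdn_mull m.+1 (dvdnn d); rewrite -alm alE -addnBA // dvdn_addr //.
have ndq h : (d * h == q) = false.
  apply/negbTE/eqP=> E; have : d %| 1 by rewrite -(subKn q0) dvdn_sub // -E dvdn_mulr.
  by rewrite dvdn1; move: d1; case: eqP => // ->.
rewrite card_Fix_rotation (@card_quotient _ _ _ _ _ (fun=> 0%R) (single (p %/ d))) //.
- have <- : (p + q - 1) %/ d = m.+1 by rewrite -alE alm mulnK // ltnW.
  by rewrite planted_count_marked_white // alE.
- by move=> h; rewrite ndq.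
- by move=> h; rewrite /single -(eqn_pmul2l (ltnW d1)) [d * (_ %/ d)]mulnC divnK //.
Qed.

Lemma card_Fix_none : ~~ (d %| q) -> ~~ (d %| p) ->
  #|'Fix_(X | 'J)[(c ^+ m.+1)%g]%g| = 0.
Proof.
move=> dq dp; rewrite card_Fix_rotation; apply: eq_card0 => z; rewrite in_set.
apply/negbTE; rewrite negb_and orbC; apply/orP; left; apply/existsP=> -[[K|K] /and3P[_ /eqP /= E _]].
  by case/negP: dq; rewrite -E dvdn_mulr.
by case/negP: dp; rewrite -E dvdn_mulr.
Qed.
End Fixed.

Lemma card_Fix1 : (#|'Fix_(X | 'J)[1%g]%g|%:R = M.+1%:R * G1 p q :> rat)%R.
Proof.
have -> : 'Fix_(X | 'J)[1%g]%g = X.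
  by apply/setP=> u; rewrite in_setI; case: (u \in X) => //=; apply/afix1P; rewrite /= conjg1.
rewrite /X (card_balanced M p p q (fun=> 0%R) (fun=> 0%R)).
by rewrite {1}alE planted_count_total // -alE.
Qed.

(** The divisors of [p + q - 1] that divide [q] are those of [gcdn (p - 1) q],
    and the ones that divide [p] are those of [gcdn p (q - 1)]. *)
Lemma rotation_classes_count : (#|rotation_classes|%:R = component_count p q)%R.
Proof.
have al0 : (M.+1%:R != 0 :> rat)%R by rewrite Num.Theory.pnatr_eq0.
apply: (mulIf al0); rewrite -natrM.
have acts : [acts <[c]>%g, on X | 'J].
  by apply/actsP=> a ac u; apply: rotations_conj.
have := Frobenius_Cauchy acts; rewrite -orderE c_order => <-.
rewrite sum_cycle => [|a b ab]; last by rewrite -!(afix_cycle 'J) ab.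
rewrite c_order natr_sum big_seq.
have step d : d \in divisors M.+1 ->
   ((totient d * #|'Fix_(X | 'J)[(c ^+ (M.+1 %/ d))%g]%g|)%:R =
    M.+1%:R * ((if d == 1%N then G1 p q else 0) +
     (if (1 < d)%N && (d %| q)%N then (totient d)%:R * Gd p q q d else 0) +
     (if (1 < d)%N && (d %| p)%N then (totient d)%:R * Gd p q p d else 0)) :> rat)%R.
  rewrite -dvdn_divisors // => /dvdnP[m alm]; case: d alm => [|[|d]] alm.
  - by rewrite muln0 in alm.
  - have -> : (c ^+ (M.+1 %/ 1) = 1)%g by have := expg_order c; rewrite c_order divn1.
    by rewrite mul1n card_Fix1 /= !addr0.
  have -> : M.+1 %/ d.+2 = m by rewrite alm mulnK.
  case: m alm => // m alm /=.
  rewrite natrM; have [dq|dq] := boolP (d.+2 %| q).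
    have -> : (d.+2 %| p) = false.
      apply/negbTE/negP=> dp; have := dvdn_mull m.+1 (dvdnn d.+2).
      rewrite -alm alE => /(dvdn_sub (dvdn_add dp dq)); rewrite subKn ?dvdn1 //.
      by rewrite addn_gt0 p0.
    by rewrite (card_Fix_black _ alm) // add0r addr0 mulrCA.
  have [dp|dp] := boolP (d.+2 %| p).
    by rewrite (card_Fix_white _ alm) // !add0r mulrCA.
  by rewrite (card_Fix_none _ alm) // !addr0 !mulr0.
rewrite (eq_bigr _ step) -big_seq -mulr_sumr mulrC; congr (_ * _)%R.
rewrite !big_split /=; congr (_ + _ + _)%R.
- rewrite (bigD1_seq 1%N) ?divisors_uniq // -?dvdn_divisors //= big1 ?addr0 //.
  by move=> d /negbTE ->.
- rewrite -big_mkcond /= -big_filter -[RHS]big_filter; apply: perm_big.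
  apply: uniq_perm; rewrite ?filter_uniq ?divisors_uniq // => d.
  rewrite !mem_filter; have [d1|] := ltnP 1 d => //=; rewrite -dvdn_divisors //.
  rewrite -dvdn_divisors ?gcdn_gt0 ?q0 ?orbT // dvdn_gcd andbC; have [dq|] := boolP (d %| q); rewrite ?andbF //=.
  by rewrite alE -addnBAC // dvdn_addl // andbT.
rewrite -big_mkcond /= -big_filter -[RHS]big_filter; apply: perm_big.
apply: uniq_perm; rewrite ?filter_uniq ?divisors_uniq // => d.
rewrite !mem_filter; have [d1|] := ltnP 1 d => //=; rewrite -dvdn_divisors //.
rewrite -dvdn_divisors ?gcdn_gt0 ?p0 // dvdn_gcd; have [dp|] := boolP (d %| p) => //=.
by rewrite alE -addnBA // dvdn_addr.
Qed.
End Burnside.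

(** * Reading a plane tree along its face *)

Section Bigraphs.
Variables (B W E : finType) (G : bigraph B W E).

Definition face_perm : {perm E} := (brot G * wrot G)%g.

(** The form in which trees are used here; [tree_like_is_tree] and [is_tree_like]
    compare it with the absence of cycles. *)
Definition tree_like : Prop := graph_connected G /\ #|B| + #|W| = #|E|.+1.

Definition balanced_weights p q (w : E -> nat) : Prop :=
  [/\ forall e, 0 < w e, forall x, \sum_(e | bend G e == x) w e = q &
      forall y, \sum_(e | wend G e == y) w e = p].

Lemma mem_brot e f : (f \in porbit (brot G) e) = (bend G f == bend G e).
Proof. by have /forallP/(_ e)/eqP -> := brotP G; rewrite inE. Qed.

Lemma mem_wrot e f : (f \in porbit (wrot G) e) = (wend G f == wend G e).
Proof. by have /forallP/(_ e)/eqP -> := wrotP G; rewrite inE. Qed.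

Lemma tree_like_is_tree : tree_like -> is_tree G.
Proof.
case=> conn; rewrite -card_sum => tc; split=> //; first exact: (tree_ends_inj conn tc).
exact: (tree_acyclic conn tc).
Qed.

Lemma is_tree_like : B -> is_tree G -> tree_like.
Proof.
move=> b0 [conn inj acyc]; split=> //; rewrite -card_sum.
exact: (acyclic_card (inl b0) conn inj acyc).
Qed.

Lemma tree_face e f : tree_like -> f \in porbit face_perm e.
Proof.
case=> conn; rewrite -card_sum => tc.
exact: (tree_one_face conn tc mem_brot mem_wrot).
Qed.

Lemma tree_faces (e0 : E) : tree_like -> #|faces G| = 1.
Proof. by move=> tl; apply: (ncyc_trans e0) => e f; apply: tree_face. Qed.

Lemma connected_neighbor u v : graph_connected G -> u != v -> exists z, adjacent G u z.
Proof.
move=> conn; have /connectP[[|z p] /=] := conn u v; first by move=> _ ->; rewrite eqxx.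
by move=> /andP[uz _] _ _; exists z.
Qed.

Lemma bend_surj b : W -> graph_connected G -> exists e, bend G e == b.
Proof.
move=> w conn; have [//|[b'|w'] //= /existsP[e /andP[eb _]]] := @connected_neighbor (inl b) (inr w) conn.
by exists e.
Qed.

Lemma wend_surj w : B -> graph_connected G -> exists e, wend G e == w.
Proof.
move=> b conn; have [//|[b'|w'] //= /existsP[e /andP[_ ew]]] := @connected_neighbor (inr w) (inl b) conn.
by exists e.
Qed.

Lemma ncyc_brot : W -> graph_connected G -> ncyc (brot G) = #|B|.
Proof.
move=> w conn; pose O b := [set e | bend G e == b].
have E1 e : porbit (brot G) e = O (bend G e) by apply/setP=> f; rewrite mem_brot inE.
have -> : ncyc (brot G) = #|O @: [set: B]|.
  apply: eq_card => K; apply/imsetP/imsetP=> [[e _ ->]|[b _ ->]]; first by exists (bend G e).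
  by have [e /eqP eb] := bend_surj b w conn; exists e; rewrite // E1 eb.
rewrite card_imset ?cardsT // => b b'; have [e /eqP eb] := bend_surj b w conn.
by move/setP/(_ e); rewrite !inE eb eqxx => /esym/eqP.
Qed.

Lemma ncyc_wrot : B -> graph_connected G -> ncyc (wrot G) = #|W|.
Proof.
move=> b conn; pose O w := [set e | wend G e == w].
have E1 e : porbit (wrot G) e = O (wend G e) by apply/setP=> f; rewrite mem_wrot inE.
have -> : ncyc (wrot G) = #|O @: [set: W]|.
  apply: eq_card => K; apply/imsetP/imsetP=> [[e _ ->]|[w _ ->]]; first by exists (wend G e).
  by have [e /eqP ew] := wend_surj w b conn; exists e; rewrite // E1 ew.
rewrite card_imset ?cardsT // => w w'; have [e /eqP ew] := wend_surj w b conn.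
by move/setP/(_ e); rewrite !inE ew eqxx => /esym/eqP.
Qed.

Lemma balanced_brot p q w : balanced_weights p q w -> balanced p q (brot G) (wrot G) w.
Proof.
case=> w0 bw ww; apply/and3P; split; apply/forallP=> e //; apply/eqP.
  by rewrite -(bw (bend G e)); apply: eq_bigl => f; rewrite mem_brot.
by rewrite -(ww (wend G e)); apply: eq_bigl => f; rewrite mem_wrot.
Qed.

Variable M : nat.
Local Notation T := 'I_M.+1.
Local Notation c := (cyc M 0 M.+1).

(** The black rotation read along the face, for all choices of the edge where
    the reading starts; [f] numbers the edges. *)
Definition readings : {set {perm T}} :=
  [set u : {perm T} | [exists f : {ffun T -> E},
     [forall i, (f (c i) == face_perm (f i)) && (brot G (f i) == f (u i))]]].

Lemma readingsP (u : {perm T}) :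
  reflect (exists f : T -> E, forall i, f (c i) = face_perm (f i) /\ brot G (f i) = f (u i))
          (u \in readings).
Proof.
rewrite inE; apply: (iffP existsP) => [[f /forallP fP]|[f fP]].
  by exists f => i; have /andP[/eqP -> /eqP ->] := fP i.
by exists [ffun i => f i]; apply/forallP=> i; rewrite !ffunE; have [-> ->] := fP i; rewrite !eqxx.
Qed.

Hypotheses (tl : tree_like) (cE : #|E| = M.+1).

Let c_trans (i j : T) : j \in porbit c i.
Proof. by rewrite porbit_cyc ?inE ?ltn_ord. Qed.

Lemma reading_pow (f : T -> E) k i : (forall i, f (c i) = face_perm (f i)) ->
  f ((c ^+ k)%g i) = (face_perm ^+ k)%g (f i).
Proof.
move=> fc; elim: k => [|k IH]; first by rewrite !expg0 !perm1.
by rewrite !expgSr (permM (c ^+ k)%g) (permM (face_perm ^+ k)%g) fc IH.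
Qed.

Lemma reading_bij (f : T -> E) : (forall i, f (c i) = face_perm (f i)) ->
  exists g, cancel f g /\ cancel g f.
Proof.
move=> fc; have surj e : exists i, e = f i.
  have /porbitP[n ->] := tree_face (f ord0) e tl; exists ((c ^+ n)%g ord0).
  by rewrite reading_pow.
have /imset_injP inj' : #|[set f i | i : T]| == #|T|.
  apply/eqP; apply: etrans (etrans (_ : _ = #|E|) cE) (esym (card_ord _)).
  by apply: eq_card => e; rewrite inE; have [i ->] := surj e; apply: imset_f.
have inj : injective f by move=> i j; apply: inj'.
by have [|g fK gK] := inj_card_bij inj _; [rewrite card_ord cE|exists g].
Qed.

(** Two numberings of the edges along the face differ by a power of [c]. *)
Lemma readings_orbit u : u \in readings -> readings = orbit 'J <[c]>%g u.
Proof.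
move=> /readingsP[f fP]; have fc i : f (c i) = face_perm (f i) by have [] := fP i.
have [g [fK gK]] := reading_bij fc.
apply/setP=> v; apply/readingsP/orbitP=> [[f' f'P]|[a /cycleP[k ->] <-]].
  have f'c i : f' (c i) = face_perm (f' i) by have [] := f'P i.
  have /porbitP[k k0] := tree_face (f ord0) (f' ord0) tl.
  have f'E i : f' i = f ((c ^+ k)%g i).
    have /porbitP[n ->] := c_trans ord0 i; rewrite (reading_pow _ _ f'c) k0.
    by rewrite !(reading_pow _ _ fc) -!permM -!expgD addnC.
  exists (c ^- k)%g; first by rewrite groupV mem_cycle.
  rewrite /= conjgE invgK; apply: (mulIg (c ^+ k)%g); rewrite -!mulgA mulVg mulg1.
  apply/permP=> i; rewrite !permM; apply: (can_inj fK).
  have [_ <-] := fP ((c ^+ k)%g i); rewrite -!f'E; by have [_] := f'P i.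
exists (fun i => f ((c ^- k)%g i)) => i; split.
  have cc : commute c (c ^- k)%g by apply/commuteV/commuteX.
  by rewrite -fc -[in LHS]permM -[in RHS]permM cc.
have [_ ->] := fP ((c ^- k)%g i); congr f.
by rewrite /= conjgE !permM permK.
Qed.

Lemma readings_in p q (w : E -> nat) : 0 < p -> 0 < q -> q <= p -> M.+1 = p + q - 1 ->
  #|B| = p -> #|W| = q -> balanced_weights p q w -> readings \in rotation_classes M p q.
Proof.
move=> p0 q0 qp alE cB cW bw; have [conn vc] := tl.
have [b _] : exists b, b \in B by apply/card_gt0P; rewrite cB.
have [y _] : exists y, y \in W by apply/card_gt0P; rewrite cW.
have [e0 _] : exists e0, e0 \in E by apply/card_gt0P; rewrite cE.
have [f [g [fK gK fc]]] := cycle_model (fun e => tree_face e0 e tl) cE.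
pose u := transport gK fK (brot G).
have uR : u \in readings.
  apply/readingsP; exists f => i; split; first exact: fc.
  by rewrite -{2}(fK i) transportE gK.
apply/imsetP; exists u; last exact: readings_orbit.
have cT : c = transport gK fK face_perm.
  by apply: transport_eq => e; apply: (can_inj fK); rewrite fc !gK.
rewrite cT transport_rotations; apply/mem_balanced.
have wE : ((brot G)^-1 * face_perm)%g = wrot G by rewrite mulKg.
split.
  rewrite geodesic_card ?wE ?(ncyc_brot y conn) ?(ncyc_wrot b conn) ?vc //.
  by apply: (ncyc_trans e0) => e e'; apply: tree_face.
exists w; rewrite wE; split; last exact: balanced_brot.
move=> e; apply: leq_trans qp; have [_ bs _] := bw.
by rewrite -(bs (bend G e)) (bigD1 e) //= leq_addr.
Qed.
End Bigraphs.

(** * Isomorphic trees and their readings *)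

Lemma tree_weights_inj (B W E : finType) (G : bigraph B W E) (A : zmodType) (w w' : E -> A) :
  tree_like G ->
  (forall x, \sum_(e | bend G e == x) w e = \sum_(e | bend G e == x) w' e)%R ->
  (forall y, \sum_(e | wend G e == y) w e = \sum_(e | wend G e == y) w' e)%R -> w =1 w'.
Proof.
case=> conn; rewrite -card_sum => tc bw ww.
by apply: (tree_vsum_inj conn tc) => -[b|y]; [apply: bw|apply: ww].
Qed.

Lemma balanced_iso (B W E B' W' E' : finType) (G : bigraph B W E) (G' : bigraph B' W' E')
    fb fw fe (A : zmodType) (a b : A) (w : E -> A) (w' : E' -> A) :
  tree_like G -> bigraph_iso G G' fb fw fe ->
  (forall x, \sum_(e | bend G e == x) w e = a)%R ->
  (forall y, \sum_(e | wend G e == y) w e = b)%R ->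
  (forall x, \sum_(e | bend G' e == x) w' e = a)%R ->
  (forall y, \sum_(e | wend G' e == y) w' e = b)%R -> forall e, w' (fe e) = w e.
Proof.
move=> tl [fbB fwB feB isoP] sb sw sb' sw'; apply: (tree_weights_inj tl) => [x|y].
  rewrite sb -(sb' (fb x)) (reindex fe) /=; last exact: onW_bij.
  by apply: eq_bigl => e; have [-> _ _ _] := isoP e; rewrite (inj_eq (bij_inj fbB)).
rewrite sw -(sw' (fw y)) (reindex fe) /=; last exact: onW_bij.
by apply: eq_bigl => e; have [_ -> _ _] := isoP e; rewrite (inj_eq (bij_inj fwB)).
Qed.

Section Isomorphism.
Variables (B W E B' W' E' : finType) (G : bigraph B W E) (G' : bigraph B' W' E') (M : nat).

Lemma readings_iso_sub fb fw fe : bigraph_iso G G' fb fw fe -> readings G M \subset readings G' M.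
Proof.
case=> _ _ _ isoP; apply/subsetP=> u /readingsP[f fP]; apply/readingsP; exists (fun i => fe (f i)) => i.
have [fc fb'] := fP i; rewrite fc /face_perm !permM.
have [_ _ -> _] := isoP (f i); have [_ _ _ ->] := isoP (brot G (f i)).
by rewrite fb'.
Qed.

Hypotheses (tl : tree_like G) (tl' : tree_like G') (cE : #|E| = M.+1) (cE' : #|E'| = M.+1).
Hypotheses (cB : #|B| = #|B'|) (cW : #|W| = #|W'|) (b0 : B) (y0 : W).

(** Equal numbers along the faces match the edges compatibly with both
    rotations; the vertices follow, being the orbits of the rotations. *)
Lemma iso_of_readings u : u \in readings G M -> u \in readings G' M ->
  exists fb fw fe, bigraph_iso G G' fb fw fe.
Proof.
move=> /readingsP[f fP] /readingsP[f' f'P].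
have fc i : f (cyc M 0 M.+1 i) = face_perm G (f i) by have [] := fP i.
have fc' i : f' (cyc M 0 M.+1 i) = face_perm G' (f' i) by have [] := f'P i.
have [g [fK gK]] := reading_bij tl cE fc; have [g' [fK' gK']] := reading_bij tl' cE' fc'.
pose fe e := f' (g e).
have feB : bijective fe by exists (fun e => f (g' e)) => e; rewrite /fe ?fK ?gK' ?fK' ?gK.
have fbE e : brot G' (fe e) = fe (brot G e).
  have [_ ->] := f'P (g e); rewrite -{2}(gK e); have [_ ->] := fP (g e).
  by rewrite /fe fK.
have ffE e : face_perm G' (fe e) = fe (face_perm G e).
  by rewrite -fc' -{2}(gK e) -fc /fe fK.
have fwE e : wrot G' (fe e) = fe (wrot G e).
  have := ffE ((brot G)^-1%g e); rewrite /face_perm !permM permKV => <-.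
  by rewrite fbE permKV.
have porb (s : {perm E}) (s' : {perm E'}) e h : (forall e, s' (fe e) = fe (s e)) ->
    (fe h \in porbit s' (fe e)) = (h \in porbit s e).
  move=> sE; have pw n : (s' ^+ n)%g (fe e) = fe ((s ^+ n)%g e).
    by elim: n => [|n IH]; rewrite ?expg0 ?perm1 // !expgSr !permM IH sE.
  apply/porbitP/porbitP=> -[n hn]; exists n; last by rewrite pw hn.
  by apply: (bij_inj feB); rewrite -pw.
have bE e h : (bend G' (fe h) == bend G' (fe e)) = (bend G h == bend G e).
  by rewrite -!mem_brot (porb (brot G)).
have wE e h : (wend G' (fe h) == wend G' (fe e)) = (wend G h == wend G e).
  by rewrite -!mem_wrot (porb (wrot G)).
have [conn _] := tl.
pose fb b := bend G' (fe (xchoose (bend_surj b y0 conn))).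
pose fw y := wend G' (fe (xchoose (wend_surj y b0 conn))).
have fbP e : fb (bend G e) = bend G' (fe e).
  by apply/eqP; rewrite bE; apply: (xchooseP (bend_surj (bend G e) y0 conn)).
have fwP e : fw (wend G e) = wend G' (fe e).
  by apply/eqP; rewrite wE; apply: (xchooseP (wend_surj (wend G e) b0 conn)).
exists fb, fw, fe; split=> //.
- apply: inj_card_bij; last by rewrite cB.
  move=> x x'; have [e /eqP <-] := bend_surj x y0 conn; have [h /eqP <-] := bend_surj x' y0 conn.
  by rewrite !fbP => /eqP; rewrite bE => /eqP.
- apply: inj_card_bij; last by rewrite cW.
  move=> x x'; have [e /eqP <-] := wend_surj x b0 conn; have [h /eqP <-] := wend_surj x' b0 conn.
  by rewrite !fwP => /eqP; rewrite wE => /eqP.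
Qed.
End Isomorphism.

Lemma readings_iso (B W E B' W' E' : finType) (G : bigraph B W E) (G' : bigraph B' W' E') M fb fw fe :
  bigraph_iso G G' fb fw fe -> readings G M = readings G' M.
Proof.
move=> iso; apply/eqP; rewrite eqEsubset (readings_iso_sub _ iso) /=.
have [_ _ [ge feK geK] _] := iso; have [gb [gw iso']] := bigraph_iso_sym iso feK geK.
exact: readings_iso_sub iso'.
Qed.

Section Realize.
Variables (E : finType) (s : {perm E}) (n : nat).
Hypothesis cn : #|porbits s| = n.

Definition orbit_index (e : E) : 'I_n := cast_ord cn (enum_rank_in (imset_f (porbit s) (isT : e \in E)) (porbit s e)).

Lemma orbit_indexE e f : (orbit_index f == orbit_index e) = (f \in porbit s e).
Proof.
rewrite /orbit_index (inj_eq (@cast_ord_inj _ _ _)) -eq_porbit_mem; apply/eqP/eqP => [E1|E1].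
  have P h : porbit s h \in porbits s by apply: imset_f.
  rewrite -(enum_rankK_in (imset_f _ (isT : f \in E)) (P f)) E1.
  by rewrite enum_rankK_in.
by apply: enum_val_inj; rewrite !enum_rankK_in ?imset_f.
Qed.

Lemma orbit_index_surj i : exists e, orbit_index e = i.
Proof.
have /imsetP[e _ ie] := enum_valP (cast_ord (esym cn) i).
exists e; apply: (@cast_ord_inj _ _ (esym cn)); apply: enum_val_inj.
by rewrite ie /orbit_index cast_ordK enum_rankK_in ?imset_f.
Qed.
End Realize.

Section Realization.
Variables (M p q : nat).
Hypotheses (p0 : 0 < p) (q0 : 0 < q) (alE : M.+1 = p + q - 1).
Local Notation c := (cyc M 0 M.+1).

(** The vertices are the orbits of the two rotations.  Computing the total weight
    at both colors shows that there are [p] black and [q] white ones. *)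
Lemma readings_surj O : O \in rotation_classes M p q ->
  exists (G : bigraph 'I_p 'I_q 'I_M.+1) (w : 'I_M.+1 -> nat),
    [/\ tree_like G, balanced_weights G p q w & readings G M = O].
Proof.
case/imsetP=> u /mem_balanced[gu [w [_ bw]]] ->.
have c_trans (i j : 'I_M.+1) : j \in porbit c i by rewrite porbit_cyc ?inE ?ltn_ord.
pose t := (u^-1 * c)%g; have ut : (u * t)%g = c by rewrite mulKVg.
have nc : ncyc u + ncyc t = p + q.
  move: gu; rewrite (geodesic_card _ (ncyc_trans ord0 c_trans)) /size_of card_ord => /eqP ->.
  by rewrite alE subn1 prednK // addn_gt0 p0.
have [w0 /forallP bu /forallP bt] := and3P bw.
have tot (s : {perm 'I_M.+1}) r : (forall e, \sum_(i in porbit s e) w i == r) -> \sum_i w i = ncyc s * r.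
  move=> sr; rewrite (partition_big (porbit s) (mem (porbits s))) /= => [|i _]; last exact: imset_f.
  rewrite -sum_nat_const; apply: eq_bigr => _ /imsetP[i _ ->]; rewrite -(eqP (sr i)).
  by apply: eq_bigl => j; rewrite eq_porbit_mem.
have cu : ncyc u = p.
  have := tot _ _ bu; rewrite (tot _ _ bt) -/t => E.
  have : ncyc u * (p + q) = p * (p + q).
    rewrite -{2}nc mulnDr -E; move: (ncyc u) (ncyc t) => a b; lia.
  by move/eqP; rewrite eqn_pmul2r ?addn_gt0 ?p0 // => /eqP.
have ct : ncyc t = q by apply/eqP; rewrite -(eqn_add2l p) -{1}cu nc.
pose x := orbit_index cu; pose y := orbit_index ct.
have P1 : [forall e, porbit u e == [set f | [ffun e => x e] f == [ffun e => x e] e]]%SET.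
  by apply/forallP=> e; apply/eqP/setP=> f; rewrite inE !ffunE orbit_indexE.
have P2 : [forall e, porbit t e == [set f | [ffun e => y e] f == [ffun e => y e] e]]%SET.
  by apply/forallP=> e; apply/eqP/setP=> f; rewrite inE !ffunE orbit_indexE.
pose G := Bigraph P1 P2; exists G, w.
have tl : tree_like G.
  split; last by rewrite !card_ord alE subn1 prednK // addn_gt0 p0.
  apply: (@one_face_connected _ _ _ (bend G) (wend G) u t) => [e|e|e f|b|b].
  - by apply/eqP; rewrite !ffunE orbit_indexE (mem_porbit u 1).
  - by apply/eqP; rewrite !ffunE orbit_indexE (mem_porbit t 1).
  - by rewrite ut c_trans.
  - by have [e <-] := orbit_index_surj cu b; exists e; rewrite ffunE.
  - by have [e <-] := orbit_index_surj ct b; exists e; rewrite ffunE.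
split=> //.
  split=> [|b|b]; first exact/forallP.
    have [e <-] := orbit_index_surj cu b; apply: etrans (eqP (bu e)).
    by apply: eq_bigl => f; rewrite ffunE orbit_indexE.
  have [e <-] := orbit_index_surj ct b; apply: etrans (eqP (bt e)).
  by apply: eq_bigl => f; rewrite ffunE orbit_indexE.
apply: readings_orbit => //; first by rewrite card_ord.
by apply/readingsP; exists id => i; rewrite /face_perm /= ut.
Qed.
End Realization.

(** * A lower bound for the length of a meridian *)

From mathcomp Require Import all_classical all_reals all_analysis.
Import numFieldNormedType.Exports.
Local Open Scope classical_set_scope.
Local Open Scope ring_scope.
Local Open Scope card_scope.

(** With [d = K0 - K1] the radicand is at most [d^2 * K0], since [K + K0 + K1] is
    at most [3 * K0]; so the integrand is at least [1 / (d * sqrt K0)] on an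
    interval of length [d]. *)
Lemma meridian_length_ge (R : realType) (K0 rho : R) : 0 < K0 -> 0 < rho < 1 ->
  (((Num.sqrt K0)^-1)%:E <= meridian_length K0 rho)%E.
Proof.
move=> K0_gt0 /andP[rho0 rho1]; rewrite /meridian_length; set K1 := min_curvature K0 rho.
have r2 : 0 < 2 - rho by lra.
have K1E : K0 - K1 = K0 * (3 * (1 - rho)) / (2 - rho) by rewrite /K1 /min_curvature; field; rewrite gt_eqF.
have s1 : K0 + K1 + K1 = K0 * (3 * rho) / (2 - rho) by rewrite /K1 /min_curvature; field; rewrite gt_eqF.
have d0 : 0 < K0 - K1 by rewrite K1E divr_gt0 // mulr_gt0 //; lra.
have s0 : 0 < K0 + K1 + K1 by rewrite s1 divr_gt0 // mulr_gt0 //; lra.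
pose d := K0 - K1; pose F K := (K0 - K) * (K - K1) * (K + K0 + K1) / 3.
have Fpos K : K1 < K < K0 -> 0 < F K.
  move=> /andP[k1 k2]; rewrite /F !mulr_gt0 // ?subr_gt0 //; lra.
have Fle K : K1 < K < K0 -> F K <= d ^+ 2 * K0.
  move=> /andP[k1 k2]; have -> : d ^+ 2 * K0 = d * d * (3 * K0) / 3 by field.
  rewrite /F ler_pM2r // !ler_pM ?mulr_ge0 ?subr_ge0 ?ltW //; rewrite /d; lra.
have sd : Num.sqrt (d ^+ 2 * K0) = d * Num.sqrt K0.
  by rewrite sqrtrM ?sqr_ge0 // sqrtr_sqr gtr0_norm.
have cst : (((Num.sqrt K0)^-1)%:E = \int[lebesgue_measure]_(K in `]K1, K0[) (cst ((d * Num.sqrt K0)^-1)%:E K))%E.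
  rewrite integral_cst //= lebesgue_measure_itv /= lte_fin -subr_gt0 d0 -EFinD -EFinM; congr (_%:E).
  rewrite -/d; field; rewrite !gt_eqF ?sqrtr_gt0 //.
rewrite cst; apply: ge0_le_integral => //=.
- by move=> K _; rewrite lee_fin invr_ge0 mulr_ge0 ?sqrtr_ge0 // ltW.
- apply/measurable_realfun.measurable_EFinP; apply: measurable_realfun.open_continuous_measurable_fun => //.
  move=> K; rewrite inE /= in_itv /= => kk.
  apply: (@continuousV _ _ (fun K => Num.sqrt (F K))); first by rewrite gt_eqF // sqrtr_gt0 Fpos.
  apply: (@continuous_comp _ _ _ F Num.sqrt); last exact: sqrt_continuous.
  rewrite /F; apply: continuousM; last exact: cst_continuous.
  apply: continuousM.
    apply: continuousM; first by apply: continuousB => //; exact: cst_continuous.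
    by apply: continuousB => //; exact: cst_continuous.
  by apply: continuousD; [apply: continuousD => //|]; exact: cst_continuous.
- move=> K; rewrite in_itv /= => kk; rewrite lee_fin -sd lef_pV2 ?posrE ?sqrtr_gt0 ?Fpos //.
    by rewrite ler_sqrt ?Fle // ltW // (lt_le_trans (Fpos _ kk)) // Fle.
  by rewrite (lt_le_trans (Fpos _ kk)) // Fle.
Qed.

(** * Classes of weighted trees *)

(** Classes are counted by a complete invariant with values in a finite set. *)
Lemma card_classes (S : finType) (Y : {set S}) (U : Type) (D : set U) (cls : U -> set U)
    (k : U -> S) (y0 : S) :
  (forall t, D t -> k t \in Y) -> (forall y, y \in Y -> exists2 t, D t & k t = y) ->
  (forall t t', D t -> D t' -> cls t = cls t' <-> k t = k t') ->
  cls @` D #= `I_#|Y|.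
Proof.
move=> kY kS kE; pose g y : set U := [set v | exists t, [/\ D t, k t = y & cls t v]].
have gE t : D t -> g (k t) = cls t.
  move=> Dt; apply/seteqP; split=> v; last by exists t.
  by move=> [t' [Dt' kk]]; rewrite (proj2 (kE t' t Dt' Dt) kk).
pose h i := g (nth y0 (enum Y) i).
have nthY i : (i < #|Y|)%N -> nth y0 (enum Y) i \in Y.
  by move=> lt_i; rewrite -mem_enum mem_nth // -cardE.
have -> : cls @` D = h @` `I_#|Y|.
  apply/seteqP; split=> [_ [t Dt <-]|_ [t /= lt_t <-]].
    have kt := kY _ Dt; rewrite -mem_enum in kt; exists (index (k t) (enum Y)); last by rewrite /h nth_index // gE.
    by rewrite /= cardE index_mem.
  have [t' Dt' kt'] := kS _ (nthY _ lt_t); exists t' => //.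
  by rewrite /h -kt' gE.
apply: inj_card_eq => i j; rewrite !inE /= => lt_i lt_j.
have [t Dt kt] := kS _ (nthY _ lt_i); have [t' Dt' kt'] := kS _ (nthY _ lt_j).
rewrite /h -kt -kt' !gE // => /(proj1 (kE t t' Dt Dt')).
by rewrite kt kt' => /eqP; rewrite nth_uniq ?enum_uniq -?cardE // => /eqP.
Qed.

Section WBP.
Variables (M p q : nat).
Hypotheses (p0 : (0 < p)%N) (q0 : (0 < q)%N) (qp : (q <= p)%N) (alE : M.+1 = (p + q - 1)%N).

Lemma wbp_same_refl T : wbp_same T T.
Proof. by exists id, id, id; split=> //; exact: bigraph_iso_refl. Qed.

Lemma wbp_same_sym T T' : wbp_same T T' -> wbp_same T' T.
Proof.
move=> [fb [fw [fe [iso ew]]]]; have [_ _ [ge feK geK] _] := iso.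
have [gb [gw iso']] := bigraph_iso_sym iso feK geK.
by exists gb, gw, ge; split=> // e; rewrite -ew geK.
Qed.

Lemma wbp_same_trans T T' T'' : wbp_same T T' -> wbp_same T' T'' -> wbp_same T T''.
Proof.
move=> [fb [fw [fe [iso ew]]]] [gb [gw [ge [iso' ew']]]].
exists (gb \o fb), (gw \o fw), (ge \o fe); split; first exact: bigraph_iso_trans iso iso'.
by move=> e /=; rewrite ew' ew.
Qed.

Lemma wbp_class_eq T T' : [set U | wbp_same T U] = [set U | wbp_same T' U] <-> wbp_same T T'.
Proof.
split=> [E|TT']; first by have : [set U | wbp_same T' U] T' := wbp_same_refl T'; rewrite -E.
apply/seteqP; split=> U /=; first by apply: wbp_same_trans; apply: wbp_same_sym.
exact: wbp_same_trans.
Qed.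

Lemma balanced_wbp_treeP T : balanced_wbp_tree p q T ->
  [/\ tree_like T, #|'I_(nblack T)| = p, #|'I_(nwhite T)| = q, #|'I_(nedge T)| = M.+1 &
      balanced_weights T p q (eweight T)].
Proof.
move=> [[tr w0] cb cw bw ww]; have tl : tree_like T by apply: is_tree_like tr; rewrite cb; exists 0%N.
split=> //; rewrite ?card_ord //; have [_] := tl; rewrite !card_ord cb cw => E.
by rewrite alE E subn1.
Qed.

Lemma sum_Posz (E : finType) (P : pred E) (w : E -> nat) :
  \sum_(e | P e) Posz (w e) = Posz (\sum_(e | P e) w e)%N.
Proof. by rewrite (big_morph Posz PoszD (erefl (Posz 0))). Qed.

Lemma wbp_classes_card : wbp_classes p q #= `I_#|rotation_classes M p q|.
Proof.
apply: (@card_classes _ (rotation_classes M p q) _ (balanced_wbp_tree p q)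
  (fun T => [set T' | wbp_same T T']) (fun T => readings (wgraph T) M) finset.set0) => [T DT|O OX|T T' DT DT'].
- have [tl cb cw ce bw] := balanced_wbp_treeP DT.
  exact: (readings_in tl ce p0 q0 qp alE cb cw bw).
- have [G [w [tl [w0 bw ww] GO]]] := readings_surj p0 q0 alE OX.
  exists (WeightedBigraph G w) => //; split=> //; split=> //.
  exact: tree_like_is_tree.
rewrite wbp_class_eq; split=> [[fb [fw [fe [iso _]]]]|kk]; first exact: readings_iso iso.
have [tl cb cw ce bw] := balanced_wbp_treeP DT; have [tl' cb' cw' ce' bw'] := balanced_wbp_treeP DT'.
have /imsetP[u _ uE] := readings_in tl ce p0 q0 qp alE cb cw bw.
have uk : u \in readings T M by rewrite uE; apply: action.orbit_refl.
have [b0 _] : exists b, b \in 'I_(nblack T) by apply/card_gt0P; rewrite cb.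
have [y0 _] : exists y, y \in 'I_(nwhite T) by apply/card_gt0P; rewrite cw.
have [|||fb [fw [fe iso]]] := iso_of_readings tl tl' ce ce' _ _ b0 y0 uk; first by rewrite cb cb'.
- by rewrite cw cw'.
- by rewrite -kk.
exists fb, fw, fe; split=> // e.
have [w0 sb sw] := bw; have [w0' sb' sw'] := bw'.
suff [] : Posz (eweight T' (fe e)) = Posz (eweight T e) by [].
apply: (balanced_iso (a := Posz q) (b := Posz p) (w := fun e => Posz (eweight T e))
  (w' := fun e => Posz (eweight T' e)) tl iso) => x;
  by rewrite sum_Posz ?sb ?sw ?sb' ?sw'.
Qed.
End WBP.

(** * Connected components of the moduli space *)

Local Open Scope quotient_scope.

Section Moduli.
Variables (R : realType) (M p q : nat).
Hypotheses (p0 : (0 < p)%N) (q0 : (0 < q)%N) (qp : (q < p)%N) (alE : M.+1 = (p + q - 1)%N).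
Local Notation params := (@hcmu_params R M.+1 p q).
Local Notation data := (@hcmu_data R M.+1 p q).
Local Notation moduli := (@hcmu_moduli R M.+1 p q).
Local Notation graph := (bigraph 'I_p 'I_q 'I_M.+1).
Implicit Types (G : graph) (K L rho : R) (w : 'rV[R]_M.+1).

Let pR0 : (0 : R) < p%:R. Proof. by rewrite ltr0n. Qed.
Let qR0 : (0 : R) < q%:R. Proof. by rewrite ltr0n. Qed.

Definition hcmu_point G K rho L w : params := (G, K, rho, L, w).

Lemma data_tree G K rho L w : data (hcmu_point G K rho L w) -> tree_like G.
Proof.
move=> [[[conn sph] f1] _ _ _ _]; split=> //; move: sph; rewrite f1.
by move: #|_| #|_| #|_|; clear; lia.
Qed.

Lemma total_weight (B E : finType) (x : E -> B) (w : E -> R) :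
  \sum_b \sum_(e | x e == b) w e = \sum_e w e.
Proof. by rewrite [RHS](partition_big x xpredT). Qed.

Lemma data_ratio G K rho L w : data (hcmu_point G K rho L w) -> rho = q%:R / p%:R.
Proof.
move=> [_ _ _ _ [_ bw ww]]; have E1 : \sum_e w ord0 e = p%:R.
  rewrite -(total_weight (bend G)) (eq_bigr (fun=> 1)) => [|b _]; last exact: bw.
  by rewrite sumr_const card_ord.
have : rho * \sum_e w ord0 e = q%:R.
  rewrite -(total_weight (wend G)) mulr_sumr (eq_bigr (fun=> 1)) => [|y _]; last exact: ww.
  by rewrite sumr_const card_ord.
by rewrite E1 => <-; rewrite mulfK // gt_eqF.
Qed.

(** Integral weights with the sums [q] and [p] exist on any tree; by uniqueness
    of real weights they are [q] times the given ones, hence positive. *)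
Lemma data_weights G K rho L w : data (hcmu_point G K rho L w) ->
  exists v : 'I_M.+1 -> nat, balanced_weights G p q v.
Proof.
move=> Dx; have tl := data_tree Dx; have rhoE := data_ratio Dx; have [conn _] := tl.
case: Dx => _ _ _ _ [w0 bw ww].
pose t (v : 'I_p + 'I_q) : int := if v is inl _ then Posz q else Posz p.
have nat_mul (a b : nat) : Posz a *+ b = Posz (a * b)%N.
  by elim: b => [|b IH]; rewrite ?mulr0n ?muln0 // mulrS IH mulnS.
have [|v vP] := vsum_surj conn (t := t) _ ord0.
  by rewrite /= !sumr_const !card_ord !nat_mul mulnC.
have vb x : \sum_(e | bend G e == x) v e = q by have := vP (inl x).
have vw y : \sum_(e | wend G e == y) v e = p by have := vP (inr y).
have vE : (fun e => (v e)%:~R) =1 (fun e => q%:R * w ord0 e).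
  apply: (tree_weights_inj tl) => x; rewrite -mulr_sumr -rmorph_sum /=.
    by rewrite vb bw mulr1.
  have := ww x; rewrite rhoE vw; move: (\sum_(_ | _) _) => S hS.
  have -> : S = p%:R / q%:R.
    by rewrite -[LHS]mul1r -[X in X * S](@divff _ (p%:R / q%:R)) ?mulf_neq0 ?invr_neq0 ?gt_eqF //
       invf_div -mulrA hS mulr1.
  by rewrite mulrC divfK // gt_eqF.
have v0 e : (0 : int) < v e.
  by rewrite -(ltr0z R) vE mulr_gt0.
have av e : Posz `|v e|%N = v e by rewrite gez0_abs // ltW.
exists (fun e => `|v e|%N); split=> [e|x|y].
- by rewrite -ltz_nat av.
- by apply/eqP; rewrite -eqz_nat -sum_Posz (eq_bigr _ (fun e _ => av e)) vb.
- by apply/eqP; rewrite -eqz_nat -sum_Posz (eq_bigr _ (fun e _ => av e)) vw.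
Qed.

Lemma data_move G K rho L w K' L' : data (hcmu_point G K rho L w) ->
  0 < K' -> 0 < L' -> (L'%:E < meridian_length K' rho)%E -> data (hcmu_point G K' rho L' w).
Proof. by move=> [h1 h2 h3 h4 h5] K'0 L'0 L'l; split. Qed.

Definition graph_of (x : data) : graph := (set_val x).1.1.1.1.
Definition cls (x : data) : moduli := \pi_(moduli) x.

Lemma cls_eq (x y : data) : hcmu_rel x y -> cls x = cls y.
Proof. by move=> xy; apply/eqmodP. Qed.

Lemma cls_rel (x y : data) : cls x = cls y -> hcmu_rel x y.
Proof. by move/eqmodP. Qed.

Lemma reprK_cls (z : moduli) : cls (generic_quotient.repr z) = z.
Proof. exact: reprK. Qed.

Definition moduli_reading (z : moduli) : {set {perm 'I_M.+1}} := readings (graph_of (generic_quotient.repr z)) M.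

Lemma reading_cls x : moduli_reading (cls x) = readings (graph_of x) M.
Proof.
have /asboolP := cls_rel (reprK_cls (cls x)); rewrite /moduli_reading /graph_of.
case: (set_val (generic_quotient.repr (cls x))) => [[[[G K] rho] L] w].
case: (set_val x) => [[[[G' K'] rho'] L'] w'] /=.
by move=> [_ _ _ [fb [fw [fe [iso _]]]]]; apply: readings_iso iso.
Qed.

Lemma moduli_reading_open (P : set {set {perm 'I_M.+1}}) : open (moduli_reading @^-1` P).
Proof.
rewrite /open /= /quotient_open.
have -> : \pi_(moduli) @^-1` (moduli_reading @^-1` P) =
  set_val @^-1` ((fun x : params => x.1.1.1.1) @^-1` ((fun G => readings G M) @^-1` P)).
  by apply/seteqP; split=> x /=; rewrite -/(cls x) reading_cls.
apply: open_comp; first by move=> x _; apply: initial_continuous.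
apply: open_comp; last exact: discrete_open.
move=> x _; apply: (@continuous_comp _ _ _ (fun x : params => x.1.1.1) fst); last exact: cvg_fst.
apply: (@continuous_comp _ _ _ (fun x : params => x.1.1) fst); last exact: cvg_fst.
apply: (@continuous_comp _ _ _ (fun x : params => x.1) fst); last exact: cvg_fst.
exact: cvg_fst.
Qed.

(** The reading is a function of the discrete component, so its fibers are open
    and closed. *)
Lemma component_reading z z' : connected_component [set: moduli] z z' ->
  moduli_reading z' = moduli_reading z.
Proof.
move=> [C [Cz _ Cc] Cz']; pose F := moduli_reading @^-1` [set moduli_reading z].
have : C `&` F = C.
  apply: Cc; first by exists z.
  - by exists F => //; apply: moduli_reading_open.
  - exists F => //; rewrite -[F]setCK; apply: open_closedC.
    exact: (moduli_reading_open (~` [set moduli_reading z])).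
by move=> CF; move: Cz'; rewrite -CF => -[].
Qed.

Lemma path_component (f : R -> data) s t : continuous f ->
  connected_component [set: moduli] (cls (f s)) (cls (f t)).
Proof.
move=> fc; have : connected [set cls (f u) | u in [set: R]].
  apply: connected_continuous_connected; first by apply/connected_intervalP.
  apply: continuous_subspaceT => u; apply: continuous_comp; first exact: fc.
  exact: pi_continuous.
by move=> co; apply: (connected_component_max _ _ co); [exists s|done|exists t].
Qed.

Lemma segment_component G rho w K L K' L' (x x' : data) :
  set_val x = hcmu_point G K rho L w -> set_val x' = hcmu_point G K' rho L' w ->
  (forall s, 0 <= s <= 1 -> data (hcmu_point G (K + (K' - K) * s) rho (L + (L' - L) * s) w)) ->
  connected_component [set: moduli] (cls x) (cls x').
Proof.
move=> xE x'E seg; pose S (t : R) := sin t ^+ 2.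
have S01 t : 0 <= S t <= 1.
  by rewrite sqr_ge0 /S sin2cos2 lerBlDr lerDl sqr_ge0.
(* A path defined on the whole line: the square of the sine covers [0, 1]. *)
pose f t : data := exist (fun u : params => u \in data) _ (mem_set (seg (S t) (S01 t))).
have fE t : set_val (f t) = hcmu_point G (K + (K' - K) * S t) rho (L + (L' - L) * S t) w by [].
have Sc : continuous S.
  move=> t; rewrite /S; apply: (@continuous_comp _ _ _ (sin : R -> R) (fun y => y ^+ 2)).
    exact: continuous_sin.
  exact: exprn_continuous.
have fc : continuous f.
  have pair (X Y : topologicalType) (a : R -> X) (b : R -> Y) :
      continuous a -> continuous b -> continuous (fun t => (a t, b t)).
    by move=> ac bc t; apply: cvg_pair; [apply: ac|apply: bc].
  have lin a b : continuous (fun t => a + b * S t).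
    by move=> t; apply: cvgD; [apply: cvg_cst|apply: cvgM; [apply: cvg_cst|apply: Sc]].
  have cst (X : topologicalType) (a : X) : continuous (fun _ : R => a) by move=> t; apply: cvg_cst.
  apply: continuous_comp_initial.
  exact: (pair _ _ _ _ (pair _ _ _ _ (pair _ _ _ _ (pair _ _ _ _
    (cst _ (G : discrete_topology graph)) (lin K (K' - K)))
    (cst _ rho)) (lin L (L' - L))) (cst _ w)).
have -> : x = f 0.
  by apply: val_inj; rewrite /= -[LHS]/(set_val x) xE /S sin0 expr0n /= !mulr0 !addr0.
have -> : x' = f (pi / 2).
  by apply: val_inj; rewrite /= -[LHS]/(set_val x') x'E /S sin_pihalf expr1n !mulr1 ![_ + (_ - _)]addrC !subrK.
exact: path_component.
Qed.

Let sqrtV_lt K Kmax : 0 < K -> K <= Kmax -> (Num.sqrt Kmax)^-1 <= (Num.sqrt K)^-1.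
Proof.
move=> K0 KK; have Km := lt_le_trans K0 KK.
by rewrite lef_pV2 ?posrE ?sqrtr_gt0 // ler_sqrt // ltW.
Qed.

Let between (a b s : R) : 0 < a -> 0 < b -> 0 <= s <= 1 -> 0 < a + (b - a) * s.
Proof.
move=> a0 b0 /andP[s0 s1]; have -> : a + (b - a) * s = a * (1 - s) + b * s by ring.
have [s_lt|s_ge] := ltP s 1; first by rewrite ltr_pwDl // ?mulr_gt0 ?mulr_ge0 // ?subr_gt0 // ltW.
by have -> : s = 1; [apply/eqP; rewrite eq_le s1 s_ge|rewrite subrr mulr0 add0r mulr1].
Qed.

Let below (a b c s : R) : a <= c -> b <= c -> 0 <= s <= 1 -> a + (b - a) * s <= c.
Proof.
move=> ac bc /andP[s0 s1]; have -> : c = c * (1 - s) + c * s by ring.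
have -> : a + (b - a) * s = a * (1 - s) + b * s by ring.
by rewrite lerD // ler_wpM2r // subr_ge0.
Qed.

(** Lower the saddle point to a height below all meridian lengths in question,
    then move the curvature, then raise the saddle point again. *)
Lemma fiber_component G rho w K L K' L' (x x' : data) :
  set_val x = hcmu_point G K rho L w -> set_val x' = hcmu_point G K' rho L' w ->
  connected_component [set: moduli] (cls x) (cls x').
Proof.
move=> xE x'E.
have Dx : data (hcmu_point G K rho L w) by rewrite -xE; apply: set_valP.
have Dx' : data (hcmu_point G K' rho L' w) by rewrite -x'E; apply: set_valP.
have [_ K0 rho01 [L0 Ll] _] := Dx; have [_ K'0 _ [L'0 L'l] _] := Dx'.
pose Kmax := Num.max K K'; have KK : K <= Kmax by rewrite le_max lexx.
have KK' : K' <= Kmax by rewrite le_max lexx orbT.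
have Km0 : 0 < (Num.sqrt Kmax)^-1 by rewrite invr_gt0 sqrtr_gt0 (lt_le_trans K0).
pose L1 := Num.min (Num.min L L') ((Num.sqrt Kmax)^-1 / 2).
have L10 : 0 < L1 by rewrite !lt_min L0 L'0 divr_gt0.
have L1L : L1 <= L by rewrite !ge_min lexx.
have L1L' : L1 <= L' by rewrite !ge_min lexx orbT.
have low k : 0 < k -> k <= Kmax -> (L1%:E < meridian_length k rho)%E.
  move=> k0 kK; apply: lt_le_trans (meridian_length_ge k0 rho01); rewrite lte_fin.
  apply: lt_le_trans (sqrtV_lt k0 kK); rewrite gt_min; apply/orP; right.
  by rewrite ltr_pdivrMr // ltr_pMr // ltr1n.
pose mk k l (D : data (hcmu_point G k rho l w)) : data := exist (fun u : params => u \in data) _ (mem_set D).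
have D1 : data (hcmu_point G K rho L1 w) by apply: (data_move Dx) => //; apply: low.
have D1' : data (hcmu_point G K' rho L1 w) by apply: (data_move Dx) => //; apply: low.
apply: (@connected_component_trans _ _ (cls (mk _ _ D1))).
  apply: (segment_component xE (x' := mk _ _ D1) (erefl _)) => s s01; rewrite subrr mul0r addr0.
  apply: (data_move Dx) => //; first exact: between.
  by apply: le_lt_trans Ll; rewrite lee_fin below.
apply: (@connected_component_trans _ _ (cls (mk _ _ D1'))).
  apply: (segment_component (x := mk _ _ D1) (erefl _) (x' := mk _ _ D1') (erefl _)) => s s01.
  rewrite subrr mul0r addr0; apply: (data_move Dx) => //; first exact: between.
  by apply: low; [apply: between|apply: below].
apply: (segment_component (x := mk _ _ D1') (erefl _) x'E) => s s01; rewrite subrr mul0r addr0.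
apply: (data_move Dx) => //; first exact: between.
by apply: le_lt_trans L'l; rewrite lee_fin below.
Qed.

(** An isomorphism of the graphs carries the weights along, so one of the points
    can be moved to the graph of the other. *)
Lemma reading_component z z' : moduli_reading z = moduli_reading z' ->
  connected_component [set: moduli] z z'.
Proof.
rewrite -(reprK_cls z) -(reprK_cls z'); set x := generic_quotient.repr z; set x' := generic_quotient.repr z'.
rewrite !reading_cls /graph_of.
case xE: (set_val x) => [[[[G K] rho] L] w]; case x'E: (set_val x') => [[[[G' K'] rho'] L'] w'].
have Dx : data (hcmu_point G K rho L w) by rewrite -[hcmu_point _ _ _ _ _]xE; apply: set_valP.
have Dx' : data (hcmu_point G' K' rho' L' w') by rewrite -[hcmu_point _ _ _ _ _]x'E; apply: set_valP.
move=> /= kk; have tl := data_tree Dx; have tl' := data_tree Dx'.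
have rE := data_ratio Dx; have rE' := data_ratio Dx'.
have cE : #|'I_M.+1| = M.+1 by rewrite card_ord.
have [v bv] := data_weights Dx.
have /imsetP[u _ uE] := readings_in tl cE p0 q0 (ltnW qp) alE (card_ord p) (card_ord q) bv.
have uk : u \in readings G M by rewrite uE; apply: action.orbit_refl.
have [|fb [fw [fe iso]]] := iso_of_readings tl tl' cE cE erefl erefl (Ordinal p0) (Ordinal q0) uk.
  by rewrite -kk.
have we e : w' ord0 (fe e) = w ord0 e.
  case: (Dx) => _ _ _ _ [_ bw ww]; case: (Dx') => _ _ _ _ [_ bw' ww'].
  have rho0 : rho != 0 by rewrite rE mulf_neq0 ?invr_neq0 ?gt_eqF.
  apply: (balanced_iso (a := 1) (b := rho^-1) (w := fun e => w ord0 e) (w' := fun e => w' ord0 e) tl iso) => y.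
  - exact: bw.
  - by apply: (mulfI rho0); rewrite mulfV // ww.
  - exact: bw'.
  - by apply: (mulfI rho0); rewrite mulfV // {1}rE -rE' ww'.
have D : data (hcmu_point G K' rho L' w).
  by case: (Dx') => _ K'0 _ [L'0 L'l] _; apply: (data_move Dx) => //; rewrite rE -rE'.
pose y : data := exist (fun u : params => u \in data) _ (mem_set D).
have <- : cls y = cls x'.
  apply: cls_eq; apply/asboolP; rewrite x'E /=; split=> //; first by rewrite rE rE'.
  by exists fb, fw, fe.
exact: (fiber_component xE (x' := y) (erefl _)).
Qed.

Lemma hcmu_components_card : hcmu_components R M.+1 p q #= `I_#|rotation_classes M p q|.
Proof.
apply: (@card_classes _ (rotation_classes M p q) _ [set: moduli]
  (connected_component [set: moduli]) moduli_reading finset.set0) => [z _|O OX|z z' _ _].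
- rewrite /moduli_reading /graph_of; set x := generic_quotient.repr z.
  case xE: (set_val x) => [[[[G K] rho] L] w] /=.
  have D : data (hcmu_point G K rho L w) by rewrite -[hcmu_point _ _ _ _ _]xE; apply: set_valP.
  have [v bv] := data_weights D.
  exact: (readings_in (data_tree D) (card_ord _) p0 q0 (ltnW qp) alE (card_ord p) (card_ord q) bv).
- have [G [v [tl [v0 bv wv] GO]]] := readings_surj p0 q0 alE OX.
  have rho01 : 0 < (q%:R / p%:R : R) < 1.
    by apply/andP; split; [apply: divr_gt0|rewrite ltr_pdivrMr // mul1r ltr_nat].
  have D : data (hcmu_point G 1 (q%:R / p%:R) 2^-1 (\row_e ((v e)%:R / q%:R))).
    split=> //.
    + split; last by rewrite (tree_faces ord0 tl).
      by split; [case: tl|rewrite (tree_faces ord0 tl) addn1; case: tl => _ ->; rewrite addn2].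
    + split; first by rewrite invr_gt0.
      apply: lt_le_trans (meridian_length_ge ltr01 rho01).
      by rewrite lte_fin sqrtr1 invr1 invf_lt1 // ltr1n.
    split=> [e|x|y]; first by rewrite mxE divr_gt0 // ltr0n.
      under eq_bigr do rewrite mxE; rewrite -mulr_suml -natr_sum.
      by rewrite bv divff // gt_eqF.
    under eq_bigr do rewrite mxE; rewrite -mulr_suml -natr_sum wv.
    by rewrite mulrA divfK ?divff // gt_eqF.
  pose x : data := exist (fun u : params => u \in data) _ (mem_set D).
  by exists (cls x); rewrite // reading_cls.
split=> [E|kk]; last exact/same_connected_component/reading_component.
apply/esym/component_reading; rewrite E; exact: connected_component_refl.
Qed.
End Moduli.

Theorem theorem1p9 (R : realType) (alpha p q : nat)
    (halpha : (1 < alpha)%N) (hq : (1 <= q)%N) (hpq : (q < p)%N)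
    (hapq : alpha = (p + q - 1)%N) :
  exists N : nat,
    [/\ hcmu_components R alpha p q #= `I_N,
        wbp_classes p q #= `I_N &
        N%:R = component_count p q].
Proof.
case: alpha halpha hapq => // M _ alE; have p0 : (0 < p)%N := ltn_trans hq hpq.
exists #|rotation_classes M p q|; split.
- exact: hcmu_components_card.
- exact: (wbp_classes_card p0 hq (ltnW hpq) alE).
exact: (rotation_classes_count p0 hq (ltnW hpq) alE).
Qed.
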